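(* If $\operatorname{Re}(a+b)<1$, and $b$ is not a positive integer, then for $0<x<\frac{\pi}{2}$ \begin{align*} {}_3F_2\left(\genfrac{}{}{0pt}{0}{1,\,a,\,b}{\frac{a+b}{2},\,\frac{1+a+b}{2}};\sin^2x\right)\cos x={}&\frac{a+b-1}{b-1}\sum_{n=0}^\infty \frac{(a)_n}{(2-b)_n}\cos\big((2n+1)x\big)\\ &+\frac{\Gamma(a+b)\Gamma(1-b)}{\Gamma(a)\,(2\sin x)^{a+b-1}}\,\sin\left(\tfrac{\pi}{2}(a+b)+x(b-a)\right). \end{align*}
   Context: Here $a,b$ are complex parameters and $x$ is real. $\Gamma$ is the Euler gamma function, $(c)_n=c(c+1)\cdots(c+n-1)$, $(c)_0=1$, is the Pochhammer symbol, and ${}_3F_2\left(\genfrac{}{}{0pt}{0}{a_1,a_2,a_3}{b_1,b_2};z\right)=\sum_{n=0}^\infty\frac{(a_1)_n(a_2)_n(a_3)_n}{(b_1)_n(b_2)_n}\frac{z^n}{n!}$ is the generalized hypergeometric series (convergent for $|z|<1$). Powers of the positive number $2\sin x$ are $(2\sin x)^{w}=e^{w\ln(2\sin x)}$. *)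

(* Defs.v *)
From Stdlib Require Export Reals Factorial.
From Coquelicot Require Export Coquelicot.

Open Scope C_scope.

Definition Cexp (z : C) : C := exp (Re z) * (cos (Im z), sin (Im z)).

Definition Csin (z : C) : C := (Cexp (Ci * z) - Cexp (- (Ci * z))) / (2 * Ci).

(* Meant for r > 0; Stdlib sets ln r = 0 for r <= 0. *)
Definition RCpower (r : R) (w : C) : C := Cexp (w * ln r).

Fixpoint poch (c : C) (n : nat) : C :=
  match n with
  | O => 1
  | S m => poch c m * (c + INR m)
  end.

(* As with Lim_seq and Series, the values of the next two are meaningful only
   in case of convergence. *)
Definition CLim_seq (u : nat -> C) : C :=
  (real (Lim_seq (fun n => Re (u n))), real (Lim_seq (fun n => Im (u n)))).

Definition CSeries (u : nat -> C) : C :=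
  (Series (fun n => Re (u n)), Series (fun n => Im (u n))).

Definition ex_Cseries (u : nat -> C) : Prop :=
  ex_series (V := C_R_NormedModule) u.

(* Euler's limit  Gamma(z) = lim_n n! n^z / (z (z+1) ... (z+n)), valid for every
   z that is not a pole.  At a pole z = -m the product vanishes for n >= m, so
   that (as / 0 = 0) Gamma z = 0 and / Gamma z = 0: the reciprocal has the value
   of the entire function 1/Gamma at every z. *)
Definition Gamma (z : C) : C :=
  CLim_seq (fun n => INR (fact n) * RCpower (INR n) z / poch z (S n)).

Definition F32_term (a1 a2 a3 b1 b2 z : C) (n : nat) : C :=
  poch a1 n * poch a2 n * poch a3 n / (poch b1 n * poch b2 n)
  * (z ^ n / INR (fact n)).

Definition F32 (a1 a2 a3 b1 b2 z : C) : C :=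
  CSeries (F32_term a1 a2 a3 b1 b2 z).

(* Main.v *)
Require Import Defs.
From Stdlib Require Import Reals Lra Lia Psatz Classical.
From Coquelicot Require Import Coquelicot.

(** Write [s = a + b], [z = e^(2ix)], and let [h(z)] be the sum of the series
    with coefficients [(a)_n / (2-b)_n].  The cosine series is the average of
    [e^(ix) h(z)] over [x] and [-x].  The recurrence of its coefficients makes
    [h] a solution of the first-order linear equation

      [(1 - z) z h' + (1 - b - a z) h = 1 - b],

    whose homogeneous solutions are the multiples of
    [z^(b-1) (1-z)^(1-s)].

    The hypergeometric side comes from a second solution of the same equation,
    the one that is analytic at [z = 1].  It is [(1-b)/(1-s) W(z)], where [W]
    is written with two power series in [T = - (1-z)^2 / (4z) = sin^2 x]: one
    has the coefficients [e_n] of the hypergeometric function, the other the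
    coefficients [(b-a) e_n / (s+2n)].  That it satisfies the equation follows
    from two first-order relations between the two series ([even_series_ode],
    [odd_series_ode], [reg_sol_ode]), and averaging [e^(ix) W(z)] over [x] and
    [-x] removes the second series and leaves the left-hand side of the theorem
    ([reg_sol_even_part]).

    Therefore [h - (1-b)/(1-s) W = K z^(b-1) (1-z)^(1-s)] with a constant [K],
    and averaging the right-hand side produces the sine term.  The equation shows
    that the product of [h - (1-b)/(1-s) W] and
    [z^(1-b) (1-z)^(s-1)], called [first_integral], has derivative zero; in the
    coordinate [w = log z] the domain where both solutions are defined is
    star-shaped towards [w = 0], so this product equals its limit at [z = 1].

    If [Re s > 1], the solution [W] does not contribute to that limit, and [h]
    is compared with the binomial series of [(1-z)^(1-s)]: the quotient of the
    coefficients tends to [Gamma(2-b) Gamma(s-1) / Gamma(a)] by Euler's limit,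
    and an Abelian theorem carries this over to the functions
    ([abel_comparison], [first_integral_const_large]).  For the other values of
    [s] the contiguous relations for [a -> a+1] multiply
    [first_integral] and the Gamma quotient by the same factor
    ([first_integral_raise], [conn_const_raise]).

    Finally [Re s < 1] makes the series of [h] absolutely convergent on the unit
    circle, so that the relation passes to [|z| = 1] along a radius
    ([boundary_connection]). *)

Open Scope C_scope.

(** * Complex numbers *)

Lemma C_ext (z w : C) : Re z = Re w -> Im z = Im w -> z = w.
Proof. destruct z, w; simpl; intros -> ->; reflexivity. Qed.

Lemma Re_scal_R (t : R) (w : C) : Re (t * w) = (t * Re w)%R.
Proof. simpl. unfold Re. ring. Qed.

Lemma Im_scal_R (t : R) (w : C) : Im (t * w) = (t * Im w)%R.
Proof. simpl. unfold Im. ring. Qed.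

Lemma Im_le_Cmod (z : C) : (Rabs (Im z) <= Cmod z)%R.
Proof.
  destruct (Rmax_Rle (Rabs (fst z)) (Rabs (snd z)) (Cmod z)) as [H _].
  generalize (Rmax_Cmod z); intros; unfold Im.
  eapply Rle_trans; [apply Rmax_r | eassumption].
Qed.

Lemma Cmod_le_Re_Im (z : C) : (Cmod z <= Rabs (Re z) + Rabs (Im z))%R.
Proof.
  rewrite <- (Rabs_pos_eq (Cmod z)) by apply Cmod_ge_0.
  rewrite <- (Rabs_pos_eq (Rabs (Re z) + Rabs (Im z)))
    by (generalize (Rabs_pos (Re z)) (Rabs_pos (Im z)); lra).
  apply Rsqr_le_abs_0. unfold Rsqr.
  generalize (Cmod2_alt z); intro H. simpl in H. rewrite !Rmult_1_r in H.
  rewrite H.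
  assert (forall t, (t * t = Rabs t * Rabs t)%R) as E
    by (intro t; rewrite <- Rabs_mult; symmetry; apply Rabs_pos_eq; nra).
  rewrite (E (Re z)), (E (Im z)).
  generalize (Rabs_pos (Re z)) (Rabs_pos (Im z)); nra.
Qed.

Lemma Cmod_triangle_inv (z w : C) : (Cmod z - Cmod w <= Cmod (z - w))%R.
Proof.
  generalize (Cmod_triangle (z - w) w).
  replace (z - w + w) with z by ring. lra.
Qed.

Lemma Re_one_minus z : (Cmod z < 1)%R -> (0 < Re (1 - z))%R.
Proof.
  intro Hz. assert (H := re_le_Cmod z). assert (H' := RRle_abs (Re z)).
  change (0 < 1 + - Re z)%R. lra.
Qed.

Lemma Re_pos_neq0 z : (0 < Re z)%R -> z <> 0.
Proof. intros H E. rewrite E in H. simpl in H. lra. Qed.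

Lemma C2_nz : RtoC 2 <> 0.
Proof. intro E. apply RtoC_inj in E. lra. Qed.

Lemma C4_nz : RtoC 4 <> 0.
Proof. intro E. apply RtoC_inj in E. lra. Qed.

Lemma INR_eventually_gt (M : R) : exists N, forall n, (N <= n)%nat -> (M < INR n)%R.
Proof.
  destruct (INR_archimed 1 M ltac:(lra)) as [N HN]. exists N. intros n Hn.
  apply le_INR in Hn. lra.
Qed.

Lemma RtoC_INR_S (n : nat) : RtoC (INR (S n)) = INR n + 1.
Proof. now rewrite S_INR, RtoC_plus. Qed.

Lemma Cmod_INR (n : nat) : Cmod (INR n) = INR n.
Proof. rewrite Cmod_R. apply Rabs_pos_eq, pos_INR. Qed.

Lemma RtoC_INR_double n : RtoC (INR (2 * n)) = 2 * INR n.
Proof. rewrite mult_INR, RtoC_mult. reflexivity. Qed.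

Lemma INR_fact_neq0_C n : RtoC (INR (fact n)) <> 0.
Proof. intro E. injection E. apply INR_fact_neq_0. Qed.

Lemma INR_S_neq0_C n : RtoC (INR (S n)) <> 0.
Proof. intro E. apply RtoC_inj in E. revert E. now apply not_0_INR. Qed.

Lemma one_plus_INR_neq0 n : 1 + INR n <> 0.
Proof.
  replace (1 + INR n) with (RtoC (INR (S n))) by (rewrite RtoC_INR_S; ring).
  apply INR_S_neq0_C.
Qed.

Lemma Cinv_0 : / RtoC 0 = 0.
Proof. apply C_ext; simpl; unfold Rdiv; ring. Qed.

Lemma Cinv_mult_total (z w : C) : / (z * w) = / z * / w.
Proof.
  destruct (classic (z = 0)) as [->|Hz]; [rewrite Cmult_0_l, Cinv_0; ring|].
  destruct (classic (w = 0)) as [->|Hw]; [rewrite Cmult_0_r, Cinv_0; ring|].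
  field. auto.
Qed.

(** * Series of complex numbers *)

(** Componentwise summability turns every statement about complex series into
    two statements about real ones, and matches the components of [CSeries].
    *)
Definition Csum (u : nat -> C) (l : C) : Prop :=
  is_series (fun n => Re (u n)) (Re l) /\ is_series (fun n => Im (u n)) (Im l).

Lemma Csum_unique u l : Csum u l -> CSeries u = l.
Proof.
  intros [H1 H2]. unfold CSeries.
  rewrite (is_series_unique _ _ H1), (is_series_unique _ _ H2).
  destruct l; reflexivity.
Qed.

Lemma Csum_ex u l : Csum u l -> ex_Cseries u.
Proof.
  intros [H1 H2]. exists l. intros P [eps HP].
  assert (HRe : forall n, Re (sum_n (G := C_R_NormedModule) u n)
                = sum_n (fun k => Re (u k)) n).
  { induction n as [|n IH]; [now rewrite !sum_O|].
    rewrite !sum_Sn, <- IH. reflexivity. }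
  assert (HIm : forall n, Im (sum_n (G := C_R_NormedModule) u n)
                = sum_n (fun k => Im (u k)) n).
  { induction n as [|n IH]; [now rewrite !sum_O|].
    rewrite !sum_Sn, <- IH. reflexivity. }
  destruct (H1 (ball (Re l) eps)) as [N1 HN1]; [now exists eps|].
  destruct (H2 (ball (Im l) eps)) as [N2 HN2]; [now exists eps|].
  exists (N1 + N2)%nat. intros n Hn. apply HP. split.
  - change (ball (Re l) eps (Re (sum_n (G := C_R_NormedModule) u n))).
    rewrite HRe. apply HN1. lia.
  - change (ball (Im l) eps (Im (sum_n (G := C_R_NormedModule) u n))).
    rewrite HIm. apply HN2. lia.
Qed.

Lemma Csum_ext u v l : (forall n, u n = v n) -> Csum u l -> Csum v l.
Proof.
  intros E [H1 H2]; split; [revert H1 | revert H2];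
    apply is_series_ext; intro n; now rewrite E.
Qed.

Lemma Csum_plus u v l m :
  Csum u l -> Csum v m -> Csum (fun n => u n + v n) (l + m).
Proof.
  intros [H1 H2] [H3 H4]; split; simpl;
    now apply (is_series_plus (K := R_AbsRing) (V := R_NormedModule)).
Qed.

Lemma Csum_scal k u l : Csum u l -> Csum (fun n => k * u n) (k * l).
Proof.
  intros [H1 H2]; split; simpl.
  - apply (is_series_minus (K := R_AbsRing) (V := R_NormedModule));
      now apply (is_series_scal (K := R_AbsRing) (V := R_NormedModule)).
  - apply (is_series_plus (K := R_AbsRing) (V := R_NormedModule));
      now apply (is_series_scal (K := R_AbsRing) (V := R_NormedModule)).
Qed.

Lemma Csum_minus u v l m :
  Csum u l -> Csum v m -> Csum (fun n => u n - v n) (l - m).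
Proof.
  intros H1 H2.
  apply (Csum_ext (fun n => u n + (-1) * v n)); [intro; ring|].
  replace (l - m) with (l + (-1) * m) by ring.
  now apply Csum_plus, Csum_scal.
Qed.

Lemma Csum_tail u l : Csum u l -> Csum (fun n => u (S n)) (l - u O).
Proof.
  intros [H1 H2]; split.
  - apply (is_series_incr_1 (K := R_AbsRing) (V := R_NormedModule)
             (fun n => Re (u n))).
    simpl. replace (plus _ _) with (Re l); [exact H1|].
    unfold plus; simpl; unfold Re; lra.
  - apply (is_series_incr_1 (K := R_AbsRing) (V := R_NormedModule)
             (fun n => Im (u n))).
    simpl. replace (plus _ _) with (Im l); [exact H2|].
    unfold plus; simpl; unfold Im; lra.
Qed.

Lemma Csum_cons u l : Csum (fun n => u (S n)) l -> Csum u (u O + l).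
Proof.
  intros [H1 H2]; split.
  - apply (is_series_decr_1 (K := R_AbsRing) (V := R_NormedModule)
             (fun n => Re (u n))).
    simpl. replace (plus _ _) with (Re l); [exact H1|].
    unfold plus, opp; simpl; unfold Re; lra.
  - apply (is_series_decr_1 (K := R_AbsRing) (V := R_NormedModule)
             (fun n => Im (u n))).
    simpl. replace (plus _ _) with (Im l); [exact H2|].
    unfold plus, opp; simpl; unfold Im; lra.
Qed.

Lemma Csum_abs u :
  ex_series (fun n => Cmod (u n)) -> Csum u (CSeries u).
Proof.
  intro H; split; simpl; apply Series_correct.
  - apply (ex_series_le (K := R_AbsRing) (V := R_CompleteNormedModule) _ (fun n => Cmod (u n))); [|exact H].
    intro n. apply re_le_Cmod.
  - apply (ex_series_le (K := R_AbsRing) (V := R_CompleteNormedModule) _ (fun n => Cmod (u n))); [|exact H].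
    intro n. apply Im_le_Cmod.
Qed.

Lemma is_series_le (u v : nat -> R) (l m : R) :
  (forall n, (u n <= v n)%R) -> is_series u l -> is_series v m -> (l <= m)%R.
Proof.
  intros H H1 H2.
  assert (H' : Rbar_le l m); [|exact H'].
  apply (is_lim_seq_le (sum_n u) (sum_n v)); [|exact H1|exact H2].
  intro n. now apply sum_n_m_le.
Qed.

(** Rotating the sum onto the positive real axis turns the triangle inequality
    for infinitely many terms into a comparison of real series. *)
Lemma Csum_bound u v l m :
  (forall n, (Cmod (u n) <= v n)%R) -> Csum u l -> is_series v m ->
  (Cmod l <= m)%R.
Proof.
  intros H Hu Hv.
  destruct (Req_dec (Cmod l) 0) as [H0|H0].
  { rewrite H0.
    apply (is_series_le (fun _ => 0%R) v); [|..|exact Hv].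
    - intro n. generalize (H n) (Cmod_ge_0 (u n)); lra.
    - replace 0%R with (scal 0 m)%R by (unfold scal; simpl; unfold mult; simpl; ring).
      apply (is_series_ext (fun n => scal 0%R (v n))).
      + intro n; unfold scal; simpl; unfold mult; simpl; ring.
      + now apply (is_series_scal (K := R_AbsRing) (V := R_NormedModule)). }
  assert (Hp : (0 < Cmod l)%R) by (generalize (Cmod_ge_0 l); lra).
  (* [Cmod l ^ 2] is the sum of the real parts of [Cconj l * u n]. *)
  apply (Rmult_le_reg_l (Cmod l)); [exact Hp|].
  replace (Cmod l * Cmod l)%R with (Re (Cconj l * l))
    by (generalize (Cmod2_alt l); simpl; unfold Re, Im; lra).
  apply (is_series_le (fun n => Re (Cconj l * u n)) (fun n => scal (Cmod l) (v n))).
  - intro n. eapply Rle_trans; [apply RRle_abs|].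
    eapply Rle_trans; [apply re_le_Cmod|].
    rewrite Cmod_mult, Cmod_conj. apply Rmult_le_compat_l; [lra|apply H].
  - apply (Csum_scal _ _ _ Hu).
  - now apply (is_series_scal (K := R_AbsRing) (V := R_NormedModule)).
Qed.

(** The form in which recurrences between coefficients become relations
    between sums. *)
Lemma Csum_inj u v l m : (forall n, u n = v n) -> Csum u l -> Csum v m -> l = m.
Proof.
  intros E Hu Hv. rewrite <- (Csum_unique _ _ Hv).
  symmetry. apply Csum_unique. revert Hu. now apply Csum_ext.
Qed.

(** * Power series on the unit disc *)

(** Strong enough for convergence in the open unit disc, and preserved by
    products, shifts and formal differentiation. *)
Definition subgeom (c : nat -> C) : Prop :=
  forall eps : R, (0 < eps)%R -> exists N, forall n, (N <= n)%nat ->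
    (Cmod (c (S n)) <= (1 + eps) * Cmod (c n))%R.

Definition psum (c : nat -> C) (z : C) : C := CSeries (fun n => c n * z ^ n).

Lemma ex_series_ratio_le (u : nat -> R) (q : R) (N : nat) :
  (forall n, (0 <= u n)%R) -> (0 <= q < 1)%R ->
  (forall n, (N <= n)%nat -> (u (S n) <= q * u n)%R) -> ex_series u.
Proof.
  intros Hp Hq H. apply (ex_series_incr_n (K := R_AbsRing) (V := R_NormedModule) u N).
  apply (ex_series_le (K := R_AbsRing) (V := R_CompleteNormedModule) _ (fun n => (u N * q ^ n)%R)).
  - intro n. unfold norm; simpl; unfold abs; simpl. rewrite Rabs_pos_eq by apply Hp.
    induction n as [|n IH]; [rewrite Nat.add_0_r; simpl; lra|].
    rewrite Nat.add_succ_r. eapply Rle_trans; [apply H; lia|].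
    simpl. replace (u N * (q * q ^ n))%R with (q * (u N * q ^ n))%R by ring.
    apply Rmult_le_compat_l; [lra|exact IH].
  - apply (ex_series_scal (K := R_AbsRing) (V := R_NormedModule) (u N)).
    apply ex_series_geom. rewrite Rabs_pos_eq; lra.
Qed.

(** [(n+2)^(-1-eps)] is at most the decrease of [x^(-eps) / eps] from [n+1] to
    [n+2], and these decreases telescope. *)
Lemma ex_series_Rpower (eps : R) : (0 < eps)%R ->
  ex_series (fun n => Rpower (INR (S n)) (- (1 + eps))).
Proof.
  intro He.
  set (u := fun n => Rpower (INR (S n)) (- (1 + eps))).
  set (V := fun n => (Rpower (INR (S n)) (- eps) / eps)%R).
  assert (Hpos : forall n, (0 < INR (S n))%R) by (intro n; apply lt_0_INR; lia).
  assert (Hstep : forall n, (u (S n) <= V n - V (S n))%R).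
  { intro n. unfold u, V. set (x := INR (S n)). set (y := INR (S (S n))).
    assert (Hx : (0 < x)%R) by apply Hpos. assert (Hy : (0 < y)%R) by apply Hpos.
    assert (Exy : (y = x + 1)%R) by (unfold y; rewrite S_INR; reflexivity).
    assert (Hl : (/ y <= ln y - ln x)%R).
    { assert (H := exp_ineq1_le (ln x - ln y)).
      unfold Rminus in H. rewrite exp_plus, exp_Ropp, !exp_ln in H by assumption.
      assert (x * / y = 1 - / y)%R by (rewrite Exy; field; lra). lra. }
    assert (H := exp_ineq1_le (eps * (ln y - ln x))).
    assert (E1 : Rpower x (- eps) = (Rpower y (- eps) * exp (eps * (ln y - ln x)))%R).
    { unfold Rpower. rewrite <- exp_plus. f_equal. ring. }
    assert (E2 : Rpower y (- (1 + eps)) = (Rpower y (- eps) * / y)%R).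
    { replace (- (1 + eps))%R with (- eps + - (1))%R by ring. rewrite Rpower_plus. f_equal.
      rewrite Rpower_Ropp, Rpower_1 by exact Hy. reflexivity. }
    rewrite E1, E2.
    assert (Hp : (0 < Rpower y (- eps))%R) by apply exp_pos.
    replace (Rpower y (- eps) * exp (eps * (ln y - ln x)) / eps - Rpower y (- eps) / eps)%R
      with (Rpower y (- eps) * ((exp (eps * (ln y - ln x)) - 1) / eps))%R by (field; lra).
    apply Rmult_le_compat_l; [lra|].
    apply (Rmult_le_reg_l eps); [exact He|].
    replace (eps * ((exp (eps * (ln y - ln x)) - 1) / eps))%R
      with (exp (eps * (ln y - ln x)) - 1)%R by (field; lra). nra. }
  apply (ex_finite_lim_seq_incr _ (u O + V O)%R).
  - intro n. rewrite sum_Sn. unfold plus; simpl.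
    assert (0 < u (S n))%R by apply exp_pos. lra.
  - assert (H : forall n, (sum_n u n <= u O + V O - V n)%R).
    { induction n as [|n IH]; [rewrite sum_O; lra|].
      rewrite sum_Sn. unfold plus; simpl. generalize (Hstep n); lra. }
    intro n. assert (0 < V n)%R by (apply Rdiv_lt_0_compat; [apply exp_pos|exact He]).
    eapply Rle_trans; [apply H|lra].
Qed.

Lemma subgeom_conv c r : subgeom c -> (0 <= r < 1)%R ->
  ex_series (fun n => (Cmod (c n) * r ^ n)%R).
Proof.
  intros Hc Hr.
  destruct (Hc ((1 - r) / 2)%R ltac:(lra)) as [N HN].
  apply (ex_series_ratio_le _ ((1 + (1 - r) / 2) * r)%R N).
  - intro n. apply Rmult_le_pos; [apply Cmod_ge_0|apply pow_le; lra].
  - nra.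
  - intros n Hn. simpl.
    replace ((1 + (1 - r) / 2) * r * (Cmod (c n) * r ^ n))%R
      with ((1 + (1 - r) / 2) * Cmod (c n) * (r * r ^ n))%R by ring.
    apply Rmult_le_compat_r; [|now apply HN].
    apply Rmult_le_pos; [lra|apply pow_le; lra].
Qed.

Lemma subgeom_abs c z : subgeom c -> (Cmod z < 1)%R ->
  ex_series (fun n => Cmod (c n * z ^ n)).
Proof.
  intros Hc Hz. apply (ex_series_ext (fun n => (Cmod (c n) * Cmod z ^ n)%R)).
  - intro n. now rewrite Cmod_mult, Cmod_pow.
  - apply subgeom_conv; [exact Hc|]. split; [apply Cmod_ge_0|exact Hz].
Qed.

Lemma subgeom_psum c z : subgeom c -> (Cmod z < 1)%R ->
  Csum (fun n => c n * z ^ n) (psum c z).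
Proof. intros. now apply Csum_abs, subgeom_abs. Qed.

Lemma subgeom_mult c d : subgeom c -> subgeom d -> subgeom (fun n => c n * d n).
Proof.
  intros Hc Hd eps He.
  assert (Hm : (0 < Rmin (eps / 3) 1)%R) by (apply Rmin_pos; lra).
  assert (Hm1 := Rmin_l (eps / 3) 1). assert (Hm2 := Rmin_r (eps / 3) 1).
  set (d' := Rmin (eps / 3) 1) in *.
  destruct (Hc d' Hm) as [N1 H1].
  destruct (Hd d' Hm) as [N2 H2].
  exists (N1 + N2)%nat. intros n Hn. rewrite !Cmod_mult.
  specialize (H1 n ltac:(lia)). specialize (H2 n ltac:(lia)).
  apply Rle_trans with ((1 + d') * Cmod (c n) * ((1 + d') * Cmod (d n)))%R.
  - apply Rmult_le_compat; auto using Cmod_ge_0.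
  - replace ((1 + d') * Cmod (c n) * ((1 + d') * Cmod (d n)))%R
      with ((1 + d') * (1 + d') * (Cmod (c n) * Cmod (d n)))%R by ring.
    apply Rmult_le_compat_r; [apply Rmult_le_pos; apply Cmod_ge_0|nra].
Qed.

Lemma subgeom_shift c : subgeom c -> subgeom (fun n => c (S n)).
Proof.
  intros H eps He. destruct (H eps He) as [N HN]. exists N. intros n Hn. apply HN. lia.
Qed.

Lemma subgeom_ext c d : (forall n, c n = d n) -> subgeom c -> subgeom d.
Proof.
  intros E H eps He. destruct (H eps He) as [N HN]. exists N. intros n Hn.
  rewrite <- !E. now apply HN.
Qed.

Lemma subgeom_const (k : C) : subgeom (fun _ => k).
Proof.
  intros eps He. exists O. intros n _.
  generalize (Cmod_ge_0 k). nra.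
Qed.

Lemma Cmod_shift_le (p q : C) (eps : R) : (0 < eps)%R ->
  exists N, forall n, (N <= n)%nat ->
    (Cmod (p + INR n) <= (1 + eps) * Cmod (q + INR n))%R.
Proof.
  intro He.
  destruct (INR_eventually_gt (Cmod q + Cmod (p - q) / eps)%R) as [N HN].
  exists N. intros n Hn. specialize (HN n Hn).
  assert (H1 : (INR n - Cmod q <= Cmod (q + INR n))%R).
  { rewrite <- (Cmod_INR n) at 1. rewrite <- (Cmod_opp q).
    replace (q + INR n) with (INR n - - q) by ring. apply Cmod_triangle_inv. }
  assert (H2 := Cmod_triangle (p - q) (q + INR n)).
  replace (p - q + (q + INR n)) with (p + INR n) in H2 by ring.
  assert (H3 : (Cmod (p - q) <= eps * Cmod (q + INR n))%R); [|lra].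
  apply (Rmult_le_reg_l (/ eps)); [now apply Rinv_0_lt_compat|].
  replace (/ eps * (eps * Cmod (q + INR n)))%R with (Cmod (q + INR n)) by (field; lra).
  unfold Rdiv in HN. lra.
Qed.

Lemma subgeom_linear (p : C) : subgeom (fun n => p + INR n).
Proof.
  intros eps He. destruct (Cmod_shift_le (p + 1) p eps He) as [N HN].
  exists N. intros n Hn. rewrite RtoC_INR_S.
  replace (p + (INR n + 1)) with (p + 1 + INR n) by ring. now apply HN.
Qed.

Lemma subgeom_inv_linear (p : C) : (forall n, p + INR n <> 0) ->
  subgeom (fun n => / (p + INR n)).
Proof.
  intros Hp eps He. destruct (Cmod_shift_le p (p + 1) eps He) as [N HN].
  exists N. intros n Hn. specialize (HN n Hn).
  replace (p + 1 + INR n) with (p + INR (S n)) in HN by (rewrite RtoC_INR_S; ring).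
  rewrite !Cmod_inv by apply Hp.
  assert (H1 := proj1 (Cmod_gt_0 _) (Hp n)). assert (H2 := proj1 (Cmod_gt_0 _) (Hp (S n))).
  apply (Rmult_le_reg_l (Cmod (p + INR (S n)) * Cmod (p + INR n))).
  { now apply Rmult_lt_0_compat. }
  field_simplify; lra.
Qed.

Lemma subgeom_ratio c p q : (forall n, q + INR n <> 0) ->
  (forall n, c (S n) = c n * ((p + INR n) / (q + INR n))) -> subgeom c.
Proof.
  intros Hq Hc eps He. destruct (Cmod_shift_le p q eps He) as [N HN].
  exists N. intros n Hn. specialize (HN n Hn).
  assert (H1 := proj1 (Cmod_gt_0 _) (Hq n)).
  rewrite Hc, Cmod_mult, Cmod_div by apply Hq.
  rewrite Rmult_comm. apply Rmult_le_compat_r; [apply Cmod_ge_0|].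
  apply (Rmult_le_reg_r (Cmod (q + INR n))); [exact H1|].
  field_simplify; lra.
Qed.

(** * Complex differentiation *)

(** [C] is taken as a normed module over itself through its absolute value, so
    that the general rules for products and compositions apply. *)
Definition is_Cd (f : C -> C) (z l : C) : Prop :=
  @is_derive C_AbsRing (AbsRing_NormedModule C_AbsRing) f z l.

Lemma is_Cd_iff f z l : is_Cd f z l <->
  forall eps : R, (0 < eps)%R -> exists delta : R, (0 < delta)%R /\
    forall k, (Cmod k < delta)%R ->
      (Cmod (f (z + k)%C - f z - l * k)%C <= eps * Cmod k)%R.
Proof.
  split.
  - intros [_ H] eps He.
    specialize (H z (fun P HP => HP) (mkposreal eps He)).
    destruct H as [d Hd]. exists d. split; [apply cond_pos|].
    intros k Hk. specialize (Hd (z + k)).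
    assert (E : z + k - z = k) by ring.
    change ((Cmod (z + k - z)%C < d)%R ->
      (Cmod (f (z + k)%C - f z - (z + k - z) * l)%C
       <= eps * Cmod (z + k - z)%C)%R) in Hd.
    rewrite E, (Cmult_comm k) in Hd. apply Hd.
    exact Hk.
  - intro H. split; [apply is_linear_scal_l|].
    intros x Hx.
    assert (Ex : z = x).
    { apply (is_filter_lim_locally_unique (K := C_AbsRing) (V := AbsRing_NormedModule C_AbsRing)).
      exact Hx. }
    subst x. intros [eps He]. destruct (H eps He) as [d [Hd1 Hd]].
    exists (mkposreal d Hd1). intros y Hy.
    change (Cmod (y - z) < d)%R in Hy.
    specialize (Hd (y - z) Hy). assert (E : @eq C (z + (y - z)) y) by ring. rewrite E in Hd.
    change (Cmod (f y - f z - (y - z) * l)%C <= eps * Cmod (y - z)%C)%R.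
    now rewrite (Cmult_comm (y - z)).
Qed.

Lemma is_Cd_quadratic f z l (M delta : R) : (0 < delta)%R ->
  (forall k, (Cmod k < delta)%R ->
     (Cmod (f (z + k)%C - f z - l * k)%C <= M * Cmod k ^ 2)%R) -> is_Cd f z l.
Proof.
  intros Hd H. apply is_Cd_iff. intros eps He.
  exists (Rmin delta (eps / (Rabs M + 1))).
  assert (HM := Rabs_pos M).
  assert (0 < eps / (Rabs M + 1))%R by (apply Rdiv_lt_0_compat; lra).
  split; [now apply Rmin_pos|]. intros k Hk.
  assert (Hk1 : (Cmod k < delta)%R) by (eapply Rlt_le_trans; [exact Hk|apply Rmin_l]).
  assert (Hk2 : (Cmod k < eps / (Rabs M + 1))%R) by (eapply Rlt_le_trans; [exact Hk|apply Rmin_r]).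
  eapply Rle_trans; [now apply H|].
  assert (HM2 := RRle_abs M). assert (Hk0 := Cmod_ge_0 k).
  assert (Hk3 : (Cmod k * (Rabs M + 1) <= eps)%R).
  { apply Rlt_le, (Rmult_lt_reg_r (/ (Rabs M + 1))); [apply Rinv_0_lt_compat; lra|].
    rewrite Rmult_assoc, Rinv_r by lra. unfold Rdiv in Hk2. lra. }
  simpl. rewrite Rmult_1_r.
  assert (M * Cmod k <= eps)%R by nra. nra.
Qed.

Lemma is_Cd_continuous f z l : is_Cd f z l ->
  forall eps : R, (0 < eps)%R -> exists delta : R, (0 < delta)%R /\
    forall k, (Cmod k < delta)%R -> (Cmod (f (z + k)%C - f z)%C < eps)%R.
Proof.
  intros H eps He. destruct (proj1 (is_Cd_iff f z l) H 1%R ltac:(lra)) as [d [Hd Hk]].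
  assert (Hl := Cmod_ge_0 l).
  exists (Rmin d (eps / (Cmod l + 2)))%R. split.
  { apply Rmin_pos; [lra|apply Rdiv_lt_0_compat; lra]. }
  intros k Hkd.
  assert (Hk1 : (Cmod k < d)%R) by (eapply Rlt_le_trans; [exact Hkd|apply Rmin_l]).
  assert (Hk2 : (Cmod k < eps / (Cmod l + 2))%R) by (eapply Rlt_le_trans; [exact Hkd|apply Rmin_r]).
  replace (f (z + k) - f z) with (f (z + k) - f z - l * k + l * k) by ring.
  eapply Rle_lt_trans; [apply Cmod_triangle|]. rewrite Cmod_mult.
  specialize (Hk k Hk1). assert (Hk0 := Cmod_ge_0 k).
  assert (Hk3 : (Cmod k * (Cmod l + 2) < eps)%R).
  { apply (Rmult_lt_reg_r (/ (Cmod l + 2))); [apply Rinv_0_lt_compat; lra|].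
    rewrite Rmult_assoc, Rinv_r by lra. unfold Rdiv in Hk2. lra. }
  nra.
Qed.

Lemma is_Cd_ext f g z l : (forall w, f w = g w) -> is_Cd f z l -> is_Cd g z l.
Proof. intros E H. exact (@is_derive_ext C_AbsRing (AbsRing_NormedModule C_AbsRing) f g z l E H). Qed.

Lemma is_Cd_eq f z l m : l = m -> is_Cd f z l -> is_Cd f z m.
Proof. now intros ->. Qed.

Lemma is_Cd_const k z : is_Cd (fun _ => k) z 0.
Proof. exact (is_derive_const (K := C_AbsRing) (V := AbsRing_NormedModule C_AbsRing) k z). Qed.

Lemma is_Cd_id z : is_Cd (fun w => w) z 1.
Proof. exact (is_derive_id (K := C_AbsRing) z). Qed.

Lemma is_Cd_plus f g z l m :
  is_Cd f z l -> is_Cd g z m -> is_Cd (fun w => f w + g w) z (l + m).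
Proof. exact (is_derive_plus (K := C_AbsRing) (V := AbsRing_NormedModule C_AbsRing) f g z l m). Qed.

Lemma is_Cd_mult f g z l m :
  is_Cd f z l -> is_Cd g z m -> is_Cd (fun w => f w * g w) z (l * g z + f z * m).
Proof.
  intros Hf Hg.
  exact (is_derive_mult (K := C_AbsRing) f g z l m Hf Hg Cmult_comm).
Qed.

Lemma is_Cd_comp f g z l m :
  is_Cd f (g z) l -> is_Cd g z m -> is_Cd (fun w => f (g w)) z (l * m).
Proof.
  intros Hf Hg. rewrite Cmult_comm.
  exact (is_derive_comp (K := C_AbsRing) (V := AbsRing_NormedModule C_AbsRing) f g z l m Hf Hg).
Qed.

Lemma is_Cd_scal k f z l : is_Cd f z l -> is_Cd (fun w => k * f w) z (k * l).
Proof.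
  intro H. apply (is_Cd_eq _ _ (0 * f z + k * l)); [ring|].
  exact (is_Cd_mult _ _ _ _ _ (is_Cd_const k z) H).
Qed.

Lemma is_Cd_minus f g z l m :
  is_Cd f z l -> is_Cd g z m -> is_Cd (fun w => f w - g w) z (l - m).
Proof.
  intros Hf Hg. apply (is_Cd_eq _ _ (l + (-1) * m)); [ring|].
  apply (is_Cd_ext (fun w => f w + (-1) * g w)); [intro; ring|].
  exact (is_Cd_plus _ _ _ _ _ Hf (is_Cd_scal _ _ _ _ Hg)).
Qed.

Lemma is_Cd_one_minus f z l : is_Cd f z l -> is_Cd (fun w => 1 - f w) z (- l).
Proof.
  intro H. apply (is_Cd_eq _ _ (0 + (-1) * l)); [ring|].
  apply (is_Cd_ext (fun w => 1 + (-1) * f w)); [intro; ring|].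
  exact (is_Cd_plus _ _ _ _ _ (is_Cd_const 1 z) (is_Cd_scal (-1) _ _ _ H)).
Qed.

Lemma is_Cd_inv_id (z : C) : z <> 0 -> is_Cd (fun w => / w) z (- / z ^ 2).
Proof.
  intro Hz. assert (Hp := proj1 (Cmod_gt_0 _) Hz).
  apply (is_Cd_quadratic _ _ _ (2 * / Cmod z ^ 3) (Cmod z / 2)); [lra|].
  intros k Hk.
  assert (Hzk : (Cmod z / 2 <= Cmod (z + k))%R).
  { assert (H := Cmod_triangle (z + k) (- k)). rewrite Cmod_opp in H.
    replace (z + k + - k) with z in H by ring. lra. }
  assert (Hzk0 : z + k <> 0) by (apply Cmod_gt_0; lra).
  replace (/ (z + k) - / z - - / z ^ 2 * k) with (k ^ 2 * / (z ^ 2 * (z + k)))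
    by (field; auto).
  assert (Hz2 : z ^ 2 <> 0) by (apply Cpow_nz; exact Hz).
  rewrite Cmod_mult, Cmod_inv, Cmod_mult, !Cmod_pow by now apply Cmult_neq_0.
  rewrite Rmult_comm. apply Rmult_le_compat_r; [apply pow_le, Cmod_ge_0|].
  replace (2 * / Cmod z ^ 3)%R with (/ (Cmod z ^ 2 * (Cmod z / 2)))%R by (field; lra).
  apply Rinv_le_contravar; [apply Rmult_lt_0_compat; [apply pow_lt|]; lra|].
  apply Rmult_le_compat_l; [apply pow_le; lra|exact Hzk].
Qed.

Lemma C_R_norm (z : C) : @norm R_AbsRing C_R_NormedModule z = Cmod z.
Proof.
  destruct z as [x y]. unfold Cmod.
  change (sqrt (Rabs x ^ 2 + Rabs y ^ 2) = sqrt (x ^ 2 + y ^ 2)).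
  now rewrite !pow2_abs.
Qed.

(** Along the segment the function depends on one real variable, and the mean
    value theorem applies to its components. *)
Lemma is_Cd_zero_segment f p v :
  (forall t : R, (0 <= t <= 1)%R -> is_Cd f (p + t * v) 0) -> f (p + v) = f p.
Proof.
  intro H.
  replace (f (p + v)) with (f (p + 1%R * v)) by (f_equal; ring).
  replace (f p) with (f (p + 0%R * v)) by (f_equal; ring).
  symmetry.
  apply (eq_is_derive (V := C_R_NormedModule) (fun t : R => f (p + t * v)) 0 1); [|lra].
  intros t Ht. specialize (proj1 (is_Cd_iff _ _ _) (H t Ht)); clear H; intro H.
  split; [apply is_linear_scal_l|].
  intros x Hx.
  assert (Ex : t = x).
  { apply (is_filter_lim_locally_unique (K := R_AbsRing) (V := R_NormedModule)). exact Hx. }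
  subst x. intros [eps He].
  assert (Hv := Cmod_ge_0 v).
  destruct (H (eps / (Cmod v + 1))%R) as [d [Hd1 Hd]]; [apply Rdiv_lt_0_compat; lra|].
  assert (Hd2 : (0 < d / (Cmod v + 1))%R) by (apply Rdiv_lt_0_compat; lra).
  exists (mkposreal _ Hd2). intros y Hy.
  change (Rabs (y - t) < d / (Cmod v + 1))%R in Hy.
  specialize (Hd (RtoC (y - t) * v)).
  rewrite Cmod_mult, Cmod_R in Hd.
  replace (p + t * v + (y - t)%R * v) with (p + y * v) in Hd
    by (rewrite RtoC_minus; ring).
  rewrite Cmult_0_l in Hd.
  assert (Hs : forall (r : R) (e : R), (0 < e)%R -> (Rabs r < e / (Cmod v + 1))%R ->
            (Rabs r * Cmod v < e)%R).
  { intros r e He' Hr. assert (Hr0 := Rabs_pos r).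
    apply (Rmult_lt_compat_r (Cmod v + 1)) in Hr; [|lra].
    unfold Rdiv in Hr. rewrite Rmult_assoc, Rinv_l in Hr by lra. nra. }
  specialize (Hd (Hs _ _ Hd1 Hy)).
  match goal with |- (norm ?A <= _)%R =>
    replace (norm A) with (Cmod (f (p + y * v) - f (p + t * v) - 0)) end.
  - eapply Rle_trans; [exact Hd|].
    change (eps / (Cmod v + 1) * (Rabs (y - t) * Cmod v) <= eps * Rabs (y - t))%R.
    unfold Rdiv. rewrite (Rmult_comm (Rabs _)), <- Rmult_assoc.
    apply Rmult_le_compat_r; [apply Rabs_pos|].
    rewrite Rmult_assoc. rewrite <- (Rmult_1_r eps) at 2.
    apply Rmult_le_compat_l; [lra|].
    apply (Rmult_le_reg_l (Cmod v + 1)); [lra|].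
    rewrite <- Rmult_assoc, Rinv_r by lra. lra.
  - transitivity (Cmod (f (p + y * v) - f (p + t * v)
                        - ((y - t) * 0, (y - t) * 0)%R)%C).
    + rewrite Rmult_0_r. reflexivity.
    + symmetry. exact (C_R_norm _).
Qed.

Definition dcoef (c : nat -> C) (n : nat) : C := INR (S n) * c (S n).

Lemma subgeom_dcoef c : subgeom c -> subgeom (dcoef c).
Proof.
  intro H. apply subgeom_mult; [|now apply subgeom_shift].
  apply (subgeom_ext (fun n => 1 + INR n)); [|apply subgeom_linear].
  intro n. rewrite RtoC_INR_S. ring.
Qed.

(** Second-order remainder of a power, with a factor [n (n-1)] that two formal
    differentiations of the power series absorb. *)
Lemma pow_taylor2 (z k : C) (rho : R) (n : nat) :
  (Cmod z <= rho)%R -> (Cmod (z + k) <= rho)%R ->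
  (Cmod ((z + k) ^ S (S n) - z ^ S (S n) - INR (S (S n)) * z ^ S n * k)
   <= INR (S n) * INR (S (S n)) * rho ^ n * Cmod k ^ 2)%R.
Proof.
  intros Hz Hzk.
  assert (Hr : (0 <= rho)%R) by (eapply Rle_trans; [apply Cmod_ge_0|exact Hz]).
  induction n as [|n IH].
  - replace ((z + k) ^ 2 - z ^ 2 - INR 2 * z ^ 1 * k) with (k ^ 2)
      by (simpl; rewrite RtoC_plus; ring).
    rewrite Cmod_pow. simpl. generalize (Cmod_ge_0 k). nra.
  - replace ((z + k) ^ S (S (S n)) - z ^ S (S (S n))
             - INR (S (S (S n))) * z ^ S (S n) * k)
      with ((z + k) * ((z + k) ^ S (S n) - z ^ S (S n) - INR (S (S n)) * z ^ S n * k)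
            + INR (S (S n)) * z ^ S n * k ^ 2)
      by (rewrite (RtoC_INR_S (S (S n))); simpl; ring).
    eapply Rle_trans; [apply Cmod_triangle|].
    rewrite !Cmod_mult, !Cmod_pow, Cmod_INR.
    set (D := Cmod (_ - _)) in *.
    assert (H1 : (Cmod z ^ S n <= rho ^ S n)%R)
      by (apply pow_incr; split; [apply Cmod_ge_0|exact Hz]).
    assert (H2 : (0 <= INR (S (S n)) * Cmod k ^ 2)%R)
      by (apply Rmult_le_pos; [apply pos_INR|apply pow_le, Cmod_ge_0]).
    assert (H3 : (Cmod (z + k) * D <= rho * D)%R)
      by (apply Rmult_le_compat_r; [apply Cmod_ge_0|exact Hzk]).
    assert (H4 : (rho * D <= rho * (INR (S n) * INR (S (S n)) * rho ^ n * Cmod k ^ 2))%R)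
      by (apply Rmult_le_compat_l; assumption).
    assert (H5 : (INR (S (S n)) * Cmod z ^ S n * Cmod k ^ 2
                  <= INR (S (S n)) * Cmod k ^ 2 * rho ^ S n)%R) by nra.
    assert (H6 : (0 <= INR (S (S n)) * Cmod k ^ 2 * rho ^ S n)%R)
      by (apply Rmult_le_pos; [exact H2|now apply pow_le]).
    replace (INR (S (S n)) * INR (S (S (S n))) * rho ^ S n * Cmod k ^ 2)%R
      with (rho * (INR (S n) * INR (S (S n)) * rho ^ n * Cmod k ^ 2)
            + 2 * (INR (S (S n)) * Cmod k ^ 2 * rho ^ S n))%R
      by (rewrite !S_INR; simpl; ring).
    lra.
Qed.

(** The remainders of the single powers are at most [Cmod k ^ 2] times the
    terms of the twice differentiated series at a radius [rho] between [Cmod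
    z] and [1]. *)
Lemma psum_derive c z : subgeom c -> (Cmod z < 1)%R ->
  is_Cd (psum c) z (psum (dcoef c) z).
Proof.
  intros Hc Hz. set (rho := ((1 + Cmod z) / 2)%R).
  assert (Hz0 := Cmod_ge_0 z).
  assert (Hd2 : subgeom (dcoef (dcoef c))) by now apply subgeom_dcoef, subgeom_dcoef.
  assert (Hr : (0 <= rho < 1)%R) by (unfold rho; lra).
  destruct (subgeom_conv _ rho Hd2 Hr) as [M HM].
  apply (is_Cd_quadratic _ _ _ M (rho - Cmod z)); [unfold rho; lra|].
  intros k Hk.
  assert (Hzk : (Cmod (z + k) <= rho)%R)
    by (eapply Rle_trans; [apply Cmod_triangle|lra]).
  assert (S0 := Csum_minus _ _ _ _ (subgeom_psum c (z + k) Hc ltac:(lra))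
                 (subgeom_psum c z Hc Hz)).
  apply Csum_tail in S0.
  assert (S1 := Csum_scal k _ _ (subgeom_psum _ z (subgeom_dcoef c Hc) Hz)).
  assert (S2 := Csum_minus _ _ _ _ S0 S1).
  apply Csum_tail in S2.
  match type of S2 with Csum _ ?L =>
    replace L with (psum c (z + k) - psum c z - psum (dcoef c) z * k) in S2
      by (unfold dcoef; simpl; ring) end.
  rewrite Rmult_comm.
  eapply Csum_bound; [|exact S2|].
  2: { exact (is_series_scal (K := R_AbsRing) (V := R_NormedModule) (Cmod k ^ 2)%R _ _ HM). }
  intro n.
  unfold scal; simpl; unfold mult; simpl.
  replace (Cmod _)
    with (Cmod (c (S (S n)) * ((z + k) ^ S (S n) - z ^ S (S n) - INR (S (S n)) * z ^ S n * k)))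
    by (f_equal; unfold dcoef; simpl; ring).
  rewrite Cmod_mult. unfold dcoef. rewrite !Cmod_mult, !Cmod_INR.
  assert (H := pow_taylor2 z k rho n ltac:(unfold rho; lra) Hzk).
  apply (Rmult_le_compat_l (Cmod (c (S (S n))))) in H; [|apply Cmod_ge_0].
  eapply Rle_trans; [exact H|]. right. simpl. ring.
Qed.

Lemma psum_0 c : subgeom c -> psum c 0 = c O.
Proof.
  intro Hc.
  apply Csum_unique.
  assert (H : Csum (fun n => 0 * (c n * 0 ^ n)) (0 * psum c 0)).
  { apply Csum_scal, subgeom_psum; [exact Hc|]. rewrite Cmod_0. lra. }
  replace (c O) with (c O * 0 ^ 0 + 0 * psum c 0) by (simpl; ring).
  apply (Csum_cons (fun n => c n * 0 ^ n)).
  revert H. apply Csum_ext. intro; simpl; ring.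
Qed.

(** The series of the Euler operator [z d/dz], which acts on the coefficient
    of [z ^ n] as multiplication by [n]. *)
Lemma psum_theta c z : subgeom c -> (Cmod z < 1)%R ->
  Csum (fun n => INR n * c n * z ^ n) (z * psum (dcoef c) z).
Proof.
  intros Hc Hz.
  assert (H := Csum_scal z _ _ (subgeom_psum _ z (subgeom_dcoef c Hc) Hz)).
  replace (z * psum (dcoef c) z)
    with (INR 0 * c O * z ^ 0 + z * psum (dcoef c) z) by (simpl; ring).
  apply (Csum_cons (fun n => INR n * c n * z ^ n)).
  revert H. apply Csum_ext. intro n. unfold dcoef. rewrite Cpow_S. ring.
Qed.

Lemma psum_tail c z : subgeom c -> (Cmod z < 1)%R ->
  Csum (fun n => c (S n) * z ^ S n) (psum c z - c O).
Proof.
  intros Hc Hz. assert (H := Csum_tail _ _ (subgeom_psum c z Hc Hz)).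
  simpl in H. rewrite Cmult_1_r in H. exact H.
Qed.

(** * Pochhammer symbols *)

Lemma poch_S c n : poch c (S n) = poch c n * (c + INR n).
Proof. reflexivity. Qed.

Lemma poch_S_l c n : poch c (S n) = c * poch (c + 1) n.
Proof.
  induction n as [|n IH]; [simpl; ring|].
  rewrite poch_S, IH, poch_S, RtoC_INR_S. ring.
Qed.

Lemma poch_1 n : poch 1 n = INR (fact n).
Proof.
  induction n as [|n IH]; [reflexivity|].
  rewrite poch_S, IH. change (fact (S n)) with (S n * fact n)%nat.
  rewrite mult_INR, RtoC_mult, RtoC_INR_S. ring.
Qed.

(** The Pochhammer symbol of a non-positive integer ends in zeros, which gives
    [1/Gamma] the value [0] there. *)
Lemma poch_pole (m n : nat) : (m < n)%nat -> poch (- INR m) n = 0.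
Proof.
  induction 1 as [|n H IH]; rewrite poch_S; [ring|rewrite IH; ring].
Qed.

Lemma poch_neq0 c n : (forall n, c + INR n <> 0) -> poch c n <> 0.
Proof.
  intro H. induction n as [|n IH]; simpl; [apply C1_nz|].
  apply Cmult_neq_0; auto.
Qed.

Definition poch_quot (p q : C) (n : nat) : C := poch p n / poch q n.

Lemma poch_quot_S p q n : (forall n, q + INR n <> 0) ->
  (q + INR n) * poch_quot p q (S n) = (p + INR n) * poch_quot p q n.
Proof.
  intro Hq. unfold poch_quot. rewrite !poch_S. field.
  split; auto using poch_neq0.
Qed.

Lemma subgeom_poch_div p q : (forall n, q + INR n <> 0) ->
  subgeom (poch_quot p q).
Proof.
  intro Hq. apply (subgeom_ratio _ p q Hq). intro n. unfold poch_quot. rewrite !poch_S. field.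
  split; [apply Hq|now apply poch_neq0].
Qed.

Definition nonpole (s : C) : Prop := forall n : nat, s + INR n <> 0.

Lemma nonpole_half s : nonpole s -> forall n, s / 2 + INR n <> 0.
Proof.
  intros H n E. apply (H (2 * n)%nat). rewrite mult_INR, RtoC_mult.
  replace (s + INR 2 * INR n) with (2 * (s / 2 + INR n))
    by (simpl; rewrite RtoC_plus; field; apply C2_nz).
  rewrite E. ring.
Qed.

Lemma nonpole_half_S s : nonpole s -> forall n, (1 + s) / 2 + INR n <> 0.
Proof.
  intros H n E. apply (H (S (2 * n))). rewrite RtoC_INR_S, mult_INR, RtoC_mult.
  replace (s + (INR 2 * INR n + 1)) with (2 * ((1 + s) / 2 + INR n))
    by (simpl; rewrite RtoC_plus; field; apply C2_nz).
  rewrite E. ring.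
Qed.

Lemma nonpole_S s : nonpole s -> nonpole (s + 1).
Proof.
  intros H n. replace (s + 1 + INR n) with (s + INR (S n)) by (rewrite RtoC_INR_S; ring).
  apply H.
Qed.

Lemma nonpole_neq0 s : nonpole s -> s <> 0.
Proof. intros H E. apply (H O). rewrite E. simpl. ring. Qed.

Lemma nonpole_Re_pos s : (0 < Re s)%R -> nonpole s.
Proof.
  intros H n E. apply (f_equal Re) in E. simpl in E. generalize (pos_INR n).
  unfold Re in *. lra.
Qed.

Lemma nonpole_linear s n : nonpole s -> s + 2 * INR n <> 0 /\ s + 2 * INR n + 1 <> 0.
Proof.
  intro H. assert (E3 := H (2 * n)%nat). assert (E4 := H (S (2 * n))).
  rewrite RtoC_INR_S, RtoC_INR_double in E4. rewrite RtoC_INR_double in E3.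
  split; [exact E3|].
  replace (s + 2 * INR n + 1) with (s + (2 * INR n + 1)) by ring. exact E4.
Qed.

(** * Exponential and logarithm *)

Lemma Re_Cexp z : Re (Cexp z) = (exp (Re z) * cos (Im z))%R.
Proof. unfold Cexp. simpl. ring. Qed.

Lemma Im_Cexp z : Im (Cexp z) = (exp (Re z) * sin (Im z))%R.
Proof. unfold Cexp. simpl. ring. Qed.

Lemma Cexp_plus z w : Cexp (z + w) = Cexp z * Cexp w.
Proof.
  apply C_ext.
  - rewrite Re_Cexp. simpl. rewrite exp_plus, cos_plus. unfold Re, Im. ring.
  - rewrite Im_Cexp. simpl. rewrite exp_plus, sin_plus. unfold Re, Im. ring.
Qed.

Lemma Cexp_0 : Cexp 0 = 1.
Proof. apply C_ext; [rewrite Re_Cexp|rewrite Im_Cexp]; simpl;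
  rewrite exp_0, ?cos_0, ?sin_0; ring. Qed.

Lemma Cexp_opp_l z : Cexp (- z) * Cexp z = 1.
Proof. rewrite <- Cexp_plus. replace (- z + z) with (RtoC 0) by ring. apply Cexp_0. Qed.

Lemma Cexp_neq0 z : Cexp z <> 0.
Proof.
  intro H. assert (E := Cexp_opp_l z). rewrite H, Cmult_0_r in E.
  apply C1_nz. now symmetry.
Qed.

Lemma Cexp_opp z : Cexp (- z) = / Cexp z.
Proof.
  rewrite <- (Cmult_1_l (/ Cexp z)), <- (Cexp_opp_l z).
  field. apply Cexp_neq0.
Qed.

Lemma Cexp_minus z w : Cexp (z - w) = Cexp z / Cexp w.
Proof. unfold Cminus. now rewrite Cexp_plus, Cexp_opp. Qed.

Lemma Cexp_R (x : R) : Cexp x = exp x.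
Proof.
  apply C_ext; [rewrite Re_Cexp|rewrite Im_Cexp]; simpl;
  rewrite ?cos_0, ?sin_0; ring.
Qed.

Lemma Cmod_Cexp z : Cmod (Cexp z) = exp (Re z).
Proof.
  unfold Cexp. rewrite Cmod_mult, Cmod_R, Rabs_pos_eq by (left; apply exp_pos).
  replace (Cmod (cos (Im z), sin (Im z))) with 1%R; [ring|].
  unfold Cmod. simpl. rewrite !Rmult_1_r.
  generalize (sin2_cos2 (Im z)). unfold Rsqr. intro H.
  rewrite Rplus_comm, H. symmetry. apply sqrt_1.
Qed.

Lemma one_minus_cos_le (y : R) : (0 <= 1 - cos y <= y ^ 2 / 2)%R.
Proof.
  split; [generalize (COS_bound y); lra|].
  replace y with (2 * (y / 2))%R at 1 by field.
  rewrite cos_2a_sin.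
  assert (H : (Rabs (sin (y / 2)) <= Rabs (y / 2))%R).
  { destruct (Rle_dec 0 (y / 2)) as [Hy|Hy].
    - rewrite (Rabs_pos_eq (y / 2)) by exact Hy.
      destruct (Req_dec (y / 2) 0) as [->|H0]; [rewrite sin_0, Rabs_R0; lra|].
      apply Rabs_le. assert (sin (y / 2) < y / 2)%R by (apply sin_lt_x; lra).
      split; [|lra].
      destruct (Rle_dec (y / 2) 1).
      + assert (0 < sin (y / 2))%R by (apply sin_gt_0; generalize PI_4, PI2_1; lra). lra.
      + generalize (SIN_bound (y / 2)); lra.
    - rewrite (Rabs_left (y / 2)) by lra. rewrite <- Rabs_Ropp, <- sin_neg.
      apply Rabs_le. assert (sin (- (y / 2)) < - (y / 2))%R by (apply sin_lt_x; lra).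
      split; [|lra].
      destruct (Rle_dec (- (y / 2)) 1).
      + assert (0 < sin (- (y / 2)))%R by (apply sin_gt_0; generalize PI2_1; lra). lra.
      + generalize (SIN_bound (- (y / 2))); lra. }
  apply Rsqr_le_abs_1 in H. unfold Rsqr in H. lra.
Qed.

Lemma sin_minus_id_le (y : R) : (Rabs (sin y - y) <= y ^ 2)%R.
Proof.
  destruct (MVT_gen (fun t => (sin t - t)%R) 0 y (fun t => (cos t - 1)%R)) as [c [Hc E]].
  - intros t _. auto_derive; [exact I|ring].
  - intros t _. apply continuity_pt_minus; [apply continuity_sin|].
    apply derivable_continuous_pt, derivable_pt_id.
  - rewrite sin_0 in E.
    replace (sin y - y)%R with ((cos c - 1) * y)%R by lra.
    rewrite Rabs_mult.
    assert (H1 := one_minus_cos_le c). assert (H2 := COS_bound c).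
    assert (Hcy : (Rabs c <= Rabs y)%R).
    { unfold Rmin, Rmax in Hc. destruct (Rle_dec 0 y).
      - rewrite !Rabs_pos_eq; lra.
      - rewrite !Rabs_left1; lra. }
    assert (H3 : (Rabs (cos c - 1) <= Rabs c)%R).
    { rewrite Rabs_left1 by lra. rewrite <- (pow2_abs c) in H1.
      destruct (Rle_dec (Rabs c) 2); [|lra]. assert (Hc0 := Rabs_pos c). nra. }
    rewrite <- (pow2_abs y).
    assert (Hy0 := Rabs_pos y). nra.
Qed.

Lemma exp_minus_1_id_le (x : R) : (0 <= exp x - 1 - x <= x ^ 2 * exp (Rabs x))%R.
Proof.
  assert (H := exp_ineq1_le x). split; [lra|].
  assert (H' := exp_ineq1_le (- x)).
  assert (E : (exp (- x) * exp x = 1)%R)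
    by (rewrite <- exp_plus, Rplus_opp_l; apply exp_0).
  assert (H1 : (exp x - 1 <= x * exp x)%R) by (generalize (exp_pos x); nra).
  destruct (Rle_dec 0 x) as [Hx|Hx].
  - rewrite Rabs_pos_eq by exact Hx. nra.
  - rewrite Rabs_left by lra.
    assert (1 <= exp (- x))%R by lra.
    assert (x * exp x - x <= x ^ 2)%R by nra. nra.
Qed.

(** With [d = x + iy], the remainder splits into that of [exp x], rotated by
    [e^(iy)], the remainders of [cos y] and [sin y] times [1 + x], and the
    product [i x y]. *)
Lemma Cexp_taylor1 d : (Cmod (Cexp d - 1 - d) <= 4 * Cmod d ^ 2 * exp (Cmod d))%R.
Proof.
  destruct d as [x y].
  set (A := RtoC (exp x - 1 - x)). set (B := (cos y - 1, sin y - y)%R : C).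
  replace (Cexp (x, y) - 1 - (x, y))
    with (A * Cexp (0%R, y) + ((1 + x)%R * B + (0%R, (x * y)%R))).
  2: { apply C_ext; unfold Cexp, A, B; simpl; rewrite ?exp_0; ring. }
  assert (Hx := re_le_Cmod (x, y)). assert (Hy := Im_le_Cmod (x, y)).
  simpl in Hx, Hy. set (m := Cmod (x, y)) in *.
  assert (Hm : (0 <= m)%R) by apply Cmod_ge_0.
  assert (Hx0 := Rabs_pos x). assert (Hy0 := Rabs_pos y).
  assert (HA : (Cmod (A * Cexp (0%R, y)) <= m ^ 2 * exp m)%R).
  { rewrite Cmod_mult, Cmod_Cexp. simpl Re. rewrite exp_0, Rmult_1_r.
    unfold A. rewrite Cmod_R.
    destruct (exp_minus_1_id_le x) as [H1 H2]. rewrite Rabs_pos_eq by exact H1.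
    eapply Rle_trans; [exact H2|]. rewrite <- (pow2_abs x).
    apply Rmult_le_compat; [apply pow_le, Rabs_pos|left; apply exp_pos| |].
    - apply pow_incr; lra.
    - destruct (Rle_lt_or_eq_dec _ _ Hx) as [H|H]; [left; now apply exp_increasing|rewrite H; lra]. }
  assert (HB : (Cmod B <= 3 / 2 * m ^ 2)%R).
  { eapply Rle_trans; [apply Cmod_le_Re_Im|]. simpl Re; simpl Im.
    assert (H1 := one_minus_cos_le y). assert (H2 := sin_minus_id_le y).
    rewrite Rabs_left1 by lra. rewrite <- (pow2_abs y) in H1, H2. nra. }
  assert (He := exp_ineq1_le m).
  assert (H1x : (Cmod (1 + x)%R <= exp m)%R).
  { rewrite Cmod_R. eapply Rle_trans; [apply Rabs_triang|]. rewrite Rabs_R1. lra. }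
  assert (HC : (Cmod (0%R, (x * y)%R) <= m ^ 2)%R).
  { eapply Rle_trans; [apply Cmod_le_Re_Im|]. simpl Re; simpl Im.
    rewrite Rabs_R0, Rabs_mult. nra. }
  eapply Rle_trans; [apply Cmod_triangle|].
  eapply Rle_trans; [apply Rplus_le_compat_l, Cmod_triangle|].
  rewrite (Cmod_mult (1 + x)%R B).
  assert (Cmod (1 + x)%R * Cmod B <= exp m * (3 / 2 * m ^ 2))%R
    by (apply Rmult_le_compat; auto using Cmod_ge_0).
  assert (m ^ 2 <= m ^ 2 * exp m)%R by nra. nra.
Qed.

Lemma Cexp_derive z : is_Cd Cexp z (Cexp z).
Proof.
  apply (is_Cd_quadratic _ _ _ (Cmod (Cexp z) * (4 * exp 1)) 1); [lra|].
  intros k Hk. rewrite Cexp_plus.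
  replace (Cexp z * Cexp k - Cexp z - Cexp z * k) with (Cexp z * (Cexp k - 1 - k)) by ring.
  rewrite Cmod_mult, Rmult_assoc. apply Rmult_le_compat_l; [apply Cmod_ge_0|].
  eapply Rle_trans; [apply Cexp_taylor1|].
  assert (exp (Cmod k) <= exp 1)%R by (left; apply exp_increasing; lra).
  assert (0 <= Cmod k ^ 2)%R by (apply pow_le, Cmod_ge_0). nra.
Qed.

Lemma is_Cd_exp f z l : is_Cd f z l -> is_Cd (fun w => Cexp (f w)) z (Cexp (f z) * l).
Proof. intro H. exact (is_Cd_comp Cexp f z _ _ (Cexp_derive (f z)) H). Qed.

(** Principal logarithm; [atan] gives the argument on the right half-plane
    only, which suffices since [1 - z] stays there for [Cmod z < 1]. *)
Definition Clog (z : C) : C := (ln (Cmod z), atan (Im z / Re z)).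

Lemma Cexp_Clog z : (0 < Re z)%R -> Cexp (Clog z) = z.
Proof.
  intro Hz.
  assert (Hm : (0 < Cmod z)%R)
    by (eapply Rlt_le_trans; [|apply re_le_Cmod]; rewrite Rabs_pos_eq; lra).
  assert (E : (Cmod z = Re z * sqrt (1 + (Im z / Re z)²))%R).
  { rewrite <- (sqrt_pow2 (Re z)) at 1 by lra. rewrite <- sqrt_mult_alt by (simpl; nra).
    unfold Cmod. f_equal. unfold Rsqr, Re, Im in *. field. lra. }
  assert (Hs : (0 < sqrt (1 + (Im z / Re z)²))%R)
    by (apply sqrt_lt_R0; generalize (Rle_0_sqr (Im z / Re z)); lra).
  apply C_ext; [rewrite Re_Cexp|rewrite Im_Cexp]; unfold Clog; simpl;
    rewrite exp_ln by exact Hm; rewrite ?cos_atan, ?sin_atan;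
    rewrite E; unfold Re, Im in *; field; lra.
Qed.

Lemma Clog_continuous z : (0 < Re z)%R ->
  forall eps : R, (0 < eps)%R -> exists delta : R, (0 < delta)%R /\
    forall k, (Cmod k < delta)%R -> (Cmod (Clog (z + k) - Clog z)%C < eps)%R.
Proof.
  intros Hz eps He.
  assert (Hm : (0 < Cmod z)%R)
    by (eapply Rlt_le_trans; [|apply re_le_Cmod]; rewrite Rabs_pos_eq; lra).
  assert (C1 : filterlim ln (locally (Cmod z)) (locally (ln (Cmod z)))).
  { apply continuity_pt_filterlim, derivable_continuous_pt.
    exists (/ Cmod z)%R. now apply derivable_pt_lim_ln. }
  assert (C2 : filterlim atan (locally (Im z / Re z)%R) (locally (atan (Im z / Re z)))).
  { apply continuity_pt_filterlim, derivable_continuous_pt, derivable_pt_atan. }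
  assert (C3 : filterlim (fun p : R * R => (snd p / fst p)%R) (locally (Re z, Im z))
                 (locally (Im z / Re z)%R)).
  { apply (filterlim_comp_2 (G := locally (Im z)) (H := locally (/ Re z)%R)
             (snd) (fun p : R * R => / fst p)%R Rmult).
    - apply filterlim_snd_aux || idtac.
      intros P [e HP]. exists e. intros y Hy. apply HP, Hy.
    - apply (filterlim_comp _ _ _ fst Rinv _ (locally (Re z))).
      + intros P [e HP]. exists e. intros y Hy. apply HP, Hy.
      + apply continuity_pt_filterlim, continuity_pt_inv; [|lra].
        apply derivable_continuous_pt, derivable_pt_id.
    - apply (filterlim_mult (K := R_AbsRing)). }
  destruct (C1 (ball (ln (Cmod z)) (mkposreal (eps / 2) ltac:(lra)))) as [d1 H1];
    [now exists (mkposreal (eps / 2) ltac:(lra))|].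
  destruct (filterlim_comp _ _ _ _ _ _ _ _ C3 C2
              (ball (atan (Im z / Re z)) (mkposreal (eps / 2) ltac:(lra)))) as [d2 H2];
    [now exists (mkposreal (eps / 2) ltac:(lra))|].
  exists (Rmin d1 d2). split; [apply Rmin_pos; apply cond_pos|].
  intros k Hk.
  assert (Hk1 : (Cmod k < d1)%R) by (eapply Rlt_le_trans; [exact Hk|apply Rmin_l]).
  assert (Hk2 : (Cmod k < d2)%R) by (eapply Rlt_le_trans; [exact Hk|apply Rmin_r]).
  eapply Rle_lt_trans; [apply Cmod_le_Re_Im|].
  replace eps with (eps / 2 + eps / 2)%R by field. apply Rplus_lt_compat.
  - unfold Clog; simpl. apply H1. change (Rabs (Cmod (z + k) - Cmod z) < d1)%R.
    apply Rabs_def1.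
    + assert (H := Cmod_triangle z k). lra.
    + assert (H := Cmod_triangle (z + k) (- k)). rewrite Cmod_opp in H.
      replace (z + k + - k) with z in H by ring. lra.
  - unfold Clog; simpl.
    change (Rabs (atan (Im (z + k) / Re (z + k)) - atan (Im z / Re z)) < eps / 2)%R.
    apply (H2 (Re (z + k), Im (z + k))%R). split; simpl.
    + change (Rabs (fst z + fst k - Re z) < d2)%R.
      replace (fst z + fst k - Re z)%R with (Re k) by (unfold Re; ring).
      eapply Rle_lt_trans; [apply re_le_Cmod|exact Hk2].
    + change (Rabs (snd z + snd k - Im z) < d2)%R.
      replace (snd z + snd k - Im z)%R with (Im k) by (unfold Im; ring).
      eapply Rle_lt_trans; [apply Im_le_Cmod|exact Hk2].
Qed.

(** Continuity upgrades to differentiability because [Cexp (Clog z) = z]: the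
    increment [D] of the logarithm and the increment [k] of its argument are
    related by [k = z (Cexp D - 1) = z D + O(D ^ 2)]. *)
Lemma Clog_derive z : (0 < Re z)%R -> is_Cd Clog z (/ z).
Proof.
  intro Hz.
  assert (Hm : (0 < Cmod z)%R)
    by (eapply Rlt_le_trans; [|apply re_le_Cmod]; rewrite Rabs_pos_eq; lra).
  assert (Hz0 : z <> 0) by now apply Cmod_gt_0.
  apply is_Cd_iff. intros eps He.
  set (E := (4 * exp 1)%R).
  assert (HE : (4 <= E)%R) by (unfold E; generalize (exp_ineq1_le 1); lra).
  set (e1 := Rmin (1 / (2 * E)) (eps * Cmod z / (2 * E))).
  assert (He1 : (0 < e1)%R).
  { apply Rmin_pos; apply Rdiv_lt_0_compat; try lra. now apply Rmult_lt_0_compat. }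
  destruct (Clog_continuous z Hz e1 He1) as [d [Hd Hk]].
  exists (Rmin d (Re z)). split; [now apply Rmin_pos|]. intros k Hkd.
  assert (Hk1 : (Cmod k < d)%R) by (eapply Rlt_le_trans; [exact Hkd|apply Rmin_l]).
  assert (Hk2 : (Cmod k < Re z)%R) by (eapply Rlt_le_trans; [exact Hkd|apply Rmin_r]).
  specialize (Hk k Hk1). set (D := Clog (z + k) - Clog z) in *.
  assert (HR : (0 < Re (z + k))%R).
  { change (0 < Re z + Re k)%R. assert (H := re_le_Cmod k).
    generalize (Rabs_maj2 (Re k)). lra. }
  assert (Ek : k = z * (Cexp D - 1)).
  { unfold D. rewrite Cexp_minus, !Cexp_Clog by assumption. field. exact Hz0. }
  assert (HT := Cexp_taylor1 D). set (r := Cexp D - 1 - D) in *.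
  assert (Hm1 := Rmin_l (1 / (2 * E)) (eps * Cmod z / (2 * E))).
  assert (Hm2 := Rmin_r (1 / (2 * E)) (eps * Cmod z / (2 * E))). fold e1 in Hm1, Hm2.
  assert (HD0 := Cmod_ge_0 D).
  assert (HED1 : (E * Cmod D <= 1 / 2)%R).
  { apply Rle_trans with (E * (1 / (2 * E)))%R; [apply Rmult_le_compat_l; lra|].
    right; field; lra. }
  assert (HED2 : (E * Cmod D <= eps * Cmod z / 2)%R).
  { apply Rle_trans with (E * (eps * Cmod z / (2 * E)))%R; [apply Rmult_le_compat_l; lra|].
    right; field; lra. }
  assert (HD1 : (Cmod D <= 1)%R) by nra.
  assert (Hr : (Cmod r <= E * Cmod D * Cmod D)%R).
  { eapply Rle_trans; [exact HT|]. unfold E.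
    assert (exp (Cmod D) <= exp 1)%R.
    { destruct (Rle_lt_or_eq_dec _ _ HD1) as [H|H]; [left; now apply exp_increasing|rewrite H; lra]. }
    assert (0 <= Cmod D ^ 2)%R by now apply pow_le. nra. }
  assert (Hkm : (Cmod z * (Cmod D / 2) <= Cmod k)%R).
  { rewrite Ek, Cmod_mult. apply Rmult_le_compat_l; [lra|].
    replace (Cexp D - 1) with (D - - r) by (unfold r; ring).
    eapply Rle_trans; [|apply Cmod_triangle_inv]. rewrite Cmod_opp. nra. }
  replace (D - / z * k) with (- r) by (unfold r; rewrite Ek at 1; field; exact Hz0).
  rewrite Cmod_opp. nra.
Qed.

Lemma Clog_Cexp v : (- (PI / 2) < Im v < PI / 2)%R -> Clog (Cexp v) = v.
Proof.
  intro Hv. unfold Clog. rewrite Cmod_Cexp, ln_exp, Re_Cexp, Im_Cexp.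
  assert (Hc : (0 < cos (Im v))%R) by (apply cos_gt_0; lra).
  replace (exp (Re v) * sin (Im v) / (exp (Re v) * cos (Im v)))%R with (tan (Im v))
    by (unfold tan; field; generalize (exp_pos (Re v)); lra).
  rewrite atan_tan by exact Hv. destruct v; reflexivity.
Qed.

Lemma Cexp_pow w n : Cexp w ^ n = Cexp (INR n * w).
Proof.
  induction n as [|n IH].
  - simpl. replace (0 * w) with (RtoC 0) by ring. now rewrite Cexp_0.
  - rewrite Cpow_S, IH, <- Cexp_plus, RtoC_INR_S. f_equal. ring.
Qed.

Lemma Cexp_imag (y : R) : Cexp (0%R, y) = (cos y, sin y).
Proof. apply C_ext; [rewrite Re_Cexp|rewrite Im_Cexp]; simpl; rewrite exp_0; ring. Qed.

Lemma Cexp_imag_opp (y : R) : Cexp (0%R, - y)%R = / Cexp (0%R, y).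
Proof. rewrite <- Cexp_opp. f_equal. apply C_ext; simpl; ring. Qed.

Lemma Cexp_imag_double (y : R) : Cexp (0%R, 2 * y)%R = Cexp (0%R, y) * Cexp (0%R, y).
Proof. rewrite <- Cexp_plus. f_equal. apply C_ext; simpl; ring. Qed.

Lemma RtoC_cos (y : R) : RtoC (cos y) = (Cexp (0%R, y) + / Cexp (0%R, y)) / 2.
Proof.
  rewrite <- Cexp_imag_opp, !Cexp_imag, cos_neg, sin_neg.
  replace (_ + _) with (2 * RtoC (cos y)) by (apply C_ext; simpl; ring).
  field.
Qed.

(** * Limits as a parameter decreases to 0 *)

Definition near0 (P : R -> Prop) : Prop :=
  exists d : R, (0 < d)%R /\ forall t, (0 < t < d)%R -> P t.

Lemma near0_and (P Q : R -> Prop) : near0 P -> near0 Q -> near0 (fun t => P t /\ Q t).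
Proof.
  intros [d [Hd HP]] [e [He HQ]]. exists (Rmin d e). split; [now apply Rmin_pos|].
  intros t Ht. assert (H1 := Rmin_l d e). assert (H2 := Rmin_r d e).
  split; [apply HP|apply HQ]; lra.
Qed.

Lemma near0_imp (P Q : R -> Prop) : (forall t, (0 < t)%R -> P t -> Q t) -> near0 P -> near0 Q.
Proof. intros H [d [Hd HP]]. exists d. split; [exact Hd|]. intros t Ht. apply H; [lra|now apply HP]. Qed.

Lemma near0_lt (e : R) : (0 < e)%R -> near0 (fun t => (t < e)%R).
Proof. intro He. exists e. split; [exact He|]. intros t Ht. lra. Qed.

Definition lim0 (f : R -> C) (l : C) : Prop :=
  forall eps : R, (0 < eps)%R -> near0 (fun t => (Cmod (f t - l)%C < eps)%R).

Lemma lim0_ext f g l : near0 (fun t => f t = g t) -> lim0 f l -> lim0 g l.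
Proof.
  intros E H eps He. generalize (near0_and _ _ E (H eps He)).
  apply near0_imp. intros t _ [<- Ht]. exact Ht.
Qed.

Lemma lim0_const k : lim0 (fun _ => k) k.
Proof.
  intros eps He. exists 1%R. split; [lra|]. intros t _.
  replace (k - k) with (RtoC 0) by ring. now rewrite Cmod_0.
Qed.

Lemma lim0_unique (f : R -> C) l m : lim0 f l -> lim0 f m -> l = m.
Proof.
  intros Hl Hm. destruct (classic (l = m)) as [E|E]; [exact E|exfalso].
  assert (Hp : (0 < Cmod (l - m))%R).
  { apply Cmod_gt_0. intro E'. apply E. replace l with (l - m + m) by ring. rewrite E'. ring. }
  destruct (near0_and _ _ (Hl (Cmod (l - m) / 2)%R ltac:(lra))
              (Hm (Cmod (l - m) / 2)%R ltac:(lra))) as [d [Hd H]].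
  destruct (H (d / 2)%R ltac:(lra)) as [H1 H2].
  assert (H3 := Cmod_triangle (f (d / 2)%R - m) (- (f (d / 2)%R - l))).
  rewrite Cmod_opp in H3.
  replace (f (d / 2)%R - m + - (f (d / 2)%R - l)) with (l - m) in H3 by ring. lra.
Qed.

Lemma lim0_plus f g l m : lim0 f l -> lim0 g m -> lim0 (fun t => f t + g t) (l + m).
Proof.
  intros Hf Hg eps He.
  generalize (near0_and _ _ (Hf (eps / 2)%R ltac:(lra)) (Hg (eps / 2)%R ltac:(lra))).
  apply near0_imp. intros t _ [H1 H2].
  replace (f t + g t - (l + m)) with ((f t - l) + (g t - m)) by ring.
  eapply Rle_lt_trans; [apply Cmod_triangle|]. lra.
Qed.

Lemma lim0_mult_0 f g : lim0 f 0 -> (exists M, near0 (fun t => (Cmod (g t) <= M)%R)) ->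
  lim0 (fun t => f t * g t) 0.
Proof.
  intros Hf [M HM] eps He. assert (HM0 := Rabs_pos M).
  generalize (near0_and _ _ (Hf (eps / (Rabs M + 1))%R ltac:(apply Rdiv_lt_0_compat; lra)) HM).
  apply near0_imp. intros t _ [H1 H2].
  replace (f t * g t - 0) with ((f t - 0) * g t) by ring. rewrite Cmod_mult.
  assert (H3 := RRle_abs M). assert (H4 := Cmod_ge_0 (f t - 0)).
  apply (Rmult_lt_compat_r (Rabs M + 1)) in H1; [|lra].
  unfold Rdiv in H1. rewrite Rmult_assoc, Rinv_l in H1 by lra. nra.
Qed.

Lemma lim0_bounded f l : lim0 f l -> exists M, near0 (fun t => (Cmod (f t) <= M)%R).
Proof.
  intro H. exists (Cmod l + 1)%R. generalize (H 1%R ltac:(lra)). apply near0_imp.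
  intros t _ Ht. assert (H1 := Cmod_triangle (f t - l) l).
  replace (f t - l + l) with (f t) in H1 by ring. lra.
Qed.

Lemma lim0_minus_0 f l : lim0 f l <-> lim0 (fun t => f t - l) 0.
Proof.
  split; intros H eps He; generalize (H eps He); apply near0_imp; intros t _.
  - now replace (f t - l - 0) with (f t - l) by ring.
  - now replace (f t - l - 0) with (f t - l) by ring.
Qed.

Lemma lim0_mult f g l m : lim0 f l -> lim0 g m -> lim0 (fun t => f t * g t) (l * m).
Proof.
  intros Hf Hg. apply lim0_minus_0.
  assert (Hf' := proj1 (lim0_minus_0 _ _) Hf). assert (Hg' := proj1 (lim0_minus_0 _ _) Hg).
  apply (lim0_ext (fun t => (f t - l) * g t + (g t - m) * l)).
  - exists 1%R. split; [lra|]. intros; ring.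
  - replace (RtoC 0) with (0 + 0) by ring. apply lim0_plus; apply lim0_mult_0; auto.
    + now apply (lim0_bounded g m).
    + apply (lim0_bounded (fun _ => l) l), lim0_const.
Qed.

Lemma lim0_is_Cd f z0 v l : is_Cd f z0 l -> lim0 (fun t => f (z0 + t * v)) (f z0).
Proof.
  intros H eps He. destruct (is_Cd_continuous _ _ _ H eps He) as [d [Hd Hk]].
  assert (Hv := Cmod_ge_0 v).
  exists (d / (Cmod v + 1))%R. split; [apply Rdiv_lt_0_compat; lra|].
  intros t [Ht0 Ht]. apply Hk. rewrite Cmod_mult, Cmod_R, Rabs_pos_eq by lra.
  apply (Rmult_lt_compat_r (Cmod v + 1)) in Ht; [|lra].
  unfold Rdiv in Ht. rewrite Rmult_assoc, Rinv_l in Ht by lra. nra.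
Qed.

Lemma lim0_path f w l : is_Cd f 0 l -> lim0 (fun t => f (t * w)) (f 0).
Proof.
  intro H. apply (lim0_ext (fun t => f (0 + t * w))); [|exact (lim0_is_Cd _ _ _ _ H)].
  exists 1%R. split; [lra|]. intros t _. now rewrite Cplus_0_l.
Qed.

(** Abel's theorem in the absolutely convergent case. The total change is at
    most the sum of [Cmod (c n) * (1 - rho ^ n)] with [rho = exp (- t)], and
    finitely many terms already carry the sum of the [Cmod (c n)] up to [eps /
    2]. *)
Lemma lim0_radial (c : nat -> C) (z : C) : ex_series (fun n => Cmod (c n)) ->
  Cmod z = 1%R -> lim0 (fun t => psum c (exp (- t) * z)) (psum c z).
Proof.
  intros [A HA] Hz eps He.
  assert (HA' := proj2 (is_lim_seq_spec (sum_n (fun n => Cmod (c n))) A) HA).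
  destruct (HA' (mkposreal (eps / 2) ltac:(lra))) as [N HN].
  specialize (HN N (le_n N)). simpl in HN. apply Rabs_def2 in HN.
  set (SN := sum_n (fun n => Cmod (c n)) N) in *.
  assert (Hmono : forall (v : nat -> R) (l : R), (forall n, (0 <= v n)%R) -> is_series v l ->
            (sum_n v N <= l)%R).
  { intros v l Hv Hl. apply (is_lim_seq_incr_compare (sum_n v) l Hl).
    intro n. rewrite sum_Sn. change (sum_n v n <= sum_n v n + v (S n))%R.
    generalize (Hv (S n)). lra. }
  assert (HSA : (SN <= A)%R) by (apply Hmono; [intro; apply Cmod_ge_0|exact HA]).
  assert (HS0 : (0 <= SN)%R).
  { unfold SN. clear. induction N as [|N IH]; [rewrite sum_O; apply Cmod_ge_0|].
    rewrite sum_Sn. exact (Rplus_le_le_0_compat _ _ IH (Cmod_ge_0 _)). }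
  assert (HN0 := pos_INR N).
  assert (HNA : (0 <= INR N * A)%R) by (apply Rmult_le_pos; lra).
  exists (eps / (2 * (INR N * A + 1)))%R. split; [apply Rdiv_lt_0_compat; lra|].
  intros t [Ht0 Ht].
  set (rho := exp (- t)).
  assert (Hrho : (0 < rho < 1)%R).
  { split; [apply exp_pos|]. unfold rho. rewrite <- exp_0. apply exp_increasing. lra. }
  assert (Hpow : forall n, (0 <= rho ^ n <= 1)%R).
  { intro n. split; [apply pow_le; lra|]. rewrite <- (pow1 n). apply pow_incr. lra. }
  assert (S1 : Csum (fun n => c n * z ^ n) (psum c z)).
  { apply Csum_abs. apply (ex_series_ext (fun n => Cmod (c n))); [|now exists A].
    intro n. rewrite Cmod_mult, Cmod_pow, Hz, pow1. symmetry. apply Rmult_1_r. }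
  assert (Hex : ex_series (fun n => (Cmod (c n) * rho ^ n)%R)).
  { apply (ex_series_le (K := R_AbsRing) (V := R_CompleteNormedModule) _ (fun n => Cmod (c n)));
      [|now exists A].
    intro n. change (Rabs (Cmod (c n) * rho ^ n) <= Cmod (c n))%R.
    assert (H := Cmod_ge_0 (c n)). specialize (Hpow n). rewrite Rabs_pos_eq; nra. }
  assert (S2 : Csum (fun n => c n * (rho * z) ^ n) (psum c (rho * z))).
  { apply Csum_abs. revert Hex. apply ex_series_ext. intro n.
    rewrite Cmod_mult, Cmod_pow, Cmod_mult, Hz, Cmod_R, Rabs_pos_eq by lra.
    now rewrite Rmult_1_r. }
  destruct Hex as [V HV].
  assert (HVN : (rho ^ N * SN <= V)%R).
  { eapply Rle_trans; [|apply (Hmono _ _ (fun n => Rmult_le_pos _ _ (Cmod_ge_0 (c n)) (proj1 (Hpow n))) HV)].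
    unfold SN. clearbody rho. clear - Hrho Hpow.
    assert (H : forall m, (m <= N)%nat ->
      (rho ^ N * sum_n (fun n => Cmod (c n)) m <= sum_n (fun n => Cmod (c n) * rho ^ n) m)%R).
    { assert (Hst : forall m, (m <= N)%nat -> (rho ^ N * Cmod (c m) <= Cmod (c m) * rho ^ m)%R).
      { intros m Hm. rewrite Rmult_comm. apply Rmult_le_compat_l; [apply Cmod_ge_0|].
        replace N with (m + (N - m))%nat by lia. rewrite pow_add.
        generalize (Hpow m) (Hpow (N - m)%nat). nra. }
      induction m as [|m IH]; intro Hm; [rewrite !sum_O; now apply Hst|].
      rewrite !sum_Sn. specialize (IH ltac:(lia)). specialize (Hst (S m) Hm).
      change (rho ^ N * (sum_n (fun n => Cmod (c n)) m + Cmod (c (S m)))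
              <= sum_n (fun n => Cmod (c n) * rho ^ n) m + Cmod (c (S m)) * rho ^ S m)%R.
      lra. }
    now apply H. }
  assert (Hb : (Cmod (psum c (rho * z) - psum c z) <= A - V)%R).
  { apply (Csum_bound (fun n => c n * (rho * z) ^ n - c n * z ^ n)
             (fun n => minus (Cmod (c n)) (Cmod (c n) * rho ^ n)%R)).
    - intro n. change (Cmod (c n * (rho * z) ^ n - c n * z ^ n)
                       <= Cmod (c n) - Cmod (c n) * rho ^ n)%R.
      rewrite Cpow_mult_l, <- RtoC_pow.
      replace (c n * ((rho ^ n)%R * z ^ n) - c n * z ^ n)
        with (c n * z ^ n * (rho ^ n - 1)%R) by (rewrite RtoC_minus; ring).
      rewrite !Cmod_mult, Cmod_pow, Hz, pow1, Cmod_R.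
      specialize (Hpow n). rewrite Rabs_left1 by lra. right. ring.
    - now apply Csum_minus.
    - now apply (is_series_minus (K := R_AbsRing) (V := R_NormedModule)). }
  eapply Rle_lt_trans; [exact Hb|].
  assert (HrN : (1 - t * INR N <= rho ^ N)%R).
  { unfold rho. rewrite <- Rpower_pow by apply exp_pos. unfold Rpower. rewrite ln_exp.
    assert (H := exp_ineq1_le (INR N * - t)). lra. }
  assert (HtN : (t * (INR N * A + 1) < eps / 2)%R).
  { apply (Rmult_lt_compat_r (INR N * A + 1)) in Ht; [|lra].
    replace (eps / (2 * (INR N * A + 1)) * (INR N * A + 1))%R with (eps / 2)%R in Ht by (field; lra).
    exact Ht. }
  assert ((1 - t * INR N) * SN <= rho ^ N * SN)%R by (apply Rmult_le_compat_r; assumption).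
  assert (t * INR N * SN <= t * INR N * A)%R by (apply Rmult_le_compat_l; [nra|exact HSA]).
  lra.
Qed.

(** * Limits of sequences and infinite products *)

Definition Clim (u : nat -> C) (l : C) : Prop :=
  is_lim_seq (fun n => Cmod (u n - l)) 0%R.

Lemma Clim_squeeze u l (v : nat -> R) :
  (forall n, (Cmod (u n - l) <= v n)%R) -> is_lim_seq v 0%R -> Clim u l.
Proof.
  intros H Hv. apply (is_lim_seq_le_le (fun _ => 0%R) _ v); [|apply is_lim_seq_const|exact Hv].
  intro n. split; [apply Cmod_ge_0|apply H].
Qed.

Lemma Clim_const l : Clim (fun _ => l) l.
Proof.
  apply (Clim_squeeze _ _ (fun _ => 0%R)); [|apply is_lim_seq_const].
  intro n. replace (l - l) with (RtoC 0) by ring. rewrite Cmod_0. lra.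
Qed.

Lemma Clim_ext u v l : (forall n, u n = v n) -> Clim u l -> Clim v l.
Proof. intro E. apply is_lim_seq_ext. intro n. now rewrite E. Qed.

Lemma Clim_shift u l : Clim (fun n => u (S n)) l <-> Clim u l.
Proof. symmetry. apply (is_lim_seq_incr_1 (fun n => Cmod (u n - l))). Qed.

Lemma Clim_shift_n u l N : Clim (fun n => u (n + N)%nat) l <-> Clim u l.
Proof. symmetry. apply (is_lim_seq_incr_n (fun n => Cmod (u n - l)) N). Qed.

Lemma Clim_mult u v l m : Clim u l -> Clim v m -> Clim (fun n => u n * v n) (l * m).
Proof.
  intros Hu Hv.
  apply (Clim_squeeze _ _ (fun n => Cmod (u n - l) * Cmod (v n - m)
      + (Cmod l * Cmod (v n - m) + Cmod m * Cmod (u n - l)))%R).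
  - intro n.
    replace (u n * v n - l * m)
      with ((u n - l) * (v n - m) + (l * (v n - m) + m * (u n - l))) by ring.
    eapply Rle_trans; [apply Cmod_triangle|].
    eapply Rle_trans; [apply Rplus_le_compat_l, Cmod_triangle|].
    rewrite !Cmod_mult. lra.
  - replace 0%R with (0 * 0 + (Cmod l * 0 + Cmod m * 0))%R by ring.
    apply is_lim_seq_plus'; [now apply is_lim_seq_mult'|].
    apply is_lim_seq_plus'; apply is_lim_seq_mult'; auto using is_lim_seq_const.
Qed.

Lemma Clim_Cmod u l : Clim u l -> is_lim_seq (fun n => Cmod (u n)) (Cmod l).
Proof.
  intro H.
  apply (is_lim_seq_le_le (fun n => Cmod l - Cmod (u n - l))%R _
           (fun n => Cmod l + Cmod (u n - l))%R).
  - intro n. split.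
    + generalize (Cmod_triangle (u n) (- (u n - l))). rewrite Cmod_opp.
      replace (u n + - (u n - l)) with l by ring. lra.
    + generalize (Cmod_triangle l (u n - l)).
      replace (l + (u n - l)) with (u n) by ring. lra.
  - replace (Finite (Cmod l)) with (Finite (Cmod l - 0)) by (f_equal; ring).
    apply is_lim_seq_minus'; [apply is_lim_seq_const|exact H].
  - replace (Finite (Cmod l)) with (Finite (Cmod l + 0)) by (f_equal; ring).
    apply is_lim_seq_plus'; [apply is_lim_seq_const|exact H].
Qed.

Lemma is_lim_seq_bounded (u : nat -> R) (l : R) : is_lim_seq u l ->
  exists M, forall n, (Rabs (u n) <= M)%R.
Proof.
  intro H.
  assert (H' : exists x : R_NormedModule, filterlim u eventually (locally x))
    by (exists l; exact H).
  destruct (filterlim_bounded (K := R_AbsRing) (V := R_NormedModule) u H') as [M HM].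
  exists M. exact HM.
Qed.

Lemma Clim_bounded u l : Clim u l -> exists M, forall n, (Cmod (u n) <= M)%R.
Proof.
  intro H. apply Clim_Cmod in H.
  destruct (is_lim_seq_bounded _ _ H) as [M HM].
  exists M. intro n. eapply Rle_trans; [apply RRle_abs|apply (HM n)].
Qed.

Lemma Clim_inv (u : nat -> C) (l : C) : l <> 0 -> (forall n, u n <> 0) -> Clim u l ->
  Clim (fun n => / u n) (/ l).
Proof.
  intros Hl Hu H.
  apply (is_lim_seq_ext (fun n => Cmod (u n - l) * (/ Cmod (u n) * / Cmod l))%R).
  - intro n. replace (/ u n - / l) with (- (u n - l) * (/ u n * / l))
      by (field; split; [exact Hl|apply Hu]).
    rewrite !Cmod_mult, Cmod_opp, !Cmod_inv by auto. reflexivity.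
  - assert (Hlp := proj1 (Cmod_gt_0 _) Hl).
    replace 0%R with (0 * (/ Cmod l * / Cmod l))%R by ring.
    apply is_lim_seq_mult'; [exact H|].
    apply is_lim_seq_mult'; [|apply is_lim_seq_const].
    apply (is_lim_seq_inv _ (Cmod l)); [now apply Clim_Cmod|].
    intro E. injection E. lra.
Qed.

Lemma Clim_unique u l m : Clim u l -> Clim u m -> l = m.
Proof.
  intros Hl Hm.
  assert (H : Cmod (l - m) = 0%R).
  { assert (H1 : is_lim_seq (fun _ => Cmod (l - m)) 0%R).
    { apply (is_lim_seq_le_le (fun _ => 0%R) _ (fun n => Cmod (u n - l) + Cmod (u n - m))%R).
      - intro n. split; [apply Cmod_ge_0|].
        rewrite <- (Cmod_opp (u n - l)).
        replace (l - m) with (- (u n - l) + (u n - m)) by ring. apply Cmod_triangle.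
      - apply is_lim_seq_const.
      - replace 0%R with (0 + 0)%R by ring. now apply is_lim_seq_plus'. }
    apply is_lim_seq_unique in H1. rewrite Lim_seq_const in H1. now injection H1. }
  apply Cmod_eq_0 in H. replace l with (l - m + m) by ring. rewrite H. ring.
Qed.

Lemma Clim_CLim_seq u l : Clim u l -> CLim_seq u = l.
Proof.
  intro H. unfold CLim_seq. destruct l as [x y].
  assert (HR : is_lim_seq (fun n => Re (u n)) x).
  { apply is_lim_seq_spec. apply is_lim_seq_spec in H. intro eps.
    destruct (H eps) as [N HN]. exists N. intros n Hn. specialize (HN n Hn).
    rewrite Rminus_0_r, Rabs_pos_eq in HN by apply Cmod_ge_0.
    eapply Rle_lt_trans; [|exact HN]. apply (re_le_Cmod (u n - (x, y))). }
  assert (HI : is_lim_seq (fun n => Im (u n)) y).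
  { apply is_lim_seq_spec. apply is_lim_seq_spec in H. intro eps.
    destruct (H eps) as [N HN]. exists N. intros n Hn. specialize (HN n Hn).
    rewrite Rminus_0_r, Rabs_pos_eq in HN by apply Cmod_ge_0.
    eapply Rle_lt_trans; [|exact HN]. apply (Im_le_Cmod (u n - (x, y))). }
  now rewrite (is_lim_seq_unique _ _ HR), (is_lim_seq_unique _ _ HI).
Qed.

Lemma Clim_eventually u l : Clim u l -> forall eps : R, (0 < eps)%R ->
  exists N, forall n, (N <= n)%nat -> (Cmod (u n - l) < eps)%R.
Proof.
  intros H eps He. apply is_lim_seq_spec in H.
  destruct (H (mkposreal eps He)) as [N HN]. exists N. intros n Hn.
  specialize (HN n Hn). simpl in HN.
  now rewrite Rminus_0_r, Rabs_pos_eq in HN by apply Cmod_ge_0.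
Qed.

Lemma Csum_Clim u l : Csum u l ->
  Clim (fun n => (sum_n (fun k => Re (u k)) n, sum_n (fun k => Im (u k)) n)) l.
Proof.
  intros [H1 H2].
  apply (Clim_squeeze _ _ (fun n => Rabs (sum_n (fun k => Re (u k)) n - Re l)
           + Rabs (sum_n (fun k => Im (u k)) n - Im l))%R).
  - intro n. apply Cmod_le_Re_Im.
  - assert (Hz : forall (v : nat -> R) (m : R), is_lim_seq v m ->
              is_lim_seq (fun n => Rabs (v n - m)) 0%R).
    { intros v m Hv. apply (is_lim_seq_abs_0 (fun n => v n - m)%R).
      replace 0%R with (m - m)%R by ring.
      apply is_lim_seq_minus'; [exact Hv|apply is_lim_seq_const]. }
    replace 0%R with (0 + 0)%R by ring.
    apply is_lim_seq_plus'; apply Hz; assumption.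
Qed.

Lemma Clim_of_summable_steps (q : nat -> C) :
  ex_series (fun n => Cmod (q (S n) - q n)) -> exists l, Clim q l.
Proof.
  intro H. assert (S0 := Csum_Clim _ _ (Csum_abs _ H)).
  set (d := CSeries _) in S0. exists (q O + d).
  apply Clim_shift. revert S0. apply is_lim_seq_ext. intro n. f_equal.
  assert (E : (sum_n (fun k => Re (q (S k) - q k)) n,
               sum_n (fun k => Im (q (S k) - q k)) n) = q (S n) - q O).
  { apply C_ext; simpl.
    - induction n as [|n IH]; [now rewrite sum_O|].
      rewrite sum_Sn, IH. unfold plus; simpl. ring.
    - induction n as [|n IH]; [now rewrite sum_O|].
      rewrite sum_Sn, IH. unfold plus; simpl. ring. }
  rewrite E. ring.
Qed.

(** The partial products are bounded by [exp] of the sum of the [Cmod (rho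
    n)], so that their steps are summable. *)
Lemma infinite_product (q rho : nat -> C) :
  (forall n, q (S n) = q n * (1 + rho n)) -> ex_series (fun n => Cmod (rho n)) ->
  exists l, Clim q l.
Proof.
  intros Hq Hr.
  assert (Hb : exists M, forall n, (sum_n (fun k => Cmod (rho k)) n <= M)%R).
  { destruct Hr as [M HM].
    destruct (is_lim_seq_bounded _ _ HM) as [M' HM'].
    exists M'. intro n. eapply Rle_trans; [apply RRle_abs|apply HM']. }
  destruct Hb as [M HM].
  assert (HM0 : (0 <= M)%R).
  { eapply Rle_trans; [|apply (HM O)]. rewrite sum_O. apply Cmod_ge_0. }
  assert (Hqn : forall n, (Cmod (q (S n)) <= Cmod (q O) * exp (sum_n (fun k => Cmod (rho k)) n))%R).
  { assert (Hstep : forall n, (Cmod (1 + rho n) <= exp (Cmod (rho n)))%R).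
    { intro n. eapply Rle_trans; [apply Cmod_triangle|]. rewrite Cmod_1. apply exp_ineq1_le. }
    induction n as [|n IH].
    - rewrite Hq, sum_O, Cmod_mult. apply Rmult_le_compat_l; [apply Cmod_ge_0|apply Hstep].
    - rewrite Hq, sum_Sn, Cmod_mult. unfold plus; simpl. rewrite exp_plus, <- Rmult_assoc.
      apply Rmult_le_compat; auto using Cmod_ge_0. }
  set (B := (Cmod (q O) * exp M)%R).
  assert (HB : forall n, (Cmod (q n) <= B)%R).
  { assert (He : forall t, (t <= M -> exp t <= exp M)%R).
    { intros t [Ht|Ht]; [left; now apply exp_increasing|rewrite Ht; lra]. }
    intros [|n].
    - unfold B. rewrite <- (Rmult_1_r (Cmod (q O))) at 1.
      apply Rmult_le_compat_l; [apply Cmod_ge_0|]. rewrite <- exp_0. now apply He.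
    - eapply Rle_trans; [apply Hqn|]. apply Rmult_le_compat_l; [apply Cmod_ge_0|].
      now apply He. }
  apply Clim_of_summable_steps.
  apply (ex_series_le (K := R_AbsRing) (V := R_CompleteNormedModule) _
           (fun n => scal B (Cmod (rho n)))).
  - intro n. unfold norm; simpl; unfold abs; simpl. rewrite Rabs_pos_eq by apply Cmod_ge_0.
    rewrite Hq. replace (q n * (1 + rho n) - q n) with (q n * rho n) by ring.
    rewrite Cmod_mult. apply Rmult_le_compat_r; [apply Cmod_ge_0|apply HB].
  - now apply (ex_series_scal (K := R_AbsRing) (V := R_NormedModule)).
Qed.

(** The reciprocals form a product of the same kind, with factors [1 - rho /
    (1 + rho)], hence converge as well; the two limits are inverse to each
    other. *)
Lemma infinite_product_neq0 (q rho : nat -> C) (l : C) :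
  (forall n, q n <> 0) ->
  (forall n, q (S n) = q n * (1 + rho n)) -> ex_series (fun n => Cmod (rho n)) ->
  Clim q l -> l <> 0.
Proof.
  intros Hn0 Hq Hr Hl.
  assert (H1 : forall n, 1 + rho n <> 0).
  { intros n E. apply (Hn0 (S n)). rewrite Hq, E. ring. }
  destruct (infinite_product (fun n => / q n) (fun n => - rho n / (1 + rho n))) as [m Hm].
  - intro n. rewrite Hq. field. auto.
  - assert (Hr0 := ex_series_lim_0 _ Hr).
    apply is_lim_seq_spec in Hr0. destruct (Hr0 (mkposreal (1/2) ltac:(lra))) as [N HN].
    simpl in HN.
    apply (ex_series_incr_n (K := R_AbsRing) (V := R_NormedModule) _ N).
    apply (ex_series_le (K := R_AbsRing) (V := R_CompleteNormedModule) _
             (fun n => scal 2%R (Cmod (rho (N + n)%nat)))).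
    + intro n. unfold norm; simpl; unfold abs; simpl. rewrite Rabs_pos_eq by apply Cmod_ge_0.
      specialize (HN (N + n)%nat ltac:(lia)).
      rewrite Rminus_0_r, Rabs_pos_eq in HN by apply Cmod_ge_0.
      rewrite Cmod_div by apply H1. rewrite Cmod_opp.
      set (r := rho (N + n)%nat) in *.
      assert (H2 : (1 / 2 <= Cmod (1 + r))%R).
      { generalize (Cmod_triangle (1 + r) (- r)). rewrite Cmod_opp.
        replace (1 + r + - r) with (RtoC 1) by ring. rewrite Cmod_1. lra. }
      assert (Hr1 := Cmod_ge_0 r). unfold scal; simpl; unfold mult; simpl.
      apply (Rmult_le_reg_r (Cmod (1 + r))); [lra|].
      unfold Rdiv. rewrite Rmult_assoc, Rinv_l by lra. nra.
    + apply (ex_series_scal (K := R_AbsRing) (V := R_NormedModule)).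
      now apply (ex_series_incr_n (K := R_AbsRing) (V := R_NormedModule) (fun n => Cmod (rho n)) N).
  - intro E. subst l. apply C1_nz.
    apply (Clim_unique (fun _ => 1)); [apply Clim_const|].
    replace (RtoC 0) with (0 * m) by ring.
    apply (Clim_ext (fun n => q n * / q n)); [intro n; field; auto|].
    now apply Clim_mult.
Qed.

(** * The reciprocal gamma function *)

Lemma RCpower_plus r v w : RCpower r (v + w) = RCpower r v * RCpower r w.
Proof. unfold RCpower. rewrite <- Cexp_plus. f_equal. ring. Qed.

Lemma RCpower_neq0 r w : RCpower r w <> 0.
Proof. apply Cexp_neq0. Qed.

Lemma RCpower_1 r : (0 < r)%R -> RCpower r 1 = r.
Proof.
  intro Hr. unfold RCpower. rewrite Cmult_1_l, Cexp_R, exp_ln by exact Hr. reflexivity.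
Qed.

Lemma Cmod_RCpower r w : Cmod (RCpower r w) = Rpower r (Re w).
Proof.
  unfold RCpower. rewrite Cmod_Cexp. unfold Rpower. f_equal.
  simpl. unfold Re. ring.
Qed.

(** The reciprocal of Euler's quotient: unlike the latter it converges for
    every [c], the limit being [1/Gamma]. *)
Definition rgamma (c : C) (n : nat) : C :=
  poch c (S n) / (INR (fact n) * RCpower (INR n) c).

Lemma poch_rgamma c n :
  poch c (S n) = rgamma c n * (INR (fact n) * RCpower (INR n) c).
Proof.
  unfold rgamma. field. split; [apply RCpower_neq0|apply INR_fact_neq0_C].
Qed.

Definition rgamma_step (c : C) (n : nat) : C :=
  (1 + c * / INR (S (S n)))
  * Cexp (c * (ln (INR (S n)) - ln (INR (S (S n))))%R) - 1.

Lemma rgamma_S c n :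
  rgamma c (S (S n)) = rgamma c (S n) * (1 + rgamma_step c n).
Proof.
  unfold rgamma, rgamma_step. rewrite (poch_S c (S (S n))).
  change (fact (S (S n))) with (S (S n) * fact (S n))%nat.
  rewrite mult_INR, RtoC_mult.
  assert (E : RCpower (INR (S (S n))) c
            = RCpower (INR (S n)) c
              / Cexp (c * (ln (INR (S n)) - ln (INR (S (S n))))%R)).
  { unfold RCpower. rewrite <- Cexp_minus. f_equal. rewrite RtoC_minus. ring. }
  rewrite E. field. repeat split; auto using RCpower_neq0, INR_fact_neq0_C, INR_S_neq0_C, Cexp_neq0.
Qed.

(** With [u = 1/(n+2)] the factor is [(1 + c u) (1 - u)^c], in which the terms
    of order [u] cancel. *)
Lemma rgamma_step_summable c : ex_series (fun n => Cmod (rgamma_step c n)).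
Proof.
  set (m := Cmod c). assert (Hm : (0 <= m)%R) by apply Cmod_ge_0.
  set (K := (2 * m + 2 * m ^ 2 + (1 + m) * (16 * m ^ 2 * exp m))%R).
  apply (ex_series_le (K := R_AbsRing) (V := R_CompleteNormedModule) _
           (fun n => scal K (Rpower (INR (S (S n))) (- (1 + 1))))).
  2: { apply (ex_series_scal (K := R_AbsRing) (V := R_NormedModule)).
       apply (ex_series_incr_1 (K := R_AbsRing) (V := R_NormedModule)
                (fun n => Rpower (INR (S n)) (- (1 + 1)))).
       apply ex_series_Rpower. lra. }
  intro n. unfold norm; simpl; unfold abs; simpl. rewrite Rabs_pos_eq by apply Cmod_ge_0.
  unfold rgamma_step.
  change (match n with O => 1 | S _ => INR n + 1 end)%R with (INR (S n)).
  rewrite (S_INR (S n)).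
  set (x := INR (S n)).
  assert (Hx : (1 <= x)%R) by (unfold x; rewrite S_INR; generalize (pos_INR n); lra).
  set (L := (ln x - ln (x + 1))%R).
  set (u := (/ (x + 1))%R).
  assert (Hu : (0 < u)%R) by (apply Rinv_0_lt_compat; lra).
  assert (Hu2 : (u <= 1 / 2)%R).
  { unfold u. replace (1 / 2)%R with (/ 2)%R by field. apply Rinv_le_contravar; lra. }
  assert (HL1 : (L <= - u)%R).
  { assert (H := exp_ineq1_le L).
    assert (EL : (exp L = x * / (x + 1))%R)
      by (unfold L, Rminus; rewrite exp_plus, exp_Ropp, !exp_ln by lra; reflexivity).
    assert (x * / (x + 1) = 1 - u)%R by (unfold u; field; lra). lra. }
  assert (HL2 : (- u - 2 * u ^ 2 <= L)%R).
  { assert (H := exp_ineq1_le (- L)).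
    assert (EL : (exp (- L) = (x + 1) * / x)%R).
    { unfold L. replace (- (ln x - ln (x + 1)))%R with (ln (x + 1) + - ln x)%R by ring.
      rewrite exp_plus, exp_Ropp, !exp_ln by lra. reflexivity. }
    assert ((x + 1) * / x = 1 + / x)%R by (field; lra).
    assert (/ x <= u + 2 * u ^ 2)%R; [|lra].
    assert (Eu : (x = / u - 1)%R) by (unfold u; rewrite Rinv_inv; ring).
    assert (Ex : (/ x = u / (1 - u))%R) by (rewrite Eu; field; split; lra).
    rewrite Ex. apply (Rmult_le_reg_r (1 - u)); [lra|].
    unfold Rdiv. rewrite Rmult_assoc, Rinv_l by lra. nra. }
  assert (Ep : Rpower (x + 1) (- (1 + 1)) = (u ^ 2)%R).
  { replace (1 + 1)%R with (INR 2) by reflexivity.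
    rewrite Rpower_Ropp, Rpower_pow by lra. unfold u. now rewrite pow_inv. }
  rewrite Ep. unfold scal; simpl (mult _ _); unfold mult; simpl.
  rewrite <- RtoC_inv by lra. fold u.
  set (r := Cexp (c * L) - 1 - c * L).
  replace ((1 + c * u) * Cexp (c * L) - 1)
    with (c * (u + L)%R + (c ^ 2 * (u * L)%R + (1 + c * u) * r))
    by (unfold r; rewrite RtoC_plus, RtoC_mult; ring).
  assert (HLa : (Rabs L <= 2 * u)%R) by (rewrite Rabs_left1; nra).
  assert (HcL : (Cmod (c * L) <= m * (2 * u))%R).
  { rewrite Cmod_mult, Cmod_R. apply Rmult_le_compat_l; [apply Cmod_ge_0|exact HLa]. }
  assert (Hr : (Cmod r <= 16 * m ^ 2 * exp m * u ^ 2)%R).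
  { eapply Rle_trans; [apply Cexp_taylor1|].
    assert (exp (Cmod (c * L)) <= exp m)%R.
    { assert (Hle : (Cmod (c * L) <= m)%R) by nra.
      destruct (Rle_lt_or_eq_dec _ _ Hle) as [H|H]; [left; now apply exp_increasing|rewrite H; lra]. }
    assert (Cmod (c * L) ^ 2 <= (m * (2 * u)) ^ 2)%R
      by (apply pow_incr; split; [apply Cmod_ge_0|exact HcL]).
    assert (0 < exp (Cmod (c * L)))%R by apply exp_pos.
    apply Rle_trans with (4 * (m * (2 * u)) ^ 2 * exp m)%R; [|right; ring].
    apply Rmult_le_compat; try lra.
    apply Rmult_le_pos; [lra|apply pow_le, Cmod_ge_0]. }
  eapply Rle_trans; [apply Cmod_triangle|].
  eapply Rle_trans; [apply Rplus_le_compat_l, Cmod_triangle|].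
  rewrite !Cmod_mult, !Cmod_pow, !Cmod_R. fold m.
  assert (H1 : (Rabs (u + L) <= 2 * u ^ 2)%R) by (rewrite Rabs_left1; lra).
  assert (H2 : (Rabs (u * L) <= 2 * u ^ 2)%R).
  { rewrite Rabs_mult, (Rabs_pos_eq u) by lra. nra. }
  assert (H3 : (Cmod (1 + c * u) <= 1 + m)%R).
  { eapply Rle_trans; [apply Cmod_triangle|]. rewrite Cmod_1, Cmod_mult, Cmod_R.
    rewrite Rabs_pos_eq by lra. fold m. nra. }
  assert (m * Rabs (u + L) <= m * (2 * u ^ 2))%R by now apply Rmult_le_compat_l.
  assert (m ^ 2 * Rabs (u * L) <= m ^ 2 * (2 * u ^ 2))%R
    by (apply Rmult_le_compat_l; [now apply pow_le|exact H2]).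
  assert (Cmod (1 + c * u) * Cmod r <= (1 + m) * (16 * m ^ 2 * exp m * u ^ 2))%R
    by (apply Rmult_le_compat; auto using Cmod_ge_0).
  change (m * Rabs (u + L) + (m ^ 2 * Rabs (u * L) + Cmod (1 + c * u) * Cmod r)
          <= K * u ^ 2)%R.
  unfold K. lra.
Qed.

Lemma rgamma_neq0 c n : (forall n, c + INR n <> 0) -> rgamma c n <> 0.
Proof.
  intros Hc E. apply (poch_neq0 c (S n) Hc). rewrite poch_rgamma, E. ring.
Qed.

Lemma rgamma_lim_neq0 c l : (forall n, c + INR n <> 0) -> Clim (rgamma c) l -> l <> 0.
Proof.
  intros Hc Hl. apply Clim_shift in Hl.
  apply (infinite_product_neq0 (fun n => rgamma c (S n)) (rgamma_step c)); auto.
  - intro n. now apply rgamma_neq0.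
  - intro n. apply rgamma_S.
  - apply rgamma_step_summable.
Qed.

(** Away from the poles the limit is nonzero and can be inverted; at a pole
    both sides vanish because the Pochhammer symbols do, and because [/ 0 =
    0]. *)
Lemma rgamma_lim c : Clim (rgamma c) (/ Gamma c).
Proof.
  destruct (classic (exists m : nat, c + INR m = 0)) as [[m Hm]|Hc].
  - assert (Ec : c = - INR m) by (replace c with (c + INR m - INR m) by ring; rewrite Hm; ring).
    assert (H0 : forall u : nat -> C, (forall n, u (n + m)%nat = 0) -> Clim u 0).
    { intros u Hu. apply (Clim_shift_n u 0 m).
      apply (Clim_ext (fun _ => 0)); [intro; now rewrite Hu|apply Clim_const]. }
    assert (EG : Gamma c = 0).
    { apply Clim_CLim_seq, H0. intro n. rewrite Ec, poch_pole by lia.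
      unfold Cdiv. rewrite Cinv_0. ring. }
    rewrite EG, Cinv_0. apply H0. intro n. unfold rgamma.
    rewrite Ec, poch_pole by lia. unfold Cdiv. ring.
  - assert (Hc' : forall n, c + INR n <> 0) by (intros n E; apply Hc; now exists n).
    destruct (infinite_product (fun n => rgamma c (S n)) (rgamma_step c)) as [l Hl].
    + intro n; apply rgamma_S.
    + apply rgamma_step_summable.
    + apply (proj1 (Clim_shift _ _)) in Hl.
      assert (Hl0 := rgamma_lim_neq0 c l Hc' Hl).
      assert (EG : Gamma c = / l).
      { apply Clim_CLim_seq.
        apply (Clim_ext (fun n => / rgamma c n)).
        - intro n. unfold rgamma. field.
          repeat split; auto using INR_fact_neq0_C, RCpower_neq0, poch_neq0.
        - apply Clim_inv; auto. intro n. now apply rgamma_neq0. }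
      rewrite EG. replace (/ / l) with l by (field; exact Hl0). exact Hl.
Qed.

Lemma Gamma_neq0 c : (forall n, c + INR n <> 0) -> Gamma c <> 0.
Proof.
  intros Hc E. apply (rgamma_lim_neq0 c (/ Gamma c) Hc (rgamma_lim c)).
  rewrite E. apply Cinv_0.
Qed.

Lemma is_lim_seq_inv_INR_S : is_lim_seq (fun n => / INR (S n))%R 0%R.
Proof.
  apply (is_lim_seq_incr_1 (fun n => / INR n)%R).
  replace (Finite 0) with (Rbar_inv p_infty) by reflexivity.
  apply is_lim_seq_inv; [apply is_lim_seq_INR|discriminate].
Qed.

Lemma Clim_linear_ratio p : Clim (fun n => (p + INR (S n)) / INR (S n)) 1.
Proof.
  apply (is_lim_seq_ext (fun n => Cmod p * / INR (S n))%R).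
  - intro n. replace ((p + INR (S n)) / INR (S n) - 1) with (p / INR (S n))
      by (field; apply INR_S_neq0_C).
    now rewrite Cmod_div, Cmod_INR by apply INR_S_neq0_C.
  - replace 0%R with (Cmod p * 0)%R by ring.
    apply is_lim_seq_mult'; [apply is_lim_seq_const|apply is_lim_seq_inv_INR_S].
Qed.

(** Stated for the reciprocal, the functional equation holds at the poles too.
    *)
Lemma rGamma_S c : / Gamma c = c * / Gamma (c + 1).
Proof.
  apply (Clim_unique (fun n => rgamma c (S n) * ((c + 1 + INR (S n)) / INR (S n)))).
  - replace (/ Gamma c) with (/ Gamma c * 1) by ring.
    apply Clim_mult; [apply Clim_shift, rgamma_lim|apply Clim_linear_ratio].
  - apply (Clim_ext (fun n => c * rgamma (c + 1) (S n))).
    + intro n. unfold rgamma.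
      assert (E : c * poch (c + 1) (S (S n)) = poch c (S (S n)) * (c + 1 + INR (S n))).
      { rewrite <- poch_S_l, poch_S, (RtoC_INR_S (S n)). ring. }
      rewrite RCpower_plus, RCpower_1 by (apply lt_0_INR; lia).
      transitivity (c * poch (c + 1) (S (S n))
        / (INR (fact (S n)) * (RCpower (INR (S n)) c * INR (S n)))).
      { unfold Cdiv. ring. }
      rewrite E. field.
      repeat split; auto using INR_fact_neq0_C, RCpower_neq0, INR_S_neq0_C.
    + apply Clim_mult; [apply Clim_const|apply Clim_shift, rgamma_lim].
Qed.

Lemma Gamma_S c : Gamma (c + 1) = c * Gamma c \/ c = 0.
Proof.
  destruct (classic (c = 0)) as [H|H]; [now right|left].
  assert (E := rGamma_S c).
  assert (Ei : forall z : C, / / z = z).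
  { intro z. destruct (classic (z = 0)) as [->|Hz]; [now rewrite !Cinv_0|field; exact Hz]. }
  destruct (classic (Gamma (c + 1) = 0)) as [H0|H0].
  - rewrite H0, Cinv_0, Cmult_0_r in E. rewrite H0, <- (Ei (Gamma c)), E, Cinv_0. ring.
  - rewrite <- (Ei (Gamma c)), E. field. split; assumption.
Qed.

(** * Growth of Pochhammer quotients *)

Lemma poch_div_bound p q : (forall n, q + INR n <> 0) ->
  exists M, forall n,
    (Cmod (poch p (S n) / poch q (S n)) <= M * Rpower (INR n) (Re (p - q)))%R.
Proof.
  intro Hq.
  assert (HG : / Gamma q <> 0) by exact (rgamma_lim_neq0 q _ Hq (rgamma_lim q)).
  destruct (Clim_bounded (fun n => rgamma p n * / rgamma q n) (/ Gamma p * / / Gamma q)) as [M HM].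
  { apply Clim_mult; [apply rgamma_lim|].
    apply Clim_inv; [exact HG|intro n; now apply rgamma_neq0|apply rgamma_lim]. }
  exists M. intro n. rewrite <- Cmod_RCpower.
  replace (poch p (S n) / poch q (S n))
    with (rgamma p n * / rgamma q n * RCpower (INR n) (p - q)).
  - rewrite Cmod_mult. apply Rmult_le_compat_r; [apply Cmod_ge_0|apply HM].
  - rewrite (poch_rgamma p), (poch_rgamma q).
    replace (RCpower (INR n) p) with (RCpower (INR n) (p - q) * RCpower (INR n) q)
      by (rewrite <- RCpower_plus; f_equal; ring).
    field. repeat split; auto using rgamma_neq0, RCpower_neq0, INR_fact_neq0_C.
Qed.

(** The terms are of order [n^(Re (p - q))]. *)
Lemma poch_div_summable p q : (forall n, q + INR n <> 0) -> (Re (p - q) < -1)%R ->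
  ex_series (fun n => Cmod (poch p n / poch q n)).
Proof.
  intros Hq Hre. destruct (poch_div_bound p q Hq) as [M HM].
  apply (ex_series_incr_n (K := R_AbsRing) (V := R_NormedModule) _ 2).
  apply (ex_series_le (K := R_AbsRing) (V := R_CompleteNormedModule) _
           (fun n => scal M (Rpower (INR (S n)) (- (1 + (- Re (p - q) - 1)))))).
  - intro n. unfold norm; simpl norm; unfold abs; simpl abs.
    rewrite Rabs_pos_eq by apply Cmod_ge_0.
    replace (- (1 + (- Re (p - q) - 1)))%R with (Re (p - q)) by ring.
    exact (HM (S n)).
  - apply (ex_series_scal (K := R_AbsRing) (V := R_NormedModule)).
    apply ex_series_Rpower. lra.
Qed.

Lemma poch_div_bounded p q : (forall n, q + INR n <> 0) -> Re p = Re q ->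
  exists M, forall n, (Cmod (poch p n / poch q n) <= M)%R.
Proof.
  intros Hq Hre. destruct (poch_div_bound p q Hq) as [M HM].
  exists (Rmax 1 M). intros [|n].
  - simpl. replace (1 / 1) with (RtoC 1) by (field; apply C1_nz). rewrite Cmod_1. apply Rmax_l.
  - eapply Rle_trans; [apply HM|].
    replace (Re (p - q)) with 0%R by (simpl; unfold Re in *; lra).
    unfold Rpower. rewrite Rmult_0_l, exp_0, Rmult_1_r. apply Rmax_r.
Qed.

(** The powers of [n] cancel in this quotient, since [p + 1 = q + r]. *)
Lemma poch_quotient_lim p q r :
  (forall n, q + INR n <> 0) -> (forall n, r + INR n <> 0) -> p + 1 = q + r ->
  Clim (fun n => poch p n * INR (fact n) / (poch q n * poch r n))
       (/ Gamma p * Gamma q * Gamma r).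
Proof.
  intros Hq Hr E. apply Clim_shift, Clim_shift.
  assert (Hi : forall c, (forall n, c + INR n <> 0) ->
            Clim (fun n => / rgamma c (S n)) (Gamma c)).
  { intros c Hc. assert (HG := Gamma_neq0 c Hc).
    replace (Gamma c) with (/ / Gamma c) by (field; exact HG).
    apply (Clim_inv (fun n => rgamma c (S n))).
    - now apply (rgamma_lim_neq0 c _ Hc), rgamma_lim.
    - intro n; now apply rgamma_neq0.
    - apply Clim_shift, rgamma_lim. }
  apply (Clim_ext (fun n => rgamma p (S n) * / rgamma q (S n) * / rgamma r (S n)
                            * ((1 + INR (S n)) / INR (S n)))).
  - intro n. rewrite (poch_rgamma p (S n)), (poch_rgamma q (S n)), (poch_rgamma r (S n)).
    assert (Ep : RCpower (INR (S n)) q * RCpower (INR (S n)) r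
                 = RCpower (INR (S n)) p * INR (S n)).
    { rewrite <- RCpower_plus, <- E, RCpower_plus, RCpower_1; [reflexivity|].
      apply lt_0_INR. lia. }
    change (fact (S (S n))) with (S (S n) * fact (S n))%nat.
    rewrite mult_INR, RtoC_mult, (RtoC_INR_S (S n)).
    replace (rgamma q (S n) * (INR (fact (S n)) * RCpower (INR (S n)) q)
             * (rgamma r (S n) * (INR (fact (S n)) * RCpower (INR (S n)) r)))
      with (rgamma q (S n) * rgamma r (S n) * (INR (fact (S n)) * INR (fact (S n)))
            * (RCpower (INR (S n)) p * INR (S n))) by (rewrite <- Ep; ring).
    field. repeat split; auto using rgamma_neq0, RCpower_neq0, INR_fact_neq0_C, INR_S_neq0_C.
  - replace (/ Gamma p * Gamma q * Gamma r)
      with (/ Gamma p * Gamma q * Gamma r * 1) by ring.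
    repeat apply Clim_mult; auto.
    + apply Clim_shift, rgamma_lim.
    + apply Clim_linear_ratio.
Qed.

(** * The binomial series and an Abelian theorem *)

Lemma Clog_one_minus_exp_derive w : (0 < Re (1 - Cexp w))%R ->
  is_Cd (fun v => Clog (1 - Cexp v)) w (- (Cexp w / (1 - Cexp w))).
Proof.
  intro H.
  refine (is_Cd_eq _ _ _ _ _ (is_Cd_comp Clog (fun v => 1 - Cexp v) w _ _
    (Clog_derive _ H) (is_Cd_one_minus _ _ _ (Cexp_derive w)))).
  field. now apply Re_pos_neq0.
Qed.

(** The product of the series and [(1 - z)^p] has derivative zero, because [(1
    - z) f' = p f] holds for the series [f]. *)
Lemma binomial_series p z : (Cmod z < 1)%R ->
  psum (poch_quot p 1) z = Cexp (- p * Clog (1 - z)).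
Proof.
  intro Hz. set (c := poch_quot p 1).
  assert (Hs : subgeom c) by (apply subgeom_poch_div, one_plus_INR_neq0).
  set (F := fun w => psum c w * Cexp (p * Clog (1 - w))).
  assert (EF : F z = F 0).
  { rewrite <- (Cplus_0_l z). apply is_Cd_zero_segment. intros t Ht.
    rewrite Cplus_0_l. set (w := t * z).
    assert (Hw : (Cmod w < 1)%R).
    { unfold w. rewrite Cmod_mult, Cmod_R, Rabs_pos_eq by lra.
      generalize (Cmod_ge_0 z); nra. }
    assert (Hr := Re_one_minus w Hw).
    assert (E1 : psum (dcoef c) w = w * psum (dcoef c) w + p * psum c w).
    { refine (Csum_inj _ _ _ _ _ (subgeom_psum _ w (subgeom_dcoef c Hs) Hw)
        (Csum_plus _ _ _ _ (psum_theta c w Hs Hw) (Csum_scal p _ _ (subgeom_psum c w Hs Hw)))).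
      intro n. unfold dcoef. rewrite RtoC_INR_S, Cplus_comm. unfold c at 1.
      rewrite poch_quot_S by apply one_plus_INR_neq0. fold c. ring. }
    assert (HL : is_Cd (fun v => Clog (1 - v)) w (/ (1 - w) * - (1))).
    { apply (is_Cd_comp Clog (fun v => 1 - v)); [now apply Clog_derive|].
      apply is_Cd_one_minus, is_Cd_id. }
    refine (is_Cd_eq _ _ _ _ _ (is_Cd_mult _ _ _ _ _ (psum_derive c w Hs Hw)
              (is_Cd_exp _ _ _ (is_Cd_scal p _ _ _ HL)))).
    assert (H1 := Re_pos_neq0 _ Hr).
    assert (E2 : p * psum c w = (1 - w) * psum (dcoef c) w).
    { transitivity (w * psum (dcoef c) w + p * psum c w - w * psum (dcoef c) w); [ring|].
      rewrite <- E1. ring. }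
    transitivity (Cexp (p * Clog (1 - w))
                  * (psum (dcoef c) w - p * psum c w * / (1 - w))); [field; exact H1|].
    rewrite E2. field. exact H1. }
  assert (E0 : F 0 = 1).
  { unfold F. rewrite psum_0 by exact Hs.
    replace (1 - 0) with (RtoC 1) by ring.
    replace (Clog 1) with (RtoC 0).
    - rewrite Cmult_0_r, Cexp_0. unfold c, poch_quot; simpl. field.
    - unfold Clog. rewrite Cmod_1, ln_1. simpl. unfold Rdiv. rewrite Rmult_0_l, atan_0. reflexivity. }
  rewrite E0 in EF. unfold F in EF.
  replace (- p * Clog (1 - z)) with (- (p * Clog (1 - z))) by ring. rewrite Cexp_opp.
  transitivity (psum c z * Cexp (p * Clog (1 - z)) * / Cexp (p * Clog (1 - z))).
  - field. apply Cexp_neq0.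
  - rewrite EF. ring.
Qed.

(** For a positive parameter the binomial coefficients are real and
    nonnegative, so they can serve as the majorant in [abel_comparison]. *)
Lemma poch_quot_real (sg : R) n : (0 < sg)%R ->
  poch_quot sg 1 n = Cmod (poch_quot sg 1 n).
Proof.
  intro Hs.
  assert (H : exists g : R, (0 <= g)%R /\ poch sg n = g).
  { induction n as [|n [g [Hg IH]]]; [exists 1%R; split; [lra|reflexivity]|].
    exists (g * (sg + INR n))%R. split.
    - apply Rmult_le_pos; [exact Hg|]. generalize (pos_INR n). lra.
    - rewrite poch_S, IH, RtoC_mult, RtoC_plus. reflexivity. }
  destruct H as [g [Hg E]]. unfold poch_quot. rewrite E, poch_1.
  rewrite <- RtoC_div by apply INR_fact_neq_0. rewrite Cmod_R, Rabs_pos_eq; [reflexivity|].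
  apply Rdiv_le_0_compat; [exact Hg|apply INR_fact_lt_0].
Qed.

Lemma binomial_series_real (sg r : R) : (0 < sg)%R -> (0 <= r < 1)%R ->
  is_series (fun n => (Cmod (poch_quot sg 1 n) * r ^ n)%R) (Rpower (1 - r) (- sg)).
Proof.
  intros Hs Hr.
  assert (Hc : (Cmod r < 1)%R) by (rewrite Cmod_R, Rabs_pos_eq; lra).
  destruct (subgeom_psum (poch_quot sg 1) r (subgeom_poch_div _ _ one_plus_INR_neq0) Hc) as [H _].
  rewrite binomial_series in H by exact Hc.
  replace (Rpower (1 - r) (- sg)) with (Re (Cexp (- sg * Clog (1 - r)))).
  - revert H. apply is_series_ext. intro n.
    rewrite (poch_quot_real sg n Hs), <- RtoC_pow, <- RtoC_mult.
    rewrite <- poch_quot_real by exact Hs. reflexivity.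
  - rewrite <- RtoC_minus, <- RtoC_opp.
    replace (Clog (1 - r)%R) with (RtoC (ln (1 - r))).
    + rewrite <- RtoC_mult, Cexp_R. reflexivity.
    + unfold Clog. rewrite Cmod_R, Rabs_pos_eq by lra. simpl.
      unfold Rdiv. rewrite Rmult_0_l, atan_0. reflexivity.
Qed.

(** The curve [t -> e^(tw)] reaches [1] without touching the unit circle
    tangentially: [Cmod (1 - z)] and [1 - Cmod z] are both comparable to [t].
    *)
Lemma exp_path_bounds w : (Re w < 0)%R -> exists M N : R, (0 < M)%R /\ (0 < N)%R /\
  forall t : R, (0 < t <= 1)%R ->
    (Cmod (1 - Cexp (t * w)) <= M * t)%R /\ (t <= N * (1 - Cmod (Cexp (t * w))))%R.
Proof.
  intro Hw. set (m := Cmod w).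
  assert (Hm : (0 < m)%R).
  { eapply Rlt_le_trans; [|apply re_le_Cmod]. rewrite Rabs_left; lra. }
  exists (m + 4 * m ^ 2 * exp m)%R, (/ (- Re w * exp (Re w)))%R.
  assert (He := exp_pos (Re w)). assert (Hem := exp_pos m).
  assert (Hpe : (0 < - Re w * exp (Re w))%R) by nra.
  repeat split; [nra|now apply Rinv_0_lt_compat|..].
  - replace (1 - Cexp (t * w)) with (- ((Cexp (t * w) - 1 - t * w) + t * w)) by ring.
    rewrite Cmod_opp. eapply Rle_trans; [apply Cmod_triangle|].
    assert (H1 := Cexp_taylor1 (t * w)).
    assert (E : Cmod (t * w) = (t * m)%R) by (rewrite Cmod_mult, Cmod_R, Rabs_pos_eq; [reflexivity|lra]).
    rewrite E in *.
    assert (exp (t * m) <= exp m)%R.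
    { destruct (Req_dec t 1) as [->|Ht1]; [rewrite Rmult_1_l; lra|].
      left. apply exp_increasing. nra. }
    assert (4 * (t * m) ^ 2 * exp (t * m) <= 4 * m ^ 2 * exp m * t)%R; [|lra].
    replace (4 * m ^ 2 * exp m * t)%R with (4 * (t * m ^ 2) * exp m)%R by ring.
    assert (0 < exp (t * m))%R by apply exp_pos.
    apply Rmult_le_compat; nra.
  - rewrite Cmod_Cexp, Re_scal_R.
    assert (H1 := exp_ineq1_le (- (t * Re w))).
    rewrite exp_Ropp in H1. assert (Ht := exp_pos (t * Re w)).
    assert (H2 : ((1 + - (t * Re w)) * exp (t * Re w) <= 1)%R).
    { apply (Rmult_le_compat_r (exp (t * Re w))) in H1; [|lra].
      rewrite Rinv_l in H1 by lra. exact H1. }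
    assert (H3 : (exp (Re w) <= exp (t * Re w))%R).
    { destruct (Req_dec t 1) as [->|Ht1]; [rewrite Rmult_1_l; lra|].
      left. apply exp_increasing. nra. }
    apply (Rmult_le_reg_l (- Re w * exp (Re w))); [exact Hpe|].
    set (X := (- Re w * exp (Re w))%R) in *.
    replace (X * (/ X * (1 - exp (t * Re w))))%R with (1 - exp (t * Re w))%R by (field; lra).
    assert (H4 : (0 <= - (t * Re w) * (exp (t * Re w) - exp (Re w)))%R)
      by (apply Rmult_le_pos; nra).
    unfold X. lra.
Qed.

Lemma Cmod_power_le p v : (0 < Cmod v)%R ->
  (Cmod (Cexp (p * Clog v)) <= exp (2 * Rabs (Im p)) * Rpower (Cmod v) (Re p))%R.
Proof.
  intro Hv. rewrite Cmod_Cexp. unfold Rpower. rewrite <- exp_plus.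
  assert (Ha : (Rabs (atan (Im v / Re v)) <= 2)%R).
  { assert (H := atan_bound (Im v / Re v)). assert (H' := PI_4). apply Rabs_le. lra. }
  assert (Hle : (Re (p * Clog v) <= 2 * Rabs (Im p) + Re p * ln (Cmod v))%R).
  { unfold Clog. simpl. fold (Re p) (Im p).
    assert (H := RRle_abs (- (Im p * atan (Im v / Re v)))).
    rewrite Rabs_Ropp, Rabs_mult in H. assert (H' := Rabs_pos (Im p)).
    change (fst p) with (Re p). change (snd p) with (Im p). nra. }
  destruct Hle as [H|H]; [left; now apply exp_increasing|rewrite H; lra].
Qed.

(** Finitely many terms are absorbed into a geometric sequence, whose power
    series stays bounded near [1]. *)
Lemma finite_geometric_bound (d : nat -> C) N : exists B : R, (0 <= B)%R /\
  forall n, (n < N)%nat -> (Cmod (d n) <= B * (1 / 2) ^ n)%R.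
Proof.
  induction N as [|N [B [HB H]]].
  - exists 0%R. split; [lra|]. intros n Hn. lia.
  - assert (Hp : (0 < (1 / 2) ^ N)%R) by (apply pow_lt; lra).
    exists (B + Cmod (d N) / (1 / 2) ^ N)%R.
    assert (H0 : (0 <= Cmod (d N) / (1 / 2) ^ N)%R)
      by (apply Rdiv_le_0_compat; [apply Cmod_ge_0|exact Hp]).
    split; [lra|]. intros n Hn.
    assert (Hpn : (0 < (1 / 2) ^ n)%R) by (apply pow_lt; lra).
    destruct (Nat.eq_dec n N) as [->|Hne].
    + replace ((B + Cmod (d N) / (1 / 2) ^ N) * (1 / 2) ^ N)%R
        with (B * (1 / 2) ^ N + Cmod (d N))%R by (field; lra). nra.
    + specialize (H n ltac:(lia)). nra.
Qed.

(** If the coefficients [c n] are asymptotically [K] times those of [(1 -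
    z)^(-p)], then the same holds for the functions as [z -> 1]. The error in
    the coefficients is at most a small multiple of those of [(1 - r)^(- Re
    p)] with [r = Cmod z], up to a geometric sequence. On a non-tangential
    path, [(1 - r)^(- Re p)] times [Cmod (1 - z) ^ Re p] is bounded, and the
    geometric part disappears because [Re p > 0]. *)
Lemma abel_comparison (c : nat -> C) (p K w : C) :
  subgeom c -> (0 < Re p)%R -> Clim (fun n => c n / poch_quot p 1 n) K -> (Re w < 0)%R ->
  lim0 (fun t => psum c (Cexp (t * w)) * Cexp (p * Clog (1 - Cexp (t * w)))) K.
Proof.
  intros Hc Hp HK Hw eps He.
  set (beta := poch_quot p 1) in *. set (sg := Re p) in *.
  assert (Hreg : forall n, RtoC sg + INR n <> 0) by now apply (nonpole_Re_pos sg).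
  assert (Hbeta : subgeom beta) by apply subgeom_poch_div, one_plus_INR_neq0.
  assert (Hb0 : forall n, beta n <> 0).
  { intro n. unfold beta, poch_quot. rewrite poch_1. intro E.
    apply (poch_neq0 p n (nonpole_Re_pos p Hp)).
    replace (poch p n) with (poch p n / INR (fact n) * INR (fact n))
      by (field; apply INR_fact_neq0_C). rewrite E. ring. }
  destruct (poch_div_bounded p sg Hreg eq_refl) as [C0 HC0].
  assert (HC : exists C1 : R, (0 < C1)%R /\ forall n, (Cmod (beta n) <= C1 * Cmod (poch_quot sg 1 n))%R).
  { exists (Rabs C0 + 1)%R. split; [generalize (Rabs_pos C0); lra|]. intro n.
    replace (beta n) with (poch p n / poch sg n * poch_quot sg 1 n).
    - rewrite Cmod_mult. apply Rmult_le_compat_r; [apply Cmod_ge_0|].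
      specialize (HC0 n). generalize (RRle_abs C0). lra.
    - unfold beta, poch_quot. rewrite poch_1. field.
      split; auto using INR_fact_neq0_C, poch_neq0. }
  destruct HC as [C1 [HC1 HC]].
  destruct (exp_path_bounds w Hw) as (M & N & HM & HN & Hpath).
  set (A := exp (2 * Rabs (Im p))). assert (HA : (0 < A)%R) by apply exp_pos.
  set (Q := Rpower (M * N) sg). assert (HQ : (0 < Q)%R) by apply exp_pos.
  (* [A * Q] will bound [Cmod G * (1 - r) ^ (- sg)], and [C1] compares the
     coefficients for [p] with those for [sg]. *)
  set (e1 := (eps / (2 * A * Q * C1))%R).
  assert (HAQ : (0 < A * Q * C1)%R) by (repeat apply Rmult_lt_0_compat; assumption).
  assert (He1 : (0 < e1)%R) by (apply Rdiv_lt_0_compat; [exact He|lra]).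
  destruct (Clim_eventually _ _ HK e1 He1) as [N0 HN0].
  set (d := fun n => c n - K * beta n).
  destruct (finite_geometric_bound d N0) as [B [HB HBd]].
  assert (Hd : forall n, (Cmod (d n) <= e1 * C1 * Cmod (poch_quot sg 1 n) + B * (1 / 2) ^ n)%R).
  { intro n. assert (Hg := Cmod_ge_0 (poch_quot sg 1 n)).
    assert (Hh : (0 < (1 / 2) ^ n)%R) by (apply pow_lt; lra).
    assert (0 <= e1 * C1 * Cmod (poch_quot sg 1 n))%R
      by (apply Rmult_le_pos; [apply Rmult_le_pos|]; lra).
    assert (0 <= B * (1 / 2) ^ n)%R by nra.
    destruct (Nat.le_gt_cases N0 n) as [Hn|Hn].
    - unfold d. replace (c n - K * beta n) with ((c n / beta n - K) * beta n) by (field; apply Hb0).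
      rewrite Cmod_mult. specialize (HN0 n Hn). specialize (HC n).
      assert (Hc0 := Cmod_ge_0 (c n / beta n - K)).
      assert (Cmod (c n / beta n - K) * Cmod (beta n) <= e1 * (C1 * Cmod (poch_quot sg 1 n)))%R
        by (apply Rmult_le_compat; auto using Cmod_ge_0; lra).
      lra.
    - specialize (HBd n Hn). lra. }
  set (eta := (eps / (2 * A * (2 * B + 1)))%R).
  assert (Heta : (0 < eta)%R) by (apply Rdiv_lt_0_compat; [exact He|nra]).
  (* [t < t0] forces [Cmod (1 - z) ^ sg <= eta]. *)
  set (t0 := (Rpower eta (/ sg) / M)%R).
  assert (Ht0 : (0 < t0)%R) by (apply Rdiv_lt_0_compat; [apply exp_pos|exact HM]).
  generalize (near0_and _ _ (near0_lt 1 ltac:(lra)) (near0_lt t0 Ht0)).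
  apply near0_imp. intros t Htp [Ht1 Ht2].
  destruct (Hpath t ltac:(lra)) as [P1 P2].
  set (z := Cexp (t * w)) in *. set (r := Cmod z) in *.
  assert (Hr0 : (0 <= r)%R) by apply Cmod_ge_0.
  assert (Hr : (r < 1)%R) by nra.
  assert (Hz : (Cmod z < 1)%R) by exact Hr.
  assert (Hv0 : (0 < Cmod (1 - z))%R) by (apply Cmod_gt_0, Re_pos_neq0, Re_one_minus, Hz).
  assert (HG := Cmod_power_le p (1 - z) Hv0).
  set (G := Cexp (p * Clog (1 - z))) in *. fold A sg in HG.
  assert (HbG : psum beta z * G = 1).
  { unfold beta, G. rewrite binomial_series by exact Hz.
    replace (- p * Clog (1 - z)) with (- (p * Clog (1 - z))) by ring. apply Cexp_opp_l. }
  replace (psum c z * G - K) with ((psum c z - K * psum beta z) * G).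
  2: { transitivity (psum c z * G - K * (psum beta z * G)); [ring|]. rewrite HbG. ring. }
  assert (HD : (Cmod (psum c z - K * psum beta z) <= e1 * C1 * Rpower (1 - r) (- sg) + B * 2)%R).
  { eapply (Csum_bound (fun n => c n * z ^ n - K * (beta n * z ^ n)) (fun n => plus (scal (e1 * C1)%R (Cmod (poch_quot sg 1 n) * r ^ n)%R)
                                        (scal B ((1 / 2) ^ n)%R))).
    - intro n. cbv beta.
      replace (c n * z ^ n - K * (beta n * z ^ n)) with (d n * z ^ n) by (unfold d; ring).
      rewrite Cmod_mult, Cmod_pow. fold r. specialize (Hd n).
      assert (Hrn : (0 <= r ^ n)%R) by now apply pow_le.
      assert (Hrn1 : (r ^ n <= 1)%R) by (rewrite <- (pow1 n); apply pow_incr; lra).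
      assert (Hh : (0 < (1 / 2) ^ n)%R) by (apply pow_lt; lra).
      change (Cmod (d n) * r ^ n <= e1 * C1 * (Cmod (poch_quot sg 1 n) * r ^ n) + B * (1 / 2) ^ n)%R.
      apply (Rmult_le_compat_r (r ^ n)) in Hd; [|exact Hrn].
      assert (B * (1 / 2) ^ n * r ^ n <= B * (1 / 2) ^ n)%R; [|lra].
      rewrite <- (Rmult_1_r (B * (1 / 2) ^ n)) at 2. apply Rmult_le_compat_l; nra.
    - exact (Csum_minus _ _ _ _ (subgeom_psum c z Hc Hz) (Csum_scal K _ _ (subgeom_psum beta z Hbeta Hz))).
    - apply (is_series_plus (K := R_AbsRing) (V := R_NormedModule)).
      + apply (is_series_scal (K := R_AbsRing) (V := R_NormedModule)).
        apply binomial_series_real; [exact Hp|lra].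
      + replace (B * 2)%R with (scal B (/ (1 - 1 / 2))%R)
          by (unfold scal; simpl; unfold mult; simpl; field).
        apply (is_series_scal (K := R_AbsRing) (V := R_NormedModule)).
        apply is_series_geom. rewrite Rabs_pos_eq; lra. }
  assert (H1r : (0 < 1 - r)%R) by lra.
  assert (Hv1 : (Cmod (1 - z) <= M * N * (1 - r))%R).
  { eapply Rle_trans; [exact P1|]. rewrite Rmult_assoc. apply Rmult_le_compat_l; lra. }
  assert (HR1 : (Rpower (Cmod (1 - z)) sg <= Q * Rpower (1 - r) sg)%R).
  { unfold Q. rewrite Rpower_mult_distr; [|now apply Rmult_lt_0_compat|exact H1r].
    apply Rle_Rpower_l; [lra|]. split; assumption. }
  assert (HR2 : (Rpower (Cmod (1 - z)) sg <= eta)%R).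
  { replace eta with (Rpower (Rpower eta (/ sg)) sg).
    - apply Rle_Rpower_l; [lra|]. split; [exact Hv0|].
      eapply Rle_trans; [exact P1|].
      replace (Rpower eta (/ sg)) with (M * t0)%R by (unfold t0; field; lra).
      apply Rmult_le_compat_l; lra.
    - rewrite Rpower_mult, Rinv_l, Rpower_1; lra. }
  rewrite Cmod_mult.
  assert (HG0 := Cmod_ge_0 G). assert (Hrp : (0 < Rpower (1 - r) (- sg))%R) by apply exp_pos.
  assert (Einv : (Rpower (1 - r) sg * Rpower (1 - r) (- sg) = 1)%R).
  { rewrite <- Rpower_plus, Rplus_opp_r. now apply Rpower_O. }
  assert (HGr : (Cmod G * Rpower (1 - r) (- sg) <= A * Q)%R).
  { apply Rle_trans with (A * (Q * Rpower (1 - r) sg) * Rpower (1 - r) (- sg))%R.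
    - apply Rmult_le_compat_r; [lra|]. eapply Rle_trans; [exact HG|].
      apply Rmult_le_compat_l; lra.
    - right. transitivity (A * Q * (Rpower (1 - r) sg * Rpower (1 - r) (- sg)))%R; [ring|].
      rewrite Einv. ring. }
  assert (HGe : (Cmod G <= A * eta)%R).
  { eapply Rle_trans; [exact HG|]. apply Rmult_le_compat_l; lra. }
  apply Rle_lt_trans with (e1 * C1 * (Cmod G * Rpower (1 - r) (- sg)) + 2 * B * Cmod G)%R.
  { apply (Rmult_le_compat_r (Cmod G)) in HD; [|exact HG0]. lra. }
  assert (HeC : (0 < e1 * C1)%R) by now apply Rmult_lt_0_compat.
  apply Rle_lt_trans with (e1 * C1 * (A * Q) + 2 * B * (A * eta))%R.
  { apply Rplus_le_compat; apply Rmult_le_compat_l; lra. }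
  replace (e1 * C1 * (A * Q))%R with (eps / 2)%R by (unfold e1; field; lra).
  replace (2 * B * (A * eta))%R with (eps / 2 * (2 * B / (2 * B + 1)))%R
    by (unfold eta; field; lra).
  assert (2 * B / (2 * B + 1) < 1)%R; [|nra].
  apply (Rmult_lt_reg_r (2 * B + 1)); [lra|].
  unfold Rdiv. rewrite Rmult_assoc, Rinv_l by lra. lra.
Qed.

(** The constant function [1] has a series whose coefficients are
    asymptotically [K = 0] times the binomial ones. *)
Lemma power_one_minus_exp_lim0 (p w : C) : (0 < Re p)%R -> (Re w < 0)%R ->
  lim0 (fun t => Cexp (p * Clog (1 - Cexp (t * w)))) 0.
Proof.
  intros Hp Hw.
  apply (lim0_ext (fun t => psum (poch_quot 0 1) (Cexp (t * w)) * Cexp (p * Clog (1 - Cexp (t * w))))).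
  - exists 1%R. split; [lra|]. intros t Ht. rewrite binomial_series.
    + replace (- (0) * Clog (1 - Cexp (t * w))) with (RtoC 0) by ring. rewrite Cexp_0. ring.
    + rewrite Cmod_Cexp, Re_scal_R, <- exp_0. apply exp_increasing. nra.
  - apply abel_comparison; auto.
    + apply subgeom_poch_div, one_plus_INR_neq0.
    + apply Clim_shift. apply (Clim_ext (fun _ => 0)); [|apply Clim_const].
      intro n. unfold poch_quot at 1. replace (poch 0 (S n)) with (RtoC 0).
      * unfold Cdiv. ring.
      * rewrite poch_S_l. ring.
Qed.

(** * The series on the unit disc *)

Definition disc_sol (a b z : C) : C := psum (poch_quot a (2 - b)) z.

(** [(q + n) c_(n+1) = (p + n) c_n] says that the Euler operator [D] satisfies
    [(D + q - 1) f - (q - 1) = z (D + p) f]. *)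
Lemma poch_quot_ode p q z : (forall n, q + INR n <> 0) -> (Cmod z < 1)%R ->
  (1 - z) * (z * psum (dcoef (poch_quot p q)) z) + (q - 1 - p * z) * psum (poch_quot p q) z
  = q - 1.
Proof.
  intros Hq Hz. assert (Hs := subgeom_poch_div p q Hq).
  set (c := poch_quot p q) in *. set (h := psum c z). set (d := psum (dcoef c) z).
  assert (Hth := psum_theta c z Hs Hz).
  assert (L := Csum_plus _ _ _ _ (Csum_tail _ _ Hth)
                 (Csum_scal (q - 1) _ _ (psum_tail c z Hs Hz))).
  assert (R := Csum_scal z _ _ (Csum_plus _ _ _ _ Hth
                 (Csum_scal p _ _ (subgeom_psum c z Hs Hz)))).
  assert (E := fun H => Csum_inj _ _ _ _ H L R).
  fold h d in E.
  assert (E' : z * d - INR 0 * c O * z ^ 0 + (q - 1) * (h - c O)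
               = z * (z * d + p * h)).
  { apply E. intro n. rewrite Cpow_S, (RtoC_INR_S n).
    replace ((INR n + 1) * c (S n) * (z * z ^ n) + (q - 1) * (c (S n) * (z * z ^ n)))
      with ((q + INR n) * c (S n) * (z * z ^ n)) by ring.
    unfold c. rewrite poch_quot_S by exact Hq. ring. }
  assert (Ec : c O = 1) by (unfold c, poch_quot; simpl; field).
  rewrite Ec in E'. simpl in E'.
  replace ((1 - z) * (z * d) + (q - 1 - p * z) * h)
    with (z * d - 0 * 1 * 1 + (q - 1) * (h - 1) + (q - 1) - z * (z * d + p * h)) by ring.
  rewrite E'. ring.
Qed.

(** [p (p+1)_n = (p + n) (p)_n]: raising the upper parameter is the operator
    [D + p]. *)
Lemma poch_quot_raise p q z : (forall n, q + INR n <> 0) -> (Cmod z < 1)%R ->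
  p * psum (poch_quot (p + 1) q) z
  = z * psum (dcoef (poch_quot p q)) z + p * psum (poch_quot p q) z.
Proof.
  intros Hq Hz.
  assert (Hs := subgeom_poch_div p q Hq). assert (Hs' := subgeom_poch_div (p + 1) q Hq).
  refine (Csum_inj _ _ _ _ _ (Csum_scal p _ _ (subgeom_psum _ z Hs' Hz))
    (Csum_plus _ _ _ _ (psum_theta _ z Hs Hz) (Csum_scal p _ _ (subgeom_psum _ z Hs Hz)))).
  intro n.
  assert (E : p * poch_quot (p + 1) q n = (p + INR n) * poch_quot p q n).
  { unfold poch_quot, Cdiv. rewrite Cmult_assoc, <- poch_S_l, poch_S. ring. }
  replace (p * (poch_quot (p + 1) q n * z ^ n)) with (p * poch_quot (p + 1) q n * z ^ n) by ring.
  rewrite E. ring.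
Qed.

(** * The solution that is analytic at 1 *)

(** The coefficients of the hypergeometric series of the theorem. *)
Definition even_coef (a b : C) (n : nat) : C :=
  poch a n * poch b n / (poch ((a + b) / 2) n * poch ((1 + a + b) / 2) n).

(** The companion series: [i sin x] times it is the odd part, in [x], of
    [e^(ix) W(e^(2ix))], as [cos x] times the first series is the even part.
    *)
Definition odd_coef (a b : C) (n : nat) : C :=
  (b - a) * (even_coef a b n * / ((a + b) + INR (2 * n))).

(** [sin^2 x] as a function of [z = e^(2ix)]. *)
Definition quad_var (z : C) : C := - ((1 - z) ^ 2) / (4 * z).

(** The prefactors are [e^(-ix) cos x] and [i e^(-ix) sin x]. *)
Definition reg_sol (a b z : C) : C :=
  (1 + / z) / 2 * psum (even_coef a b) (quad_var z) + (1 - / z) / 2 * psum (odd_coef a b) (quad_var z).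

Lemma subgeom_even_coef a b : nonpole (a + b) -> subgeom (even_coef a b).
Proof.
  intro H. apply (subgeom_ext (fun n => poch_quot a ((a + b) / 2) n * poch_quot b ((1 + (a + b)) / 2) n)).
  - intro n. unfold poch_quot, even_coef. rewrite Cplus_assoc. field.
    split; apply poch_neq0; [rewrite <- Cplus_assoc; now apply nonpole_half_S|now apply nonpole_half].
  - apply subgeom_mult; apply subgeom_poch_div; [now apply nonpole_half|now apply nonpole_half_S].
Qed.

Lemma subgeom_odd_coef a b : nonpole (a + b) -> subgeom (odd_coef a b).
Proof.
  intro H. apply subgeom_mult; [apply subgeom_const|]. apply subgeom_mult; [now apply subgeom_even_coef|].
  apply (subgeom_ext (fun n => / 2 * / ((a + b) / 2 + INR n))).
  - intro n. rewrite RtoC_INR_double. field.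
    assert (E := nonpole_half _ H n). assert (E' := H (2 * n)%nat).
    rewrite RtoC_INR_double in E'.
    repeat split; auto using C2_nz.
  - apply subgeom_mult; [apply subgeom_const|]. apply subgeom_inv_linear. now apply nonpole_half.
Qed.

Lemma odd_coef_rec a b n : nonpole (a + b) ->
  (a + b + 2 * INR n) * odd_coef a b n = (b - a) * even_coef a b n.
Proof.
  intro H. unfold odd_coef. rewrite RtoC_INR_double. field.
  assert (E' := H (2 * n)%nat). now rewrite RtoC_INR_double in E'.
Qed.

(** The product of [2n + 2a] and [2n + 2b] is [(s + 2n)^2 - (b - a)^2];
    dividing by [s + 2n] splits the two-term recurrence into first-order
    relations between the two sequences. *)
Lemma even_coef_rec a b n : nonpole (a + b) ->
  (a + b + 2 * INR n + 1) * even_coef a b (S n)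
  = (a + b + 2 * INR n) * even_coef a b n - (b - a) * odd_coef a b n.
Proof.
  intro H. unfold odd_coef, even_coef. rewrite !poch_S, RtoC_INR_double.
  assert (E1 := nonpole_half _ H n). assert (E2 := nonpole_half_S _ H n).
  assert (E3 := H (2 * n)%nat). rewrite RtoC_INR_double in E3.
  assert (E4 := H (S (2 * n))). rewrite RtoC_INR_S, RtoC_INR_double in E4.
  assert (P1 := poch_neq0 _ n (nonpole_half _ H)).
  assert (P2 := poch_neq0 _ n (nonpole_half_S _ H)).
  rewrite Cplus_assoc in E2, P2.
  set (A := poch ((a + b) / 2) n) in *. set (B := poch ((1 + a + b) / 2) n) in *.
  replace ((a + b) / 2 + INR n) with ((a + b + 2 * INR n) / 2) by (field; apply C2_nz).
  replace ((1 + a + b) / 2 + INR n) with ((a + b + 2 * INR n + 1) / 2) by (field; apply C2_nz).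
  field. repeat split; auto using C2_nz.
  replace (a + b + 2 * INR n + 1) with (a + b + (2 * INR n + 1)) by ring. exact E4.
Qed.

Lemma even_coef_0 a b : even_coef a b 0 = 1.
Proof. unfold even_coef. simpl. field. Qed.

Lemma even_series_ode a b T : nonpole (a + b) -> (Cmod T < 1)%R ->
  2 * (1 - T) * (T * psum (dcoef (even_coef a b)) T)
  = T * ((a + b) * psum (even_coef a b) T - (b - a) * psum (odd_coef a b) T)
    - (a + b - 1) * (psum (even_coef a b) T - 1).
Proof.
  intros H HT.
  assert (He := subgeom_even_coef a b H). assert (Hf := subgeom_odd_coef a b H).
  set (e := psum (even_coef a b) T). set (d := psum (dcoef (even_coef a b)) T).
  set (f := psum (odd_coef a b) T).
  assert (Hth := psum_theta _ T He HT).
  assert (L := Csum_plus _ _ _ _ (Csum_scal 2 _ _ (Csum_tail _ _ Hth))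
                 (Csum_scal (a + b - 1) _ _ (psum_tail _ T He HT))).
  assert (R := Csum_scal T _ _ (Csum_minus _ _ _ _
     (Csum_plus _ _ _ _ (Csum_scal 2 _ _ Hth) (Csum_scal (a + b) _ _ (subgeom_psum _ T He HT)))
     (Csum_scal (b - a) _ _ (subgeom_psum _ T Hf HT)))).
  assert (E := fun H => Csum_inj _ _ _ _ H L R).
  fold e d f in E.
  assert (E' : 2 * (T * d - INR 0 * even_coef a b O * T ^ 0) + (a + b - 1) * (e - even_coef a b O)
               = T * (2 * (T * d) + (a + b) * e - (b - a) * f)).
  { apply E. intro n. rewrite Cpow_S, (RtoC_INR_S n).
    transitivity ((a + b + 2 * INR n + 1) * even_coef a b (S n) * (T * T ^ n)); [ring|].
    rewrite even_coef_rec by exact H. ring. }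
  rewrite even_coef_0 in E'. simpl in E'.
  replace (2 * (1 - T) * (T * d))
    with (2 * (T * d - 0 * 1 * 1) + (a + b - 1) * (e - 1) - (a + b - 1) * (e - 1) - 2 * T * (T * d))
    by ring.
  rewrite E'. ring.
Qed.

Lemma odd_series_ode a b T : nonpole (a + b) -> (Cmod T < 1)%R ->
  2 * (T * psum (dcoef (odd_coef a b)) T)
  = (b - a) * psum (even_coef a b) T - (a + b) * psum (odd_coef a b) T.
Proof.
  intros H HT.
  assert (He := subgeom_even_coef a b H). assert (Hf := subgeom_odd_coef a b H).
  refine (Csum_inj _ _ _ _ _ (Csum_scal 2 _ _ (psum_theta _ T Hf HT))
    (Csum_minus _ _ _ _ (Csum_scal (b - a) _ _ (subgeom_psum _ T He HT))
       (Csum_scal (a + b) _ _ (subgeom_psum _ T Hf HT)))).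
  intro n. assert (E := odd_coef_rec a b n H).
  transitivity (((a + b + 2 * INR n) * odd_coef a b n - (a + b) * odd_coef a b n) * T ^ n); [ring|].
  rewrite E. ring.
Qed.

Lemma quad_var_derive (z : C) : z <> 0 -> is_Cd quad_var z ((1 - z ^ 2) / (4 * z ^ 2)).
Proof.
  intro Hz. assert (H4 := C4_nz).
  apply (is_Cd_ext (fun w => (- / 4) * ((1 - w) * (1 - w) * / w))).
  - intro w. unfold quad_var, Cdiv. destruct (classic (w = 0)) as [->|Hw].
    + rewrite Cmult_0_r, Cinv_0. ring.
    + simpl. field. auto.
  - assert (D1 := is_Cd_one_minus _ _ _ (is_Cd_id z)).
    refine (is_Cd_eq _ _ _ _ _ (is_Cd_scal _ _ _ _ (is_Cd_mult _ _ _ _ _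
              (is_Cd_mult _ _ _ _ _ D1 D1) (is_Cd_inv_id z Hz)))).
    field. auto.
Qed.

Definition reg_sol_der (a b z : C) : C :=
  / 2 * - / z ^ 2 * psum (even_coef a b) (quad_var z)
  + (1 + / z) / 2 * (psum (dcoef (even_coef a b)) (quad_var z) * ((1 - z ^ 2) / (4 * z ^ 2)))
  + (/ 2 * / z ^ 2 * psum (odd_coef a b) (quad_var z)
     + (1 - / z) / 2 * (psum (dcoef (odd_coef a b)) (quad_var z) * ((1 - z ^ 2) / (4 * z ^ 2)))).

Lemma reg_sol_derive (a b z : C) : nonpole (a + b) -> z <> 0 -> (Cmod (quad_var z) < 1)%R ->
  is_Cd (reg_sol a b) z (reg_sol_der a b z).
Proof.
  intros H Hz HT.
  assert (He := is_Cd_comp _ _ _ _ _ (psum_derive _ _ (subgeom_even_coef a b H) HT) (quad_var_derive z Hz)).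
  assert (Hf := is_Cd_comp _ _ _ _ _ (psum_derive _ _ (subgeom_odd_coef a b H) HT) (quad_var_derive z Hz)).
  assert (Hp : is_Cd (fun w => (1 + / w) / 2) z (/ 2 * - / z ^ 2)).
  { apply (is_Cd_ext (fun w => / 2 * (1 + / w))); [intro; unfold Cdiv; ring|].
    refine (is_Cd_eq _ _ _ _ _ (is_Cd_scal (/ 2) _ _ _ (is_Cd_plus _ _ _ _ _ (is_Cd_const 1 z) (is_Cd_inv_id z Hz)))).
    ring. }
  assert (Hm : is_Cd (fun w => (1 - / w) / 2) z (/ 2 * / z ^ 2)).
  { apply (is_Cd_ext (fun w => / 2 * (1 - / w))); [intro; unfold Cdiv; ring|].
    refine (is_Cd_eq _ _ _ _ _ (is_Cd_scal (/ 2) _ _ _ (is_Cd_one_minus _ _ _ (is_Cd_inv_id z Hz)))).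
    ring. }
  exact (is_Cd_plus _ _ _ _ _ (is_Cd_mult _ _ _ _ _ Hp He) (is_Cd_mult _ _ _ _ _ Hm Hf)).
Qed.

(** The combination of the two series relations uses [(1 - z) z dT/dz = - (1 +
    z) T] and [1 - T = (1 + z)^2 / (4z)]. *)
Lemma reg_sol_ode (a b z : C) : nonpole (a + b) -> z <> 0 -> (Cmod (quad_var z) < 1)%R ->
  (1 - z) * (z * reg_sol_der a b z) + (1 - b - a * z) * reg_sol a b z = 1 - (a + b).
Proof.
  intros H Hz HT.
  assert (E1 := even_series_ode a b _ H HT). assert (E2 := odd_series_ode a b _ H HT).
  unfold reg_sol_der, reg_sol.
  set (e := psum (even_coef a b) (quad_var z)) in *. set (f := psum (odd_coef a b) (quad_var z)) in *.
  set (e' := psum (dcoef (even_coef a b)) (quad_var z)) in *.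
  set (f' := psum (dcoef (odd_coef a b)) (quad_var z)) in *.
  assert (H4 := C4_nz).
  (* The derivatives enter only through [T e'] and [T f'], in the very
     combinations that [E1] and [E2] evaluate. *)
  transitivity ((1 - z) / (2 * z) * (f - e) - 2 * (1 - quad_var z) * (quad_var z * e')
     - (1 + z) * (1 - / z) / 4 * (2 * (quad_var z * f'))
     + (1 - b - a * z) * ((1 + / z) / 2 * e + (1 - / z) / 2 * f)).
  - unfold quad_var. field. auto using C2_nz.
  - rewrite E1, E2. unfold quad_var. field. auto using C2_nz.
Qed.

Lemma even_coef_raise a b n : nonpole (a + b) ->
  2 * (a / (a + b)) * even_coef (a + 1) b n = even_coef a b n - odd_coef a b n.
Proof.
  intro H. assert (H' := nonpole_S _ H).
  destruct (nonpole_linear _ n H) as [E1 E2]. assert (Hs := nonpole_neq0 _ H).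
  unfold odd_coef, even_coef. rewrite RtoC_INR_double.
  replace ((a + 1 + b) / 2) with ((1 + a + b) / 2) by (unfold Cdiv; ring).
  replace ((1 + (a + 1) + b) / 2) with ((a + b) / 2 + 1) by (field; apply C2_nz).
  assert (P1 := poch_neq0 _ n (nonpole_half _ H)).
  assert (P2 := poch_neq0 _ n (nonpole_half_S _ H)).
  rewrite Cplus_assoc in P2.
  assert (P3 : poch ((a + b) / 2 + 1) n <> 0).
  { apply poch_neq0. intro m.
    replace ((a + b) / 2 + 1 + INR m) with ((a + b) / 2 + INR (S m)) by (rewrite RtoC_INR_S; ring).
    now apply nonpole_half. }
  assert (A1 : a * poch (a + 1) n = poch a n * (a + INR n)) by (now rewrite <- poch_S_l, poch_S).
  assert (A2 : (a + b) / 2 * poch ((a + b) / 2 + 1) n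
               = poch ((a + b) / 2) n * ((a + b) / 2 + INR n)) by (now rewrite <- poch_S_l, poch_S).
  set (p1 := poch ((a + b) / 2 + 1) n) in *. set (p0 := poch ((a + b) / 2) n) in *.
  set (p2 := poch ((1 + a + b) / 2) n) in *.
  replace (2 * (a / (a + b)) * (poch (a + 1) n * poch b n / (p2 * p1)))
    with (a * poch (a + 1) n * poch b n / (p2 * ((a + b) / 2 * p1)))
    by (field; auto using C2_nz).
  rewrite A1, A2. field. repeat split; auto using C2_nz.
Qed.

Lemma odd_coef_raise a b n : nonpole (a + b) ->
  2 * (a / (a + b)) * odd_coef (a + 1) b n = even_coef a b (S n) - even_coef a b n + odd_coef a b n.
Proof.
  intro H. destruct (nonpole_linear _ n H) as [E1 E2].
  assert (Hr := even_coef_raise a b n H).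
  assert (R1 := even_coef_rec a b n H). assert (R2 := odd_coef_rec a b n H).
  assert (D : even_coef a b (S n) = ((a + b + 2 * INR n) * even_coef a b n - (b - a) * odd_coef a b n)
                                / (a + b + 2 * INR n + 1)).
  { rewrite <- R1. field. exact E2. }
  rewrite D. unfold odd_coef at 1. rewrite RtoC_INR_double.
  replace (2 * (a / (a + b)) * ((b - (a + 1)) * (even_coef (a + 1) b n * / (a + 1 + b + 2 * INR n))))
    with ((b - a - 1) * (2 * (a / (a + b)) * even_coef (a + 1) b n) / (a + b + 2 * INR n + 1)).
  2: { replace (a + 1 + b + 2 * INR n) with (a + b + 2 * INR n + 1) by ring. unfold Cdiv. ring. }
  rewrite Hr.
  assert (Z : (b - a) * even_coef a b n - (a + b + 2 * INR n) * odd_coef a b n = 0)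
    by (rewrite R2; ring).
  set (N := a + b + 2 * INR n) in *. set (e := even_coef a b n) in *. set (f := odd_coef a b n) in *.
  transitivity ((N * e - (b - a) * f) / (N + 1) - e + f
                + ((b - a) * e - N * f) / (N + 1)).
  - field. exact E2.
  - rewrite Z. field. exact E2.
Qed.

(** Contiguous relation; the coefficients of its two parts are compared in
    [even_coef_raise] and [odd_coef_raise]. *)
Lemma reg_sol_raise (a b z : C) : nonpole (a + b) -> z <> 0 -> (Cmod (quad_var z) < 1)%R ->
  reg_sol a b z = 1 + a / (a + b) * (1 - z) * reg_sol (a + 1) b z.
Proof.
  intros H Hz HT.
  assert (H' : nonpole (a + 1 + b)).
  { replace (a + 1 + b) with (a + b + 1) by ring. now apply nonpole_S. }
  assert (He := subgeom_even_coef a b H). assert (Hf := subgeom_odd_coef a b H).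
  assert (He' := subgeom_even_coef _ b H'). assert (Hf' := subgeom_odd_coef _ b H').
  set (T := quad_var z) in *.
  assert (E1 : 2 * (a / (a + b)) * psum (even_coef (a + 1) b) T
               = psum (even_coef a b) T - psum (odd_coef a b) T).
  { refine (Csum_inj _ _ _ _ _ (Csum_scal _ _ _ (subgeom_psum _ T He' HT))
      (Csum_minus _ _ _ _ (subgeom_psum _ T He HT) (subgeom_psum _ T Hf HT))).
    intro n. rewrite Cmult_assoc, even_coef_raise by exact H. ring. }
  assert (E2 : 2 * (a / (a + b)) * T * psum (odd_coef (a + 1) b) T
               = psum (even_coef a b) T - even_coef a b O
                 + T * (psum (odd_coef a b) T - psum (even_coef a b) T)).
  { refine (Csum_inj _ _ _ _ _ (Csum_scal _ _ _ (subgeom_psum _ T Hf' HT))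
      (Csum_plus _ _ _ _ (psum_tail _ T He HT)
        (Csum_scal T _ _ (Csum_minus _ _ _ _ (subgeom_psum _ T Hf HT) (subgeom_psum _ T He HT))))).
    intro n.
    replace (2 * (a / (a + b)) * T * (odd_coef (a + 1) b n * T ^ n))
      with (2 * (a / (a + b)) * odd_coef (a + 1) b n * (T * T ^ n)) by ring.
    rewrite odd_coef_raise by exact H. rewrite Cpow_S. ring. }
  rewrite even_coef_0 in E2. unfold reg_sol. fold T.
  transitivity (1 + (1 - z) * (1 + / z) / 4 * (2 * (a / (a + b)) * psum (even_coef (a + 1) b) T)
                + 2 * (a / (a + b)) * T * psum (odd_coef (a + 1) b) T).
  - rewrite E1, E2. unfold T, quad_var. field. exact Hz.
  - unfold T, quad_var at 2. field. split; auto using nonpole_neq0.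
Qed.

(** * The difference of the two solutions *)

(** [w = log z] for [z] in the unit disc with [Cmod (quad_var z) < 1], cut
    along the negative axis; see [Cmod_quad_var_exp] for the last condition.
    *)
Definition log_domain (w : C) : Prop :=
  (Re w < 0 /\ Rabs (Im w) < PI /\ cosh (Re w) - cos (Im w) < 2)%R.

Lemma Cmod_quad_var_exp w : Cmod (quad_var (Cexp w)) = ((cosh (Re w) - cos (Im w)) / 2)%R.
Proof.
  assert (H4 := C4_nz).
  unfold quad_var. rewrite Cmod_div by (apply Cmult_neq_0; [exact H4|apply Cexp_neq0]).
  rewrite Cmod_opp, Cmod_pow, Cmod_mult, Cmod_Cexp, Cmod_R, Rabs_pos_eq by lra.
  rewrite Cmod2_alt.
  replace (Re (1 - Cexp w)) with (1 - exp (Re w) * cos (Im w))%R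
    by (rewrite <- Re_Cexp; reflexivity).
  replace (Im (1 - Cexp w)) with (- (exp (Re w) * sin (Im w)))%R
    by (rewrite <- Im_Cexp; simpl; unfold Im; ring).
  assert (Hsc := sin2_cos2 (Im w)). unfold Rsqr in Hsc.
  unfold cosh. rewrite exp_Ropp. assert (Hp := exp_pos (Re w)).
  set (p := exp (Re w)) in *. set (c := cos (Im w)) in *. set (s := sin (Im w)) in *.
  replace ((1 - p * c) ^ 2 + (- (p * s)) ^ 2)%R
    with (1 - 2 * p * c + p ^ 2 * (s * s + c * c))%R by ring.
  rewrite Hsc. field. lra.
Qed.

Lemma log_domain_disc w : log_domain w -> (Cmod (Cexp w) < 1)%R.
Proof.
  intros [H _]. rewrite Cmod_Cexp, <- exp_0. now apply exp_increasing.
Qed.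

Lemma log_domain_quad_var w : log_domain w -> (Cmod (quad_var (Cexp w)) < 1)%R.
Proof. intros (_ & _ & H). rewrite Cmod_quad_var_exp. lra. Qed.

Lemma cos_Rabs y : cos (Rabs y) = cos y.
Proof. unfold Rabs. destruct (Rcase_abs y); [apply cos_neg|reflexivity]. Qed.

(** [cosh] increases away from [0], and [cos] decreases on [[0, PI]]. *)
Lemma log_domain_star (t : R) w : (0 < t <= 1)%R -> log_domain w -> log_domain (t * w).
Proof.
  intros Ht (H1 & H2 & H3). unfold log_domain. rewrite Re_scal_R, Im_scal_R.
  set (p := Re w) in *. set (q := Im w) in *.
  assert (Hq := Rabs_pos q).
  assert (Eq : Rabs (t * q) = (t * Rabs q)%R) by (rewrite Rabs_mult, (Rabs_pos_eq t); lra).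
  repeat split; [nra|rewrite Eq; nra|].
  assert (Hc : (cos q <= cos (t * q))%R).
  { rewrite <- (cos_Rabs q), <- (cos_Rabs (t * q)), Eq.
    apply cos_decr_1; nra. }
  assert (Hch : (cosh (t * p) <= cosh p)%R); [|lra].
  unfold cosh. rewrite !exp_Ropp.
  assert (Hv : (0 < exp p)%R) by apply exp_pos.
  assert (Huv : (exp p <= exp (t * p))%R).
  { destruct (Req_dec t 1) as [->|Ht1]; [rewrite Rmult_1_l; lra|].
    left. apply exp_increasing. nra. }
  assert (Hu : (exp (t * p) <= 1)%R).
  { rewrite <- exp_0. left. apply exp_increasing. nra. }
  set (u := exp (t * p)) in *. set (v := exp p) in *.
  assert (E : (v + / v - (u + / u) = (u - v) * (1 - u * v) * / (u * v))%R) by (field; lra).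
  assert (0 <= (u - v) * (1 - u * v) * / (u * v))%R; [|lra].
  apply Rmult_le_pos; [apply Rmult_le_pos; nra|].
  left. apply Rinv_0_lt_compat. nra.
Qed.

Definition sol_diff (a b z : C) : C := disc_sol a b z - (1 - b) / (1 - (a + b)) * reg_sol a b z.

(** A difference of two solutions divided by the homogeneous solution [z^(b-1)
    (1-z)^(1-s)], in the coordinate [w = log z]. *)
Definition first_integral (a b w : C) : C :=
  sol_diff a b (Cexp w) * Cexp ((1 - b) * w) * Cexp ((a + b - 1) * Clog (1 - Cexp w)).

Lemma first_integral_derive a b w : (forall n, 2 - b + INR n <> 0) -> nonpole (a + b) ->
  1 - (a + b) <> 0 -> log_domain w -> is_Cd (first_integral a b) w 0.
Proof.
  intros Hb Hs Hs1 Hw.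
  assert (Hz1 := log_domain_disc w Hw). assert (HT := log_domain_quad_var w Hw).
  set (z := Cexp w). assert (Hz := Cexp_neq0 w).
  assert (Hre := Re_one_minus _ Hz1). assert (Hz3 := Re_pos_neq0 _ Hre).
  assert (O1 := poch_quot_ode a (2 - b) z Hb Hz1). assert (O2 := reg_sol_ode a b z Hs Hz HT).
  assert (Dh := is_Cd_comp _ Cexp w _ _ (psum_derive _ z (subgeom_poch_div a _ Hb) Hz1) (Cexp_derive w)).
  assert (DW := is_Cd_comp _ Cexp w _ _ (reg_sol_derive a b z Hs Hz HT) (Cexp_derive w)).
  assert (DR := is_Cd_minus _ _ _ _ _ Dh (is_Cd_scal ((1 - b) / (1 - (a + b))) _ _ _ DW)).
  assert (D1 := is_Cd_exp _ _ _ (is_Cd_scal (1 - b) _ _ _ (is_Cd_id w))).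
  assert (D2 := is_Cd_exp _ _ _ (is_Cd_scal (a + b - 1) _ _ _ (Clog_one_minus_exp_derive w Hre))).
  refine (is_Cd_eq _ _ _ _ _ (is_Cd_mult _ _ _ _ _ (is_Cd_mult _ _ _ _ _ DR D1) D2)).
  fold z in Hz, Hz3 |- *.
  set (h := psum (poch_quot a (2 - b)) z) in *. set (h' := psum (dcoef (poch_quot a (2 - b))) z) in *.
  set (W := reg_sol a b z) in *. set (W' := reg_sol_der a b z) in *.
  set (X := Cexp ((1 - b) * w)). set (Y := Cexp ((a + b - 1) * Clog (1 - z))).
  transitivity (X * Y / (1 - z) *
    (((1 - z) * (z * h') + (2 - b - 1 - a * z) * h)
     - (1 - b) / (1 - (a + b)) * ((1 - z) * (z * W') + (1 - b - a * z) * W))).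
  - field. auto.
  - rewrite O1, O2. field. auto.
Qed.

Lemma first_integral_star a b w (t : R) : (forall n, 2 - b + INR n <> 0) -> nonpole (a + b) ->
  1 - (a + b) <> 0 -> log_domain w -> (0 < t <= 1)%R -> first_integral a b w = first_integral a b (t * w).
Proof.
  intros Hb Hs Hs1 Hw Ht.
  replace (first_integral a b w) with (first_integral a b (t * w + (1 - t)%R * w))
    by (f_equal; rewrite RtoC_minus; ring).
  apply is_Cd_zero_segment. intros u Hu.
  replace (t * w + u * ((1 - t)%R * w)) with ((t + u * (1 - t))%R * w)
    by (rewrite RtoC_plus, RtoC_mult; ring).
  apply first_integral_derive; auto. apply log_domain_star; [split; nra|exact Hw].
Qed.

Lemma quad_var_1 : quad_var 1 = 0.
Proof. unfold quad_var, Cdiv. simpl. ring. Qed.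

(** The value of [first_integral], with [/ Gamma a = 0] at the poles of
    [Gamma]. *)
Definition conn_const (a b : C) : C := / Gamma a * Gamma (2 - b) * Gamma (a + b - 1).

(** * The constant *)

(** [first_integral] is constant on the segment from [w] to [0]. As [t -> 0]
    the part with [reg_sol] vanishes, since [reg_sol] is continuous at [1] and
    [(1 - z)^(s-1)] tends to [0], and the Abelian theorem gives the limit of
    the other part. *)
Lemma first_integral_const_large (a b w : C) : (forall n, 2 - b + INR n <> 0) ->
  (1 < Re (a + b))%R -> log_domain w -> first_integral a b w = conn_const a b.
Proof.
  intros Hb Hre Hw.
  assert (Hp : (0 < Re (a + b - 1))%R) by (change (0 < Re (a + b) + - (1))%R; lra).
  assert (Hs : nonpole (a + b)) by (apply nonpole_Re_pos; lra).
  assert (Hs1 : 1 - (a + b) <> 0).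
  { intro E. apply (Re_pos_neq0 _ Hp). replace (a + b - 1) with (- (1 - (a + b))) by ring.
    rewrite E. ring. }
  assert (Hw0 : (Re w < 0)%R) by apply Hw.
  apply (lim0_unique (fun t => first_integral a b (t * w))).
  { apply (lim0_ext (fun _ => first_integral a b w)); [|apply lim0_const].
    exists 1%R. split; [lra|]. intros t Ht. apply first_integral_star; auto. lra. }
  set (G := fun t : R => Cexp ((a + b - 1) * Clog (1 - Cexp (t * w)))).
  set (X := fun t : R => Cexp ((1 - b) * (t * w))).
  set (c := (1 - b) / (1 - (a + b))).
  assert (HX : lim0 X 1).
  { assert (H := lim0_path (fun v => Cexp ((1 - b) * v)) w _
      (is_Cd_exp _ _ _ (is_Cd_scal (1 - b) _ _ _ (is_Cd_id 0)))).
    cbv beta in H. rewrite Cmult_0_r, Cexp_0 in H. exact H. }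
  assert (HW : lim0 (fun t => reg_sol a b (Cexp (t * w))) (reg_sol a b 1)).
  { assert (HT : (Cmod (quad_var (Cexp 0)) < 1)%R).
    { rewrite Cexp_0, quad_var_1, Cmod_0. lra. }
    assert (H := lim0_path (fun v => reg_sol a b (Cexp v)) w _
      (is_Cd_comp (reg_sol a b) Cexp 0 _ _ (reg_sol_derive a b _ Hs (Cexp_neq0 0) HT) (Cexp_derive 0))).
    cbv beta in H. rewrite Cexp_0 in H. exact H. }
  assert (HG : lim0 G 0) by (apply power_one_minus_exp_lim0; auto).
  assert (HH : lim0 (fun t => disc_sol a b (Cexp (t * w)) * G t) (conn_const a b)).
  { apply abel_comparison; auto.
    - now apply subgeom_poch_div.
    - assert (H := poch_quotient_lim a (2 - b) (a + b - 1) Hb (nonpole_Re_pos _ Hp) ltac:(ring)).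
      revert H. apply Clim_ext. intro n. unfold poch_quot. rewrite poch_1. field.
      assert (H1 := poch_neq0 _ n (nonpole_Re_pos _ Hp)).
      repeat split; auto using INR_fact_neq0_C, poch_neq0. }
  apply (lim0_ext (fun t => disc_sol a b (Cexp (t * w)) * G t * X t
                            + (- c * reg_sol a b (Cexp (t * w))) * G t * X t)).
  { exists 1%R. split; [lra|]. intros t _. unfold first_integral, sol_diff. fold c. fold (G t) (X t). ring. }
  replace (conn_const a b) with (conn_const a b * 1 + - c * reg_sol a b 1 * 0 * 1) by ring.
  apply lim0_plus; apply lim0_mult; auto.
  apply lim0_mult; [|exact HG]. apply lim0_mult; [apply lim0_const|exact HW].
Qed.

(** Both solutions satisfy the same contiguous relation, up to an
    inhomogeneous term that cancels in the difference. *)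
Lemma first_integral_raise (a b w : C) : (forall n, 2 - b + INR n <> 0) -> nonpole (a + b) ->
  1 - (a + b) <> 0 -> log_domain w -> first_integral a b w = a / (a + b - 1) * first_integral (a + 1) b w.
Proof.
  intros Hb Hs Hs1 Hw.
  assert (Hz1 := log_domain_disc w Hw). assert (HT := log_domain_quad_var w Hw). assert (Hz := Cexp_neq0 w).
  assert (Hre := Re_one_minus _ Hz1).
  assert (Hs0 := nonpole_neq0 _ Hs).
  assert (Hs2 : a + b - 1 <> 0).
  { intro E. apply Hs1. replace (1 - (a + b)) with (- (a + b - 1)) by ring. rewrite E. ring. }
  assert (ER : sol_diff a b (Cexp w) = a / (a + b - 1) * (1 - Cexp w) * sol_diff (a + 1) b (Cexp w)).
  { set (z := Cexp w) in *. unfold sol_diff, disc_sol.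
    assert (O1 := poch_quot_ode a (2 - b) z Hb Hz1).
    assert (O2 := poch_quot_raise a (2 - b) z Hb Hz1).
    rewrite (reg_sol_raise a b z Hs Hz HT).
    set (h := psum (poch_quot a (2 - b)) z) in *. set (h1 := psum (poch_quot (a + 1) (2 - b)) z) in *.
    set (d := z * psum (dcoef (poch_quot a (2 - b))) z) in *.
    set (W1 := reg_sol (a + 1) b z).
    assert (E : h = (a * (1 - z) * h1 - (1 - b)) / (a + b - 1)).
    { transitivity (((1 - z) * (d + a * h) - ((1 - z) * d + (2 - b - 1 - a * z) * h)) / (a + b - 1)).
      - field. exact Hs2.
      - rewrite O1, <- O2. field. exact Hs2. }
    rewrite E. field. repeat split; auto.
    replace (1 - (a + 1 + b)) with (- (a + b)) by ring.
    intro E0. apply Hs0. replace (a + b) with (- - (a + b)) by ring. rewrite E0. ring. }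
  unfold first_integral. rewrite ER.
  replace (Cexp ((a + 1 + b - 1) * Clog (1 - Cexp w)))
    with (Cexp ((a + b - 1) * Clog (1 - Cexp w)) * (1 - Cexp w)).
  - ring.
  - replace ((a + 1 + b - 1) * Clog (1 - Cexp w))
      with ((a + b - 1) * Clog (1 - Cexp w) + Clog (1 - Cexp w)) by ring.
    rewrite Cexp_plus, (Cexp_Clog _ Hre). reflexivity.
Qed.

Lemma conn_const_raise a b : 1 - (a + b) <> 0 ->
  conn_const a b = a / (a + b - 1) * conn_const (a + 1) b.
Proof.
  intro Hs1.
  assert (Hs2 : a + b - 1 <> 0).
  { intro E. apply Hs1. replace (1 - (a + b)) with (- (a + b - 1)) by ring. rewrite E. ring. }
  unfold conn_const. rewrite (rGamma_S a).
  replace (a + 1 + b - 1) with (a + b - 1 + 1) by ring.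
  destruct (Gamma_S (a + b - 1)) as [->|E]; [|contradiction].
  unfold Cdiv. transitivity (a * / Gamma (a + 1) * Gamma (2 - b) * ((/ (a + b - 1) * (a + b - 1)) * Gamma (a + b - 1))).
  - rewrite Cinv_l by exact Hs2. ring.
  - ring.
Qed.

(** Raising [a] finitely often reaches [Re (a + b) > 1]. *)
Lemma first_integral_const (a b w : C) : (forall n, 2 - b + INR n <> 0) -> nonpole (a + b) ->
  1 - (a + b) <> 0 -> log_domain w -> first_integral a b w = conn_const a b.
Proof.
  intros Hb Hs Hs1 Hw.
  destruct (INR_eventually_gt (1 - Re (a + b))%R) as [N HN]. specialize (HN N (le_n N)).
  revert a Hs Hs1 HN. induction N as [|N IH]; intros a Hs Hs1 HN.
  - apply first_integral_const_large; auto. simpl in HN. simpl. lra.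
  - assert (E : a + 1 + b = a + b + 1) by ring.
    rewrite first_integral_raise, conn_const_raise by auto. f_equal. apply IH; rewrite E.
    + now apply nonpole_S.
    + intro E'. apply (nonpole_neq0 _ Hs).
      replace (a + b) with (- (1 - (a + b + 1))) by ring. rewrite E'. ring.
    + rewrite S_INR in HN. change (Re (a + b + 1)) with (Re (a + b) + 1)%R. lra.
Qed.

(** * The unit circle *)

(** Limit of [first_integral_const] along [w = i th - t] as [t -> 0]: the
    series [disc_sol] converges absolutely on the circle, and everything else
    is differentiable at [i th]. *)
Lemma boundary_connection (a b : C) (th : R) : (forall n, 2 - b + INR n <> 0) ->
  nonpole (a + b) -> (Re (a + b) < 1)%R -> (0 < Rabs th < PI)%R ->
  sol_diff a b (Cexp (0%R, th)) =
  conn_const a b * Cexp ((b - 1) * (0%R, th)) * Cexp ((1 - (a + b)) * Clog (1 - Cexp (0%R, th))).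
Proof.
  intros Hb Hs Hre Hth. set (w0 := (0%R, th) : C).
  assert (Hs1 : 1 - (a + b) <> 0).
  { apply Re_pos_neq0. change (0 < 1 + - Re (a + b))%R. lra. }
  assert (Hc1 : (cos th < 1)%R).
  { rewrite <- cos_Rabs, <- cos_0. apply cos_decreasing_1; lra. }
  assert (Hc2 : (-1 < cos th)%R).
  { rewrite <- cos_Rabs, <- cos_PI. apply cos_decreasing_1; lra. }
  assert (HT : (Cmod (quad_var (Cexp w0)) < 1)%R).
  { rewrite Cmod_quad_var_exp. unfold w0; simpl. rewrite cosh_0. lra. }
  assert (HR : (0 < Re (1 - Cexp w0))%R).
  { change (0 < 1 + - Re (Cexp w0))%R. rewrite Re_Cexp. unfold w0; simpl. rewrite exp_0. lra. }
  set (E := fun w => conn_const a b * Cexp ((b - 1) * w) * Cexp ((1 - (a + b)) * Clog (1 - Cexp w))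
                     + (1 - b) / (1 - (a + b)) * reg_sol a b (Cexp w)).
  assert (DE : exists l, is_Cd E w0 l).
  { eexists. apply is_Cd_plus; [apply is_Cd_mult; [apply is_Cd_scal|]|apply is_Cd_scal].
    - apply is_Cd_exp, is_Cd_scal, is_Cd_id.
    - apply is_Cd_exp, is_Cd_scal, Clog_one_minus_exp_derive, HR.
    - apply (is_Cd_comp (reg_sol a b) Cexp); [|apply Cexp_derive].
      apply reg_sol_derive; [exact Hs|apply Cexp_neq0|exact HT]. }
  destruct DE as [l DE].
  assert (HE : disc_sol a b (Cexp w0) = E w0).
  { apply (lim0_unique (fun t => disc_sol a b (Cexp (w0 + t * - (1))))).
    - apply (lim0_ext (fun t => disc_sol a b (exp (- t) * Cexp w0))).
      + exists 1%R. split; [lra|]. intros t _.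
        replace (w0 + t * - (1)) with ((- t)%R + w0) by (rewrite RtoC_opp; ring).
        now rewrite Cexp_plus, Cexp_R.
      + apply lim0_radial.
        * apply poch_div_summable; [exact Hb|].
          change (Re a + - (2 + - Re b) < -1)%R. change (Re a + Re b < 1)%R in Hre. lra.
        * rewrite Cmod_Cexp. unfold w0; simpl. apply exp_0.
    - apply (lim0_ext (fun t => E (w0 + t * - (1)))); [|exact (lim0_is_Cd E w0 _ l DE)].
      (* [cosh t <= 1 + 3 t ^ 2] for [t <= 1] keeps [w] in the domain. *)
      generalize (near0_and _ _ (near0_lt 1 ltac:(lra)) (near0_lt ((1 + cos th) / 3) ltac:(lra))).
      apply near0_imp. intros t Ht [Ht1 Ht2].
      set (w := w0 + t * - (1)).
      assert (Ew : w = (- t, th)%R) by (unfold w, w0; apply C_ext; simpl; ring).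
      assert (Hw : log_domain w).
      { rewrite Ew. unfold log_domain. simpl Re. simpl Im. repeat split; [lra|lra|].
        assert (cosh (- t) <= 1 + 3 * t ^ 2)%R; [|nra].
        unfold cosh. rewrite Ropp_involutive.
        destruct (exp_minus_1_id_le t) as [_ A1]. destruct (exp_minus_1_id_le (- t)) as [_ A2].
        rewrite Rabs_Ropp in A2. rewrite Rabs_pos_eq in A1, A2 by lra.
        assert (exp t <= 3)%R.
        { eapply Rle_trans; [|apply exp_le_3]. left. now apply exp_increasing. }
        assert (0 <= t ^ 2)%R by nra. nra. }
      assert (H := first_integral_const a b w Hb Hs Hs1 Hw). unfold first_integral in H.
      unfold E. rewrite <- H.
      replace ((b - 1) * w) with (- ((1 - b) * w)) by ring.
      replace ((1 - (a + b)) * Clog (1 - Cexp w))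
        with (- ((a + b - 1) * Clog (1 - Cexp w))) by ring.
      rewrite !Cexp_opp. unfold sol_diff. field. auto using Cexp_neq0. }
  unfold sol_diff. rewrite HE. unfold E. ring.
Qed.

(** This polar form has an argument in the range of [atan], so it determines
    the principal logarithm. *)
Lemma one_minus_Cexp_imag (x : R) : (0 < sin x)%R ->
  1 - Cexp (0%R, 2 * x)%R = Cexp (ln (2 * sin x), x - PI / 2)%R.
Proof.
  intro Hx. rewrite Cexp_imag. unfold Cexp. simpl Re. simpl Im.
  rewrite exp_ln by lra.
  replace (x - PI / 2)%R with (- (PI / 2 - x))%R by ring.
  rewrite cos_neg, sin_neg, cos_shift, sin_shift, sin_2a, cos_2a_sin.
  apply C_ext; simpl; ring.
Qed.

Lemma one_minus_Cexp_imag_opp (x : R) : (0 < sin x)%R ->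
  1 - Cexp (0%R, - (2 * x))%R = Cexp (ln (2 * sin x), PI / 2 - x)%R.
Proof.
  intro Hx. rewrite Cexp_imag. unfold Cexp. simpl Re. simpl Im.
  rewrite exp_ln, cos_neg, sin_neg, cos_shift, sin_shift, sin_2a, cos_2a_sin by lra.
  apply C_ext; simpl; ring.
Qed.

Lemma F32_term_even_coef (a b z : C) n :
  F32_term 1 a b ((a + b) / 2) ((1 + a + b) / 2) z n = even_coef a b n * z ^ n.
Proof.
  unfold F32_term, even_coef. rewrite poch_1. unfold Cdiv.
  transitivity (INR (fact n) * / INR (fact n) * (poch a n * poch b n
    * / (poch ((a + b) * / 2) n * poch ((1 + a + b) * / 2) n) * z ^ n)); [ring|].
  rewrite Cinv_r by apply INR_fact_neq0_C. ring.
Qed.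

Lemma quad_var_circle (x : R) : quad_var (Cexp (0%R, 2 * x)%R) = RtoC (sin x ^ 2)%R.
Proof.
  assert (H4 := C4_nz).
  assert (Hu := Cexp_neq0 (0%R, x)).
  unfold quad_var. rewrite Cexp_imag_double.
  transitivity (- / 4 * (Cexp (0%R, x) - / Cexp (0%R, x)) ^ 2); [field; auto|].
  rewrite <- Cexp_imag_opp, !Cexp_imag, cos_neg, sin_neg.
  replace (_ - _) with (2 * Ci * RtoC (sin x)) by (apply C_ext; simpl; ring).
  rewrite RtoC_pow. transitivity (- (Ci * Ci) * RtoC (sin x) ^ 2).
  - field.
  - replace (Ci * Ci) with (- RtoC 1) by (apply C_ext; simpl; ring). ring.
Qed.

Lemma quad_var_inv (z : C) : z <> 0 -> quad_var (/ z) = quad_var z.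
Proof.
  intro Hz. assert (H4 := C4_nz).
  unfold quad_var. field. auto.
Qed.

(** The odd parts cancel, and what is left is the hypergeometric series times
    [cos x]. *)
Lemma reg_sol_even_part (a b : C) (x : R) :
  psum (even_coef a b) (RtoC (sin x ^ 2)%R) * RtoC (cos x)
  = / 2 * (Cexp (0%R, x) * reg_sol a b (Cexp (0%R, 2 * x)%R)
           + Cexp (0%R, - x)%R * reg_sol a b (Cexp (0%R, - (2 * x))%R)).
Proof.
  assert (Hu := Cexp_neq0 (0%R, x)).
  rewrite !Cexp_imag_opp. unfold reg_sol.
  rewrite quad_var_inv by apply Cexp_neq0. rewrite quad_var_circle, RtoC_cos, Cexp_imag_double.
  field. auto using C2_nz.
Qed.

Lemma cos_series (a b : C) (x : R) : (forall n, 2 - b + INR n <> 0) ->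
  (Re (a + b) < 1)%R ->
  Csum (fun n => poch a n / poch (2 - b) n * RtoC (cos ((2 * INR n + 1) * x)%R))
    (/ 2 * (Cexp (0%R, x) * disc_sol a b (Cexp (0%R, 2 * x)%R)
            + Cexp (0%R, - x)%R * disc_sol a b (Cexp (0%R, - (2 * x))%R))).
Proof.
  intros Hb Hre.
  assert (HS : forall y : R, Csum (fun n => poch_quot a (2 - b) n * Cexp (0%R, y) ^ n)
                               (disc_sol a b (Cexp (0%R, y)))).
  { intro y. apply Csum_abs. apply (ex_series_ext (fun n => Cmod (poch_quot a (2 - b) n))).
    - intro n. rewrite Cmod_mult, Cmod_pow, Cmod_Cexp. simpl Re. rewrite exp_0, pow1.
      symmetry. apply Rmult_1_r.
    - apply poch_div_summable; [exact Hb|].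
      change (Re a + - (2 + - Re b) < -1)%R. change (Re a + Re b < 1)%R in Hre. lra. }
  generalize (Csum_scal (/ 2) _ _ (Csum_plus _ _ _ _
    (Csum_scal (Cexp (0%R, x)) _ _ (HS (2 * x)%R))
    (Csum_scal (Cexp (0%R, - x)%R) _ _ (HS (- (2 * x))%R)))).
  apply Csum_ext. intro n. rewrite RtoC_cos.
  assert (E : Cexp (0%R, (2 * INR n + 1) * x)%R = Cexp (0%R, x) * Cexp (0%R, 2 * x)%R ^ n).
  { rewrite Cexp_pow, <- Cexp_plus. f_equal. apply C_ext; simpl; ring. }
  rewrite E, !Cexp_imag_opp, Cpow_inv by apply Cexp_neq0.
  fold (poch_quot a (2 - b) n). field.
  repeat split; auto using C2_nz, Cexp_neq0, Cpow_nz.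
Qed.

Theorem proposition6 (a b : C) (x : R)
  (Hab : (Re (a + b) < 1)%R)
  (Hb : forall n : nat, (1 <= n)%nat -> b <> RtoC (INR n))
  (Hpole : forall n : nat, a + b <> - RtoC (INR n))
  (Hx : (0 < x < PI / 2)%R) :
  ex_Cseries (F32_term 1 a b ((a + b) / 2) ((1 + a + b) / 2)
                (RtoC (sin x ^ 2)%R)) /\
  ex_Cseries (fun n : nat =>
    poch a n / poch (2 - b) n * RtoC (cos ((2 * INR n + 1) * x)%R)) /\
  F32 1 a b ((a + b) / 2) ((1 + a + b) / 2) (RtoC (sin x ^ 2)%R)
    * RtoC (cos x)
  = (a + b - 1) / (b - 1)
      * CSeries (fun n : nat =>
          poch a n / poch (2 - b) n * RtoC (cos ((2 * INR n + 1) * x)%R))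
    + Gamma (a + b) * Gamma (1 - b)
        / (Gamma a * RCpower (2 * sin x)%R (a + b - 1))
        * Csin (RtoC (PI / 2)%R * (a + b) + RtoC x * (b - a)).
Proof.
  assert (Hb2 : forall n, 2 - b + INR n <> 0).
  { intros n E. apply (Hb (S (S n))); [lia|]. rewrite !RtoC_INR_S.
    replace b with (2 + INR n - (2 - b + INR n)) by ring. rewrite E.
    replace (RtoC 2) with (RtoC 1 + 1) by (rewrite <- RtoC_plus; f_equal; lra). ring. }
  assert (Hb1 : 1 - b <> 0).
  { intro E. apply (Hb 1%nat); [lia|]. simpl. replace b with (1 - (1 - b)) by ring.
    rewrite E. ring. }
  assert (Hb1' : b - 1 <> 0).
  { intro E. apply Hb1. replace (1 - b) with (- (b - 1)) by ring. rewrite E. ring. }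
  assert (Hs : nonpole (a + b)).
  { intros n E. apply (Hpole n). replace (a + b) with (a + b + INR n - INR n) by ring.
    rewrite E. ring. }
  assert (Hs1 : 1 - (a + b) <> 0).
  { apply Re_pos_neq0. change (0 < 1 + - Re (a + b))%R. lra. }
  assert (Hs1' : a + b - 1 <> 0).
  { intro E. apply Hs1. replace (1 - (a + b)) with (- (a + b - 1)) by ring. rewrite E. ring. }
  assert (Hsin : (0 < sin x)%R) by (apply sin_gt_0; lra).
  assert (Hcos : (0 < cos x)%R) by (apply cos_gt_0; lra).
  assert (HT : (Cmod (RtoC (sin x ^ 2)%R) < 1)%R).
  { rewrite Cmod_R, Rabs_pos_eq by nra. generalize (sin2_cos2 x). unfold Rsqr. nra. }
  assert (S1 : Csum (F32_term 1 a b ((a + b) / 2) ((1 + a + b) / 2) (RtoC (sin x ^ 2)%R))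
                 (psum (even_coef a b) (RtoC (sin x ^ 2)%R))).
  { apply (Csum_ext (fun n => even_coef a b n * RtoC (sin x ^ 2)%R ^ n)).
    - intro n. now rewrite F32_term_even_coef.
    - apply subgeom_psum; [now apply subgeom_even_coef|exact HT]. }
  assert (S2 := cos_series a b x Hb2 Hab).
  split; [exact (Csum_ex _ _ S1)|]. split; [exact (Csum_ex _ _ S2)|].
  unfold F32. rewrite (Csum_unique _ _ S1), (Csum_unique _ _ S2), reg_sol_even_part.
  assert (B1 := boundary_connection a b (2 * x)%R Hb2 Hs Hab).
  assert (B2 := boundary_connection a b (- (2 * x))%R Hb2 Hs Hab).
  rewrite Rabs_Ropp in B2. rewrite Rabs_pos_eq in B1, B2 by lra.
  specialize (B1 ltac:(lra)). specialize (B2 ltac:(lra)).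
  rewrite one_minus_Cexp_imag, Clog_Cexp in B1 by (simpl; lra).
  rewrite one_minus_Cexp_imag_opp, Clog_Cexp in B2 by (simpl; lra).
  set (th := RtoC (PI / 2)%R * (a + b) + RtoC x * (b - a)).
  set (P := RCpower (2 * sin x)%R (a + b - 1)).
  assert (HP : P <> 0) by apply RCpower_neq0.
  assert (Ephase : Cexp (0%R, PI / 2)%R = Ci).
  { rewrite Cexp_imag, cos_PI2, sin_PI2. reflexivity. }
  assert (Hi : Ci <> 0) by (intro E; injection E; lra).
  assert (U1 : Cexp (0%R, x) * sol_diff a b (Cexp (0%R, 2 * x)%R)
               = conn_const a b * (Cexp (Ci * th) / (Ci * P))).
  { rewrite B1. replace (Ci * P) with (Cexp (0%R, PI / 2)%R * P) by now rewrite Ephase.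
    unfold P, RCpower, Cdiv.
    rewrite <- Cexp_plus, <- Cexp_opp.
    transitivity (conn_const a b * (Cexp (0%R, x) * Cexp ((b - 1) * (0%R, (2 * x)%R))
      * Cexp ((1 - (a + b)) * (ln (2 * sin x), x - PI / 2)%R))); [ring|].
    rewrite <- !Cexp_plus. do 2 f_equal. unfold th.
    destruct a, b. apply C_ext; simpl; field. }
  assert (U2 : Cexp (0%R, - x)%R * sol_diff a b (Cexp (0%R, - (2 * x))%R)
               = conn_const a b * (Ci * Cexp (- (Ci * th)) / P)).
  { rewrite B2.
    replace (Ci * Cexp (- (Ci * th))) with (Cexp (0%R, PI / 2)%R * Cexp (- (Ci * th)))
      by now rewrite Ephase.
    unfold P, RCpower, Cdiv.
    rewrite <- Cexp_plus, <- Cexp_opp.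
    transitivity (conn_const a b * (Cexp (0%R, - x)%R * Cexp ((b - 1) * (0%R, (- (2 * x))%R))
      * Cexp ((1 - (a + b)) * (ln (2 * sin x), PI / 2 - x)%R))); [ring|].
    rewrite <- !Cexp_plus. do 2 f_equal. unfold th.
    destruct a, b. apply C_ext; simpl; field. }
  assert (EK : conn_const a b = / Gamma a * ((1 - b) * Gamma (1 - b)) * (Gamma (a + b) / (a + b - 1))).
  { unfold conn_const. f_equal; [f_equal|].
    - destruct (Gamma_S (1 - b)) as [E|E]; [|contradiction].
      rewrite <- E. f_equal. replace (RtoC 2) with (RtoC 1 + 1) by (rewrite <- RtoC_plus; f_equal; lra).
      ring.
    - destruct (Gamma_S (a + b - 1)) as [E|E]; [|contradiction].
      replace (a + b - 1 + 1) with (a + b) in E by ring. rewrite E. field. exact Hs1'. }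
  unfold sol_diff in U1, U2. rewrite EK in U1, U2.
  set (h1 := disc_sol a b (Cexp (0%R, 2 * x)%R)) in *.
  set (h2 := disc_sol a b (Cexp (0%R, - (2 * x))%R)) in *.
  set (W1 := reg_sol a b (Cexp (0%R, 2 * x)%R)) in *.
  set (W2 := reg_sol a b (Cexp (0%R, - (2 * x))%R)) in *.
  set (u1 := Cexp (0%R, x)) in *. set (u2 := Cexp (0%R, - x)%R) in *.
  (* Each value of the analytic solution is traded for the disc series and the
     difference, which [U1] and [U2] evaluate. *)
  assert (EW : forall u h W, u * W = (1 - (a + b)) / (1 - b)
            * (u * h - u * (h - (1 - b) / (1 - (a + b)) * W))) by (intros; field; auto).
  rewrite (EW u1 h1 W1), (EW u2 h2 W2), U1, U2.
  unfold Csin.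
  replace (Gamma (a + b) * Gamma (1 - b) / (Gamma a * P))
    with (Gamma (a + b) * Gamma (1 - b) * (/ Gamma a * / P))
    by (unfold Cdiv; now rewrite Cinv_mult_total).
  generalize (/ Gamma a). intro g.
  assert (Ei : Ci * Ci = - (1)) by (apply C_ext; simpl; ring).
  set (E1 := Cexp (Ci * th)). set (E2 := Cexp (- (Ci * th))).
  replace (Ci * E2 / P) with (- (E2 / (Ci * P))).
  - field. auto 10 using C2_nz.
  - transitivity (Ci * Ci * (- (1)) * (- (E2 / (Ci * P)))).
    + rewrite Ei. ring.
    + field. auto.
Qed.
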